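(* Suppose the network satisfies the Foster–Lyapunov condition (FL$_+$) of the context. Then for any $\kappa\ge1$ there exist constants $\widetilde C_0$ and $\widetilde C_1$, depending only on $\kappa$ (and the network parameters), such that $$\mathbb E^{Z^n}\Bigl[\int_0^T|\hat X^n(s)|^\kappa\,ds\Bigr]\ \le\ \widetilde C_0\bigl(T+|\hat X^n(0)|^\kappa\bigr)+\widetilde C_1\,\mathbb E^{Z^n}\Bigl[\int_0^T\bigl(1+|\hat Q^n(s)|\bigr)^\kappa ds\Bigr]$$ for all $T>0$, all $n\in\mathbb N$, and any sequence of admissible policies $\{Z^n\in\mathfrak Z^n,\ n\in\mathbb N\}$.
   Context: **Network.** Fix $I,J\in\mathbb N$, $\mathcal I=\{1,\dots,I\}$ (customer classes), $\mathcal J=\{1,\dots,J\}$ (server pools), an edge set $\mathcal E\subset\mathcal I\times\mathcal J$; write $i\sim j$ if $(i,j)\in\mathcal E$, $\mathcal J(i)=\{j:i\sim j\}$, $\mathcal I(j)=\{i:i\sim j\}$. The bipartite graph $\mathcal G=(\mathcal I\cup\mathcal J,\mathcal E)$ is a tree. $\mathbb R_+^{\mathcal G}$ (resp. $\mathbb Z_+^{\mathcal G}$) is the set of $I\times J$ matrices with nonnegative real (resp. integer) entries vanishing for $i\nsim j$. $e=(1,\dots,1)^{\mathsf T}$; $|\cdot|$ is the Euclidean norm; $a^+=\max(a,0)$, $a^-=\max(-a,0)$. In the $n$-th system class $i$ has Poisson arrivals of rate $\lambda_i^n>0$, exponential abandonment rate $\gamma_i^n\ge0$ per waiting customer, and is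 served at exponential rate $\mu_{ij}^n$ in pool $j$ ($\mu^n_{ij}>0$ iff $i\sim j$, else $0$); pool $j$ has $N_j^n$ servers. Arrival, service and abandonment processes are mutually independent. Halfin–Whitt scaling: there are $\lambda_i,\nu_j>0$, $\gamma_i\ge0$, $\mu_{ij}\ge 0$ ($\mu_{ij}>0$ iff $i\sim j$) and real $\hat\lambda_i,\hat\mu_{ij},\hat\nu_j$ with $(\lambda_i^n-n\lambda_i)/\sqrt n\to\hat\lambda_i$, $\sqrt n(\mu_{ij}^n-\mu_{ij})\to\hat\mu_{ij}$, $(N_j^n-n\nu_j)/\sqrt n\to\hat\nu_j$, $\gamma_i^n\to\gamma_i$. Fluid equilibrium: the linear program ''minimize $\max_j\sum_i\xi_{ij}$ subject to $\sum_j\mu_{ij}\nu_j\xi_{ij}=\lambda_i$ for all $i$, $[\xi_{ij}]\in\mathbb R_+^{\mathcal G}$'' has a unique solution $\xi^*$, and $\sum_i\xi^*_{ij}=1$ for all $j$, $\xi^*_{ij}>0$ for all $i\sim j$. Put $z^*_{ij}=\xi^*_{ij}\nu_j$, $x_i^*=\sum_j z_{ij}^*$. **Processes and policies.** $X_i^n$ = number of class-$i$ customers in the system, $Q_i^n$ = number in queue, $Z_{ij}^n$ = number of class-$i$ customers in service in pool $j$, $Y_j^n$ = number of idle servers in pool $j$; $X_i^n=Q_i^n+\sum_jZ_{ij}^n$, $N_j^n=Y_j^n+\sum_iZ_{ij}^n$. For $x\in\mathbb Z_+^I$, $z\in\mathbb Z_+^{\mathcal G}$ let $q_i(x,z)=x_i-\sum_jz_{ij}$,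 $y_j^n(z)=N_j^n-\sum_iz_{ij}$, and the action set $\mathcal Z^n(x)=\{z\in\mathbb Z_+^{\mathcal G}: q_i(x,z)\wedge y_j^n(z)=0,\ q_i(x,z)\ge0,\ y_j^n(z)\ge0\ \forall (i,j)\in\mathcal E\}$ (work conservation). With independent rate-1 Poisson processes $A_i^n,S_{ij}^n,R_i^n$ (independent of $X^n(0)$), $$X_i^n(t)=X_i^n(0)+A_i^n(\lambda_i^nt)-\sum_{j\in\mathcal J(i)}S_{ij}^n\Bigl(\mu_{ij}^n\!\int_0^t\! Z_{ij}^n\,ds\Bigr)-R_i^n\Bigl(\gamma_i^n\!\int_0^t\! Q_i^n\,ds\Bigr).$$ Let $\tilde A_i^n(t),\tilde S_{ij}^n(t),\tilde R_i^n(t)$ denote the three time-changed processes on the right, $\mathscr F_t^n$ the $\sigma$-field generated by $X^n(0)$, these processes up to time $t$, and null sets; and $\mathscr G_t^n$ the $\sigma$-field generated by the future increments $\tilde A_i^n(t+r)-\tilde A_i^n(t)$, $\delta\tilde S^n_{ij}(t,r)=S_{ij}^n(\mu_{ij}^n\int_0^tZ_{ij}^nds+\mu_{ij}^nr)-\tilde S_{ij}^n(t)$, $\delta\tilde R^n_i(t,r)=R_i^n(\gamma_i^n\int_0^tQ_i^nds+\gamma_i^nr)-\tilde R_i^n(t)$, $r\ge0$. A policy $Z^n$ is admissible, $Z^n\in\mathfrak Z^n$, if $Z^n(t)\in\mathcal Z^n(X^n(t))$ a.s. for all $t$; $Z^n(t)$ is $\mathscr F_t^n$-adapted; $\mathscr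 F_t^n$ is independent of $\mathscr G_t^n$ for each $t$; and for each $t$, $\delta\tilde S_{ij}^n(t,\cdot)$, $\delta\tilde R_i^n(t,\cdot)$ have the laws of $S_{ij}^n(\mu_{ij}^n\cdot)$, $R_i^n(\gamma_i^n\cdot)$. $\mathbb E^{Z^n}$ is expectation under $Z^n$; the initial condition $X^n(0)$ is deterministic. **Diffusion scaling.** $\hat X_i^n=(X_i^n-nx_i^* )/\sqrt n$, $\hat Q^n=Q^n/\sqrt n$, $\hat Y^n=Y^n/\sqrt n$. **Limiting drift.** Let $D_\Psi=\{(\alpha,\beta)\in\mathbb R^I\times\mathbb R^J: e\cdot\alpha=e\cdot\beta\}$ and let $\Psi:D_\Psi\to\mathbb R^{I\times J}$ be the unique linear map with $\sum_j\Psi_{ij}(\alpha,\beta)=\alpha_i$, $\sum_i\Psi_{ij}(\alpha,\beta)=\beta_j$, $\Psi_{ij}=0$ for $i\nsim j$. $\mathbb U=\{(u^c,u^s)\in\mathbb R_+^I\times\mathbb R_+^J: e\cdot u^c=e\cdot u^s=1\}$; $\hat\Psi[u](x)=\Psi(x-(e\cdot x)^+u^c,-(e\cdot x)^-u^s)$; $\ell_i=\hat\lambda_i-\sum_{j\in\mathcal J(i)}\hat\mu_{ij}z^*_{ij}$; $b_i(x,u)=\ell_i-\sum_{j\in\mathcal J(i)}\mu_{ij}\hat\Psi_{ij}[u](x)-\gamma_i(e\cdot x)^+u_i^c$. **Condition (FL$_+$).** For a positive vector $\beta\in\mathbb R^I$ let $\|x\|_\beta=(\sum_i\beta_i|x_i|^2)^{1/2}$,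 and let $\mathcal V_{\kappa,\beta}$, $\kappa\ge1$, denote a $C^2(\mathbb R^I)$ function which agrees with $\|x\|_\beta^\kappa$ on the complement of the unit ball. For $\delta>0$ let $\mathcal K_{\delta,+}=\{x\in\mathbb R^I: e\cdot x>\delta|x|\}$. (FL$_+$): for any $\kappa\ge1$ there exist a function $\mathcal V_{\kappa,\beta}$ of this kind, $\delta>0$, and positive constants $c_0,c_1,c_2$ such that for all $(x,u)\in\mathbb R^I\times\mathbb U$, $$b(x,u)\cdot\nabla\mathcal V_{\kappa,\beta}(x)\le c_0+c_1\mathcal V_{\kappa,\beta}(x)\mathbf 1_{\mathcal K_{\delta,+}}(x)-c_2\mathcal V_{\kappa,\beta}(x)\mathbf 1_{\mathcal K_{\delta,+}^c}(x).$$ *)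

(* Defs.v *)
From HB Require Import structures.
From mathcomp Require Import all_boot all_order all_algebra.
From mathcomp Require Import all_classical all_reals all_analysis.

Set Implicit Arguments.
Unset Strict Implicit.
Unset Printing Implicit Defensive.

Import Order.TTheory GRing.Theory Num.Theory.
Import numFieldNormedType.Exports.

Local Open Scope classical_set_scope.
Local Open Scope ring_scope.

(* The norm `|x| of the library on 'rV[R]_n is the sup norm; the Euclidean
   norm is needed here. *)
Definition enorm (R : realType) (n : nat) (x : 'rV[R]_n) : R :=
  Num.sqrt (\sum_(i < n) x 0 i ^+ 2).

Definition bnorm (R : realType) (n : nat) (beta x : 'rV[R]_n) : R :=
  Num.sqrt (\sum_(i < n) beta 0 i * `|x 0 i| ^+ 2).

Definition edot (R : realType) (n : nat) (x : 'rV[R]_n) : R :=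
  \sum_(i < n) x 0 i.

Definition pospart (R : realType) (a : R) : R := Num.max a 0.
Definition negpart (R : realType) (a : R) : R := Num.max (- a) 0.

Definition partial (R : realType) (n : nat) (i : 'I_n) (f : 'rV[R]_n -> R) :
  'rV[R]_n -> R := fun x => 'D_(delta_mx 0 i) f x.

Definition is_C1 (R : realType) (n : nat) (f : 'rV[R]_n -> R) : Prop :=
  forall i : 'I_n, (forall x, derivable f x (delta_mx 0 i)) /\
                   continuous (partial i f).

Definition is_C2 (R : realType) (n : nat) (f : 'rV[R]_n -> R) : Prop :=
  is_C1 f /\ forall i : 'I_n, is_C1 (partial i f).

(* The sequence of systems is indexed by [n : nat], but only the systems with
   [0 < n] are meaningful: the fields suffixed by [_n] are junk at [n = 0]. *)
Record network (R : realType) (I J : nat) := Network {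
  edge : 'I_I -> 'I_J -> bool;
  lambda_n : nat -> 'I_I -> R;
  gamma_n : nat -> 'I_I -> R;
  mu_n : nat -> 'I_I -> 'I_J -> R;
  servers_n : nat -> 'I_J -> nat;
  lambda : 'I_I -> R;
  gamma : 'I_I -> R;
  mu : 'I_I -> 'I_J -> R;
  nu : 'I_J -> R;
  lambda_hat : 'I_I -> R;
  mu_hat : 'I_I -> 'I_J -> R;
  nu_hat : 'I_J -> R;
  xi_star : 'M[R]_(I, J)
}.

Definition bipartite_rel (R : realType) (I J : nat) (net : network R I J) :
    rel ('I_I + 'I_J) :=
  fun a b => match a, b with
             | inl i, inr j => edge net i j
             | inr j, inl i => edge net i j
             | _, _ => false
             end.

(* In the library [cycle e [:: a; b]] holds as soon as [a] and [b] are
   adjacent, hence the lower bound on the length of a genuine cycle. *)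
Definition is_tree (T : finType) (e : rel T) : Prop :=
  (forall a b : T, connect e a b) /\
  (forall c : seq T, (2 < size c)%N -> uniq c -> ~~ cycle e c).

Definition LP_feasible (R : realType) (I J : nat) (net : network R I J)
    (xi : 'M[R]_(I, J)) : Prop :=
  [/\ forall i j, 0 <= xi i j,
      forall i j, ~~ edge net i j -> xi i j = 0
    & forall i, \sum_(j < J) mu net i j * nu net j * xi i j = lambda net i].

(* On feasible points all the loads are nonnegative, so the default value 0 of
   the iterated maximum is harmless. *)
Definition LP_objective (R : realType) (I J : nat) (xi : 'M[R]_(I, J)) : R :=
  \big[Num.max/0]_(j < J) \sum_(i < I) xi i j.

Definition LP_solution (R : realType) (I J : nat) (net : network R I J)
    (xi : 'M[R]_(I, J)) : Prop :=
  LP_feasible net xi /\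
  forall xi', LP_feasible net xi' -> LP_objective xi <= LP_objective xi'.

Record network_assumptions (R : realType) (I J : nat) (net : network R I J) :
    Prop := {
  classes_gt0 : (0 < I)%N;
  pools_gt0 : (0 < J)%N;
  net_tree : is_tree (bipartite_rel net);
  lambda_n_gt0 : forall n i, (0 < n)%N -> 0 < lambda_n net n i;
  gamma_n_ge0 : forall n i, (0 < n)%N -> 0 <= gamma_n net n i;
  mu_n_gt0 : forall n i j, (0 < n)%N -> edge net i j -> 0 < mu_n net n i j;
  mu_n_eq0 : forall n i j, (0 < n)%N -> ~~ edge net i j -> mu_n net n i j = 0;
  lambda_gt0 : forall i, 0 < lambda net i;
  nu_gt0 : forall j, 0 < nu net j;
  gamma_ge0 : forall i, 0 <= gamma net i;
  mu_gt0 : forall i j, edge net i j -> 0 < mu net i j;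
  mu_eq0 : forall i j, ~~ edge net i j -> mu net i j = 0;
  lambda_cvg : forall i,
    (lambda_n net n i - n%:R * lambda net i) / Num.sqrt n%:R
      @[n --> \oo] --> lambda_hat net i;
  mu_cvg : forall i j,
    Num.sqrt n%:R * (mu_n net n i j - mu net i j)
      @[n --> \oo] --> mu_hat net i j;
  nu_cvg : forall j,
    ((servers_n net n j)%:R - n%:R * nu net j) / Num.sqrt n%:R
      @[n --> \oo] --> nu_hat net j;
  gamma_cvg : forall i, gamma_n net n i @[n --> \oo] --> gamma net i;
  xi_star_opt : LP_solution net (xi_star net);
  xi_star_unique : forall xi, LP_solution net xi -> xi = xi_star net;
  xi_star_full : forall j, \sum_(i < I) xi_star net i j = 1;
  xi_star_gt0 : forall i j, edge net i j -> 0 < xi_star net i j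
}.

Definition z_star (R : realType) (I J : nat) (net : network R I J)
  (i : 'I_I) (j : 'I_J) : R := xi_star net i j * nu net j.

Definition x_star (R : realType) (I J : nat) (net : network R I J)
  (i : 'I_I) : R := \sum_(j < J) z_star net i j.

(* The values of [Psi] outside the domain [edot a = edot b] are irrelevant;
   on the domain these properties determine [Psi]. *)
Definition is_Psi (R : realType) (I J : nat) (net : network R I J)
    (Psi : 'rV[R]_I -> 'rV[R]_J -> 'M[R]_(I, J)) : Prop :=
  (forall (c : R) (a a' : 'rV[R]_I) (b b' : 'rV[R]_J),
     edot a = edot b -> edot a' = edot b' ->
     Psi (c *: a + a') (c *: b + b') = c *: Psi a b + Psi a' b') /\
  (forall (a : 'rV[R]_I) (b : 'rV[R]_J), edot a = edot b ->
     [/\ forall i, \sum_(j < J) Psi a b i j = a 0 i,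
         forall j, \sum_(i < I) Psi a b i j = b 0 j
       & forall i j, ~~ edge net i j -> Psi a b i j = 0]).

Definition in_U (R : realType) (I J : nat) (u : 'rV[R]_I * 'rV[R]_J) : Prop :=
  [/\ forall i, 0 <= u.1 0 i, forall j, 0 <= u.2 0 j,
      edot u.1 = 1 & edot u.2 = 1].

Definition Psi_hat (R : realType) (I J : nat)
    (Psi : 'rV[R]_I -> 'rV[R]_J -> 'M[R]_(I, J))
    (u : 'rV[R]_I * 'rV[R]_J) (x : 'rV[R]_I) : 'M[R]_(I, J) :=
  Psi (x - pospart (edot x) *: u.1) (- (negpart (edot x) *: u.2)).

Definition ell (R : realType) (I J : nat) (net : network R I J)
    (i : 'I_I) : R :=
  lambda_hat net i - \sum_(j < J | edge net i j) mu_hat net i j * z_star net i j.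

Definition drift (R : realType) (I J : nat) (net : network R I J)
    (Psi : 'rV[R]_I -> 'rV[R]_J -> 'M[R]_(I, J))
    (x : 'rV[R]_I) (u : 'rV[R]_I * 'rV[R]_J) (i : 'I_I) : R :=
  ell net i - \sum_(j < J | edge net i j) mu net i j * Psi_hat Psi u x i j
  - gamma net i * pospart (edot x) * u.1 0 i.

Definition is_lyapunov (R : realType) (n : nat) (kappa : R) (beta : 'rV[R]_n)
    (V : 'rV[R]_n -> R) : Prop :=
  is_C2 V /\ forall x, 1 <= enorm x -> V x = bnorm beta x `^ kappa.

Definition cone_plus (R : realType) (n : nat) (delta : R) : set 'rV[R]_n :=
  [set x | delta * enorm x < edot x].

Definition FL_plus (R : realType) (I J : nat) (net : network R I J)
    (Psi : 'rV[R]_I -> 'rV[R]_J -> 'M[R]_(I, J)) : Prop :=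
  forall kappa : R, 1 <= kappa ->
  exists (beta : 'rV[R]_I) (V : 'rV[R]_I -> R) (delta c0 c1 c2 : R),
    [/\ forall i, 0 < beta 0 i,
        is_lyapunov kappa beta V,
        0 < delta,
        [/\ 0 < c0, 0 < c1 & 0 < c2]
      & forall (x : 'rV[R]_I) (u : 'rV[R]_I * 'rV[R]_J), in_U u ->
          \sum_(i < I) drift net Psi x u i * partial i V x
          <= c0 + c1 * V x * \1_(cone_plus delta) x
             - c2 * V x * \1_(~` cone_plus delta) x].

Definition indep_family (R : realType) (d : measure_display)
    (Omega : measurableType d) (P : probability Omega R)
    (K : finType) (A : pred K) (F : K -> set (set Omega)) : Prop :=
  forall E : K -> set Omega, (forall k, A k -> F k (E k)) ->
    P (\bigcap_(k in [set k | A k]) E k)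
    = (\prod_(k | A k) fine (P (E k)))%:E.

Definition indep_classes (R : realType) (d : measure_display)
    (Omega : measurableType d) (P : probability Omega R)
    (F G : set (set Omega)) : Prop :=
  forall A B, F A -> G B -> P (A `&` B) = (P A * P B)%E.

(* Preimages of all sets of naturals under the [Y i], [i \in D]. *)
Definition events (Omega T : Type) (D : set T) (Y : T -> Omega -> nat) :
  set (set Omega) := [set E | exists2 i, D i & exists B, E = Y i @^-1` B].

(* Rate-1 Poisson process, as a counting process with right-continuous
   nondecreasing paths; only its values at times [t >= 0] are meaningful, and
   it is extended by 0 to negative times. *)
Record is_poisson (R : realType) (d : measure_display)
    (Omega : measurableType d) (P : probability Omega R)
    (N : R -> Omega -> nat) : Prop := {
  poisson_meas : forall t, measurable_fun setT (N t);
  poisson_zero : forall t w, t <= 0 -> N t w = 0%N;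
  poisson_mono : forall s t w, s <= t -> (N s w <= N t w)%N;
  poisson_rcont : forall t w, \forall s \near t^'+, N s w = N t w;
  poisson_incr : forall s t k, 0 <= s -> s < t ->
    P [set w | (N t w - N s w)%N = k] = (poisson_pmf (t - s) k)%:E;
  poisson_indep : forall s t, 0 <= s -> s < t ->
    indep_classes P <<s events [set r | 0 <= r <= s] N >>
                    <<s events [set: unit] (fun _ w => (N t w - N s w)%N) >>
}.

(* Equality of the laws of two processes on [0, oo[, i.e. of their
   finite-dimensional distributions. *)
Definition same_law (R : realType) (d : measure_display)
    (Omega : measurableType d) (P : probability Omega R)
    (U V : R -> Omega -> nat) : Prop :=
  forall (m : nat) (r : 'I_m -> R) (k : 'I_m -> nat), (forall l, 0 <= r l) ->
    P [set w | forall l, U (r l) w = k l] = P [set w | forall l, V (r l) w = k l].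

(* Index of the driving Poisson processes: [inl (inl i)] for [A_i],
   [inl (inr (i, j))] for [S_ij], and [inr i] for [R_i]. *)
Definition source (I J : nat) : finType := ('I_I + 'I_I * 'I_J + 'I_I)%type.

(* There is no service process off the edges; the values of the driving family
   at such indices are junk and always ignored. *)
Definition active (R : realType) (I J : nat) (net : network R I J) :
    pred (source I J) :=
  fun k => match k with inl (inr (i, j)) => edge net i j | _ => true end.

Definition queue (I J : nat) (x : 'I_I -> nat) (z : 'I_I -> 'I_J -> nat)
  (i : 'I_I) : int := (x i)%:Z - \sum_(j < J) (z i j)%:Z.

Definition idle (R : realType) (I J : nat) (net : network R I J) (n : nat)
  (z : 'I_I -> 'I_J -> nat) (j : 'I_J) : int :=
  (servers_n net n j)%:Z - \sum_(i < I) (z i j)%:Z.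

Definition action (R : realType) (I J : nat) (net : network R I J) (n : nat)
    (x : 'I_I -> nat) (z : 'I_I -> 'I_J -> nat) : Prop :=
  (forall i j, ~~ edge net i j -> z i j = 0%N) /\
  (forall i j, edge net i j ->
     [/\ Num.min (queue x z i) (idle net n z j) = 0,
         0 <= queue x z i & 0 <= idle net n z j]).

Section Processes.
Context (R : realType) (I J : nat) (net : network R I J) (n : nat).
Context (d : measure_display) (Omega : measurableType d)
  (P : probability Omega R).
Context (N : source I J -> R -> Omega -> nat).
Context (X : R -> Omega -> 'I_I -> nat).
Context (Z : R -> Omega -> 'I_I -> 'I_J -> nat).

Definition rate (k : source I J) : R :=
  match k with
  | inl (inl i) => lambda_n net n i
  | inl (inr (i, j)) => mu_n net n i j
  | inr i => gamma_n net n i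
  end.

Definition clock (k : source I J) (t : R) (w : Omega) : R :=
  match k with
  | inl (inl i) => lambda_n net n i * t
  | inl (inr (i, j)) =>
      mu_n net n i j * \int[lebesgue_measure]_(s in `[0, t]) (Z s w i j)%:R
  | inr i =>
      gamma_n net n i *
        \int[lebesgue_measure]_(s in `[0, t]) (queue (X s w) (Z s w) i)%:~R
  end.

Definition time_changed (k : source I J) (t : R) (w : Omega) : nat :=
  N k (clock k t w) w.

(* The truncated subtraction is exact, the paths being nondecreasing.  For
   arrivals this is [time_changed k (t + r) w - time_changed k t w]. *)
Definition future_incr (k : source I J) (t r : R) (w : Omega) : nat :=
  (N k (clock k t w + rate k * r) w - time_changed k t w)%N.

Definition past (t : R) : set (set Omega) :=
  <<s events [set: 'I_I] (fun i w => X 0 w i)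
      `|` events [set p : source I J * R | active net p.1 /\ 0 <= p.2 <= t]
            (fun p => time_changed p.1 p.2)
      `|` [set E | measurable E /\ P E = 0%E] >>.

Definition future (t : R) : set (set Omega) :=
  <<s events [set p : source I J * R | active net p.1 /\ 0 <= p.2]
        (fun p => future_incr p.1 t p.2) >>.

(* The n-th system started from the deterministic state [x0]; independence of
   the driving processes from [X 0] is then automatic.  Joint measurability
   gives a meaning to the time integrals. *)
Record is_system (x0 : 'I_I -> nat) : Prop := {
  sys_poisson : forall k, active net k -> is_poisson P (N k);
  sys_indep : indep_family P (active net)
    (fun k => <<s events [set t | 0 <= t] (N k) >>);
  sys_X_meas : forall i, measurable_fun [set p : R * Omega | 0 <= p.1]
    (fun p : R * Omega => X p.1 p.2 i);
  sys_Z_meas : forall i j, measurable_fun [set p : R * Omega | 0 <= p.1]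
    (fun p : R * Omega => Z p.1 p.2 i j);
  sys_balance : {ae P, forall w, forall t i, 0 <= t ->
    (X t w i)%:Z = (x0 i)%:Z + (time_changed (inl (inl i)) t w)%:Z
      - \sum_(j < J | edge net i j) (time_changed (inl (inr (i, j))) t w)%:Z
      - (time_changed (inr i) t w)%:Z}
}.

Record admissible : Prop := {
  adm_action : forall t, 0 <= t -> {ae P, forall w, action net n (X t w) (Z t w)};
  adm_adapted : forall t i j m, 0 <= t -> past t [set w | Z t w i j = m];
  adm_indep : forall t, 0 <= t -> indep_classes P (past t) (future t);
  adm_law_service : forall t i j, 0 <= t -> edge net i j ->
    same_law P (future_incr (inl (inr (i, j))) t)
      (fun r => N (inl (inr (i, j))) (mu_n net n i j * r));
  adm_law_abandon : forall t i, 0 <= t ->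
    same_law P (future_incr (inr i) t)
      (fun r => N (inr i) (gamma_n net n i * r))
}.

End Processes.

Definition X_hat (R : realType) (I J : nat) (net : network R I J) (n : nat)
    (x : 'I_I -> nat) : 'rV[R]_I :=
  \row_(i < I) (((x i)%:R - n%:R * x_star net i) / Num.sqrt n%:R).

Definition Q_hat (R : realType) (I J : nat) (n : nat)
    (x : 'I_I -> nat) (z : 'I_I -> 'I_J -> nat) : 'rV[R]_I :=
  \row_(i < I) ((queue x z i)%:~R / Num.sqrt n%:R).

(* Main.v *)
Require Import Defs.
From HB Require Import structures.
From mathcomp Require Import all_boot all_order all_algebra.
From mathcomp Require Import all_classical all_reals all_analysis.
From mathcomp Require Import measurable_realfun ring lra.

Set Implicit Arguments.
Unset Strict Implicit.
Unset Printing Implicit Defensive.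

Import Order.TTheory GRing.Theory Num.Theory.
Import numFieldNormedType.Exports.

Local Open Scope classical_set_scope.
Local Open Scope ring_scope.

(** The Lyapunov function is [lyap x = (1 + sum_i beta_i * xh_i^2)^(kappa/2)],
    where [xh] is the diffusion-scaled state and [beta] is the vector that the
    Foster-Lyapunov condition provides at exponent 2.

    _Drift._  In the [n]-th system the scaled drift at a state with queues and
    idle servers differs from the limiting drift [b (xh, u)], for a direction
    [u] that distributes the idleness in the actual proportions, by at most a
    constant times [1 + q], with [q] the total scaled queue.  The reason is that
    the scaled occupation [zh] and the matrix [Psi_hat] live on the edges of a
    tree and have nearly the same margins, and a matrix on a tree is controlled
    by its margins ([tree_entry_le], [sys_drift_near]).  On the cone where the
    condition gives no decay, [e.xh > delta |xh|], and [e.xh] is at most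
    [q] plus a constant because the fluid already fills all the servers;
    hence [|xh|] is itself of order [1 + q].  Together this gives, uniformly in
    [n], the generator bound [- c * lyap + C * (1 + q)^kappa]
    ([sys_generator_le]).

    _From the generator to expectations._  Independence of past and future is
    available at deterministic times only, and the control is an arbitrary
    adapted process.  Over a short interval [[s, t]] the jumps of each driving
    process are compared with their compensator, the rate times the busy time;
    both have the same mean on every event of the past at [s] ([martingale]).
    This follows from independence at [s] and at [t]: an increment over a fixed
    amount [K] of service from time [s] splits into the jumps in [[s, t]] and
    an increment from time [t] over the amount that is left; this amount is
    known at time [t], as a limit of sums of finitely many sampled occupations
    ([sampling_times], [idle_approx]).  Pathwise, [lyap] changes over [[s, t]]
    by at most the generator bound plus the compensated jumps plus an error
    whose mean is quadratic in [t - s] ([step_core]): without a jump the state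
    is constant, simple jumps obey a second-order Taylor bound, and multiple
    jumps are rare.  All of this is localized to the event that at most [M]
    customers have arrived, the initial ones included, where only finitely many
    states occur.  Summing over
    a grid, refining it and letting [M] grow proves
    [E lyap (X_t) + c E int_0^t lyap <= lyap x0 + C E int_0^t (1 + q)^kappa]
    ([lyapunov_mean]).

    _Conclusion._  For [T >= 1] the integral term on the left is the claim,
    since [1 <= T].  For [T < 1] the constant hidden in [lyap x0] is too large,
    and the bound on [E lyap (X_t)] is integrated over [t <= T] instead
    ([mean_V_path]). *)

(** * A Taylor bound for real powers *)

Lemma expR_le_taylor2 (R : realType) (x : R) :
  expR x <= 1 + x + x ^+ 2 * expR `|x|.
Proof.
have h1 : expR x * (1 - x) <= 1.
  rewrite -[leRHS](expRxMexpNx_1 x) ler_pM2l ?expR_gt0//.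
  by have := expR_ge1Dx (- x).
have h2 := expR_ge1Dx x.
have e0 := expR_gt0 x.
have [x0|x0] := leP 0 x.
  rewrite ger0_norm//; nra.
rewrite ltr0_norm//.
have := expR_ge1Dx (- x).
nra.
Qed.

(** The bound holds for every exponent at once because
    [(1 + t)^p = exp (p ln (1 + t)) <= exp (p t)]. *)
Lemma powR_le_taylor2 (R : realType) (p r e b : R) :
  0 < p -> 0 < r -> 0 < r + e -> `|e| <= b * r ->
  (r + e) `^ p <=
  r `^ (p - 1) * (r + p * e + p ^+ 2 * expR (p * b) * (e ^+ 2 / r)).
Proof.
move=> p0 r0 re0 eb.
set t := e / r.
have t1 : 0 < 1 + t by rewrite /t -(@divff _ r) ?gt_eqF// -mulrDl divr_gt0.
have -> : r + e = r * (1 + t) by rewrite /t mulrDr mulr1 mulrCA divff ?gt_eqF// mulr1.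
have -> : r + p * e + p ^+ 2 * expR (p * b) * (e ^+ 2 / r) =
   r * (1 + p * t + (p * t) ^+ 2 * expR (p * b)).
  by rewrite /t; field; rewrite gt_eqF.
rewrite powRM ?(ltW r0) ?(ltW t1)// -(mulr_powRB1 (ltW r0) p0) mulrA.
rewrite [in leRHS](mulrC (r `^ _)) ler_wpM2l ?mulr_ge0 ?powR_ge0 ?(ltW r0)//.
rewrite /powR (gt_eqF t1).
have lnt : ln (1 + t) <= t.
  by have := expR_ge1Dx (ln (1 + t)); rewrite lnK ?posrE//; lra.
apply: (@le_trans _ _ (expR (p * t))); first by rewrite ler_expR ler_pM2l.
apply: (le_trans (expR_le_taylor2 _)).
rewrite lerD2l ler_wpM2l ?sqr_ge0// ler_expR normrM (gtr0_norm p0) ler_pM2l//.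
by rewrite /t normrM normfV (gtr0_norm r0) ler_pdivrMr.
Qed.

(** * Matrices supported on a tree *)

(** A matrix supported on the edges of a tree is controlled by its margins:
    deleting the edge [(i, j)] separates [i] from [j], and summing the row sums
    minus the column sums over the component of [i] leaves the entry at
    [(i, j)] alone. *)
Lemma tree_entry_le (R : realType) (I J : nat) (net : network R I J)
    (D : 'I_I -> 'I_J -> R) :
  is_tree (bipartite_rel net) -> (forall i j, ~~ edge net i j -> D i j = 0) ->
  forall i j, `|D i j| <= \sum_(i' < I) `|\sum_(j' < J) D i' j'|
                          + \sum_(j' < J) `|\sum_(i' < I) D i' j'|.
Proof.
move=> [_ acyc] D0 i j.
have [eij|/D0->] := boolP (edge net i j); last first.
  by rewrite normr0 addr_ge0 ?sumr_ge0.
pose e : rel ('I_I + 'I_J) := fun a b => bipartite_rel net a b &&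
  ~~ [|| (a == inl i) && (b == inr j) | (a == inr j) && (b == inl i)].
have esym : symmetric e.
  move=> a b; rewrite /e orbC; congr (_ && ~~ _); first by case: a b => ? [].
  by congr (_ || _); rewrite andbC.
pose T := connect e (inl i).
(* a path from [i] to [j] that avoids the edge would close a cycle *)
have cut : ~~ T (inr j).
  apply/negP => /connectP[q0 eq0 lq0].
  case/shortenP: eq0 lq0 => q eq uq _ lq.
  have bq : path (bipartite_rel net) (inl i) q.
    by apply: sub_path eq => a b /andP[].
  have : cycle (bipartite_rel net) (inl i :: q).
    by rewrite /= rcons_path bq /= -lq.
  apply/negP; apply: acyc => //=.
  case: q {uq bq} eq lq => [//|a [|b q]//] /= + aE.
  by rewrite -aE /e !eqxx /= !andbF.
have inT i' j' : edge net i' j' -> (i', j') != (i, j) ->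
    T (inl i') = T (inr j').
  move=> e' ne; rewrite /T; apply: (same_connect_r (sym_connect_sym esym)).
  apply: connect1; rewrite /e /= e' /= orbF.
  by move: ne; rewrite xpair_eqE.
have E : D i j = \sum_(i' < I) (T (inl i'))%:R * (\sum_(j' < J) D i' j')
             - \sum_(j' < J) (T (inr j'))%:R * (\sum_(i' < I) D i' j').
  under eq_bigr do rewrite mulr_sumr.
  under [X in _ - X]eq_bigr do rewrite mulr_sumr.
  rewrite [X in _ - X]exchange_big /= -sumrB.
  under eq_bigr do rewrite -sumrB.
  rewrite (bigD1 i)//= (bigD1 j)//= [X in _ + X + _]big1 ?[X in _ + X]big1.
  - have -> : T (inl i) by exact: connect0.
    by rewrite (negbTE cut) mul1r mul0r subr0 !addr0.
  - move=> i' ne; rewrite big1// => j' _.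
    have [e'|/D0->] := boolP (edge net i' j'); last by rewrite !mulr0 subrr.
    by rewrite (inT _ _ e') ?subrr// xpair_eqE (negbTE ne).
  - move=> j' ne.
    have [e'|/D0->] := boolP (edge net i j'); last by rewrite !mulr0 subrr.
    by rewrite (inT _ _ e') ?subrr// xpair_eqE (negbTE ne) andbF.
rewrite {1}E (le_trans (ler_normB _ _))// lerD// (le_trans (ler_norm_sum _ _ _))//.
  by apply: ler_sum => i' _; rewrite normrM; case: (T _); rewrite ?normr1 ?normr0 ?mul1r ?mul0r.
by apply: ler_sum => i' _; rewrite normrM; case: (T _); rewrite ?normr1 ?normr0 ?mul1r ?mul0r.
Qed.

(** * The limiting drift and the quadratic Lyapunov function *)

Definition sqbnorm (R : realType) (n : nat) (beta x : 'rV[R]_n) : R :=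
  \sum_(i < n) beta 0 i * x 0 i ^+ 2.

Lemma sqbnorm_ge0 (R : realType) (n : nat) (beta x : 'rV[R]_n) :
  (forall i, 0 < beta 0 i) -> 0 <= sqbnorm beta x.
Proof. by move=> b0; apply: sumr_ge0 => i _; rewrite mulr_ge0 ?sqr_ge0 ?ltW. Qed.

Lemma enorm_ge0 (R : realType) (n : nat) (x : 'rV[R]_n) : 0 <= enorm x.
Proof. exact: sqrtr_ge0. Qed.

Lemma enorm_coord (R : realType) (n : nat) (x : 'rV[R]_n) i :
  `|x 0 i| <= enorm x.
Proof.
rewrite -sqrtr_sqr ler_wsqrtr// (bigD1 i)//= lerDl.
by apply: sumr_ge0 => j _; rewrite sqr_ge0.
Qed.

Lemma continuous_coord_sum (R : realType) (n : nat) (c : 'I_n -> R) :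
  continuous (fun x : 'rV[R]_n => \sum_(i < n) c i * x 0 i ^+ 2).
Proof.
move=> x; rewrite (_ : (fun _ => _) = \sum_(i < n) (fun y : 'rV[R]_n => c i * y 0 i ^+ 2)); last first.
  by apply/funext => y; rewrite fct_sumE.
elim/big_ind : _ => [|f g cf cg|i _].
- exact: cst_continuous.
- exact: continuousD.
- have cx : (fun y : 'rV[R]_n => y 0 i) @ x --> x 0 i by exact: coord_continuous.
  exact: (cvgM (cvg_cst (c i)) (cvgM cx cx)).
Qed.

Lemma partial_quadratic (R : realType) (n : nat) (beta x : 'rV[R]_n)
    (V : 'rV[R]_n -> R) i :
  (forall x, 1 <= enorm x -> V x = sqbnorm beta x) -> 1 < enorm x ->
  partial i V x = 2 * beta 0 i * x 0 i.
Proof.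
move=> VE x1; rewrite /partial (@near_eq_derive _ _ _ _ (sqbnorm beta)); last first.
  have : @enorm R n @ x --> enorm x.
    apply: continuous_comp; last exact: sqrt_continuous.
    have := @continuous_coord_sum R n (fun=> 1) x.
    rewrite (_ : (fun _ => _) = (fun y : 'rV[R]_n => \sum_(i < n) y 0 i ^+ 2))//.
    by apply/funext => y; apply: eq_bigr => j _; rewrite mul1r.
  move/cvgr_ge => /(_ _ x1); apply: filterS => y; exact: VE.
apply: cvg_lim => //.
apply: cvg_trans (_ : 2 * beta 0 i * x 0 i + beta 0 i * h @[h --> 0^'] --> _).
  apply: near_eq_cvg; near=> h.
  have h0 : h != 0 by near: h; exact: nbhs_dnbhs_neq.
  rewrite /= /sqbnorm -sumrB (bigD1 i)//= big1 => [|j ji]; last first.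
    by rewrite !mxE eqxx /= (negbTE ji) mulr0 add0r subrr.
  rewrite !mxE !eqxx mulr1 addr0 /GRing.scale /=.
  by field.
rewrite -[X in _ --> X]addr0; apply: cvgD; first exact: cvg_cst.
rewrite -[X in _ --> X](mulr0 (beta 0 i)); apply: cvgM; first exact: cvg_cst.
exact/cvg_within.
Unshelve. all: by end_near. Qed.

Lemma pospart_ge0 (R : realType) (a : R) : 0 <= pospart a.
Proof. by rewrite /pospart le_max lexx orbT. Qed.

Lemma negpart_ge0 (R : realType) (a : R) : 0 <= negpart a.
Proof. by rewrite /negpart le_max lexx orbT. Qed.

Lemma pospartBnegpart (R : realType) (a : R) : pospart a - negpart a = a.
Proof. by rewrite /pospart /negpart /Num.max; case: (ltP a 0) => ?; case: (ltP (- a) 0) => ?; lra. Qed.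

Lemma pospartDnegpart (R : realType) (a : R) : pospart a + negpart a = `|a|.
Proof.
rewrite /pospart /negpart /Num.max; case: (ltP a 0) => a0; case: (ltP (- a) 0) => a0'.
- lra.
- by rewrite ltr0_norm//; lra.
- by rewrite ger0_norm//; lra.
- by rewrite ger0_norm//; lra.
Qed.

Lemma edot_le (R : realType) (n : nat) (x : 'rV[R]_n) :
  `|edot x| <= \sum_(i < n) `|x 0 i|.
Proof. exact: ler_norm_sum. Qed.

Lemma sum_coord_le (R : realType) (n : nat) (x : 'rV[R]_n) :
  \sum_(i < n) `|x 0 i| <= n%:R * enorm x.
Proof.
rewrite mulr_natl -[X in _ *+ X]card_ord -sumr_const.
by apply: ler_sum => i _; exact: enorm_coord.
Qed.

Section Drift.
Context (R : realType) (I J : nat) (net : network R I J).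
Context (Psi : 'rV[R]_I -> 'rV[R]_J -> 'M[R]_(I, J)).
Hypothesis netP : network_assumptions net.
Hypothesis PsiP : is_Psi net Psi.

Lemma Psi_hat_margins u x : in_U u ->
  [/\ forall i, \sum_(j < J) Psi_hat Psi u x i j = x 0 i - pospart (edot x) * u.1 0 i,
      forall j, \sum_(i < I) Psi_hat Psi u x i j = - (negpart (edot x) * u.2 0 j)
    & forall i j, ~~ edge net i j -> Psi_hat Psi u x i j = 0].
Proof.
move=> [_ _ u1 u2].
have [|h1 h2 h3] := PsiP.2 (x - pospart (edot x) *: u.1) (- (negpart (edot x) *: u.2)).
  rewrite {1 4}/edot; under eq_bigr do rewrite !mxE.
  under [RHS]eq_bigr do rewrite !mxE.
  rewrite sumrB sumrN -!mulr_sumr -/(edot u.1) -/(edot u.2) u1 u2 !mulr1 -/(edot x).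
  by have := pospartBnegpart (edot x); lra.
split.
- by move=> i; rewrite h1 !mxE.
- by move=> j; rewrite h2 !mxE.
- exact: h3.
Qed.

Lemma Psi_hat_le u x i j : in_U u ->
  `|Psi_hat Psi u x i j| <= 2 * I%:R * enorm x.
Proof.
move=> uU; have [h1 h2 h3] := Psi_hat_margins x uU.
have [u10 u20 u1 u2] := uU.
apply: (le_trans (tree_entry_le (net_tree netP) h3 i j)).
under eq_bigr do rewrite h1.
under [X in _ + X]eq_bigr do rewrite h2.
apply: (@le_trans _ _ (\sum_(i < I) (`|x 0 i| + pospart (edot x) * u.1 0 i) +
   \sum_(j < J) negpart (edot x) * u.2 0 j)).
  apply: lerD; apply: ler_sum => k _.
    by rewrite (le_trans (ler_normB _ _))// lerD2l ger0_norm// mulr_ge0 ?pospart_ge0.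
  by rewrite normrN ger0_norm// mulr_ge0 ?negpart_ge0.
rewrite big_split/= -!mulr_sumr -/(edot u.1) -/(edot u.2) u1 u2 !mulr1 -addrA pospartDnegpart.
by have := edot_le x; have := sum_coord_le x; lra.
Qed.

Lemma drift_unit_ball : exists C : R, 0 <= C /\
  forall x u i, in_U u -> enorm x <= 1 -> `|drift net Psi x u i| <= C.
Proof.
pose K i := `|ell net i| + \sum_(j < J | edge net i j) mu net i j * (2 * I%:R)
   + gamma net i * (2 * I%:R).
have K0 i : 0 <= K i.
  have g0 := gamma_ge0 netP i.
  apply: addr_ge0; last by rewrite mulr_ge0 ?mulr_ge0.
  apply: addr_ge0 => //; apply: sumr_ge0 => j e.
  by have m := ltW (mu_gt0 netP e); rewrite mulr_ge0 ?mulr_ge0.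
exists (\sum_i K i); split; first exact: sumr_ge0.
move=> x u i uU x1; apply: (@le_trans _ _ (K i)); last first.
  by rewrite (bigD1 i)//= lerDl sumr_ge0.
have P2 j : `|Psi_hat Psi u x i j| <= 2 * I%:R.
  by apply: (le_trans (Psi_hat_le _ _ _ uU)); rewrite ler_piMr// mulr_ge0.
rewrite /drift /K (le_trans (ler_normB _ _))// lerD//.
  rewrite (le_trans (ler_normB _ _))// lerD2l (le_trans (ler_norm_sum _ _ _))//.
  apply: ler_sum => j e; have m := mu_gt0 netP e.
  by rewrite normrM (gtr0_norm m) ler_pM2l.
have [u10 _ u1 _] := uU.
have g0 := gamma_ge0 netP i.
rewrite ger0_norm ?mulr_ge0 ?pospart_ge0// -mulrA ler_wpM2l//.
have ui1 : u.1 0 i <= 1.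
  by rewrite -u1 /edot (bigD1 i)//= lerDl sumr_ge0.
have : pospart (edot x) <= 2 * I%:R.
  have := edot_le x; have := sum_coord_le x; have := negpart_ge0 (edot x).
  have := pospartDnegpart (edot x).
  have : I%:R * enorm x <= I%:R by rewrite ler_piMr.
  have : 0 <= I%:R :> R by [].
  lra.
have := pospart_ge0 (edot x); have := u10 i; nra.
Qed.

(** At exponent 2 the Lyapunov function is a quadratic form outside the unit
    ball, with an explicit gradient; inside the ball the drift is bounded.  The
    inequality therefore holds for the form itself, everywhere. *)
Lemma FL_plus_quadratic : FL_plus net Psi ->
  exists (beta : 'rV[R]_I) (delta c0 c1 c2 : R),
  [/\ forall i, 0 < beta 0 i, 0 < delta, [/\ 0 <= c0, 0 <= c1 & 0 < c2] &
  forall (x : 'rV[R]_I) (u : 'rV[R]_I * 'rV[R]_J), in_U u ->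
    2 * \sum_(i < I) beta 0 i * x 0 i * drift net Psi x u i <=
    c0 + c1 * sqbnorm beta x * (delta * enorm x < edot x)%R%:R
    - c2 * sqbnorm beta x].
Proof.
move=> /(_ 2)[]; first by rewrite ler1n.
move=> beta [V [delta [c0 [c1 [c2 [b0 [_ VE] d0 [c00 c10 c20] FL]]]]]].
have [Cb [Cb0 CbP]] := drift_unit_ball.
exists beta, delta, (c0 + 2 * (\sum_i beta 0 i) * Cb + c2 * \sum_i beta 0 i), (c1 + c2), c2.
have sb0 : 0 <= \sum_i beta 0 i by apply: sumr_ge0 => i _; exact/ltW.
split => //; first by split; [nra|lra|].
have VE' x : 1 <= enorm x -> V x = sqbnorm beta x.
  move=> /VE ->; rewrite powR_mulrn ?sqrtr_ge0// sqr_sqrtr.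
    by apply: eq_bigr => i _; rewrite real_normK ?num_real.
  by apply: sumr_ge0 => i _; rewrite mulr_ge0 ?sqr_ge0 ?ltW.
move=> x u uU.
have q0 := sqbnorm_ge0 x b0.
have [x1|x1] := leP (enorm x) 1.
  have : \sum_(i < I) beta 0 i * x 0 i * drift net Psi x u i <= (\sum_i beta 0 i) * Cb.
    rewrite mulr_suml; apply: ler_sum => i _; rewrite -mulrA ler_wpM2l ?(ltW (b0 i))//.
    rewrite (le_trans (ler_norm _))// normrM.
    rewrite -[leRHS]mul1r ler_pM ?CbP//.
    exact: le_trans (enorm_coord _ _) x1.
  have : sqbnorm beta x <= \sum_i beta 0 i.
    apply: ler_sum => i _; rewrite ler_piMr ?(ltW (b0 i))// -real_normK ?num_real//.
    by rewrite expr_le1// (le_trans (enorm_coord _ _)).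
  have h : 0 <= (c1 + c2) * sqbnorm beta x * (delta * enorm x < edot x)%R%:R.
    by rewrite !mulr_ge0// addr_ge0// ltW.
  move=> h1 h2; have : c2 * sqbnorm beta x <= c2 * \sum_i beta 0 i by rewrite ler_pM2l.
  lra.
have := FL x u uU.
rewrite (VE' _ (ltW x1)).
under eq_bigr do rewrite (partial_quadratic _ VE' x1).
have -> : \sum_(i < I) drift net Psi x u i * (2 * beta 0 i * x 0 i) =
   2 * \sum_(i < I) beta 0 i * x 0 i * drift net Psi x u i.
  by rewrite mulr_sumr; apply: eq_bigr => i _; ring.
move=> /le_trans; apply.
rewrite indicC !indicE.
have -> : (x \in cone_plus delta) = (delta * enorm x < edot x).
  by apply/idP/idP; rewrite /cone_plus inE.
have := mulr_ge0 sb0 Cb0; have := mulr_ge0 (ltW c20) sb0.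
by case: ltP => _ /=; rewrite ?subr0 ?subrr ?mulr1 ?mulr0; lra.
Qed.

(** * The drift of the system *)

Definition qsum (n : nat) (x : 'I_I -> nat) (z : 'I_I -> 'I_J -> nat) : R :=
  \sum_(i < I) (queue x z i)%:~R / Num.sqrt n%:R.

Definition sys_drift (n : nat) (x : 'I_I -> nat) (z : 'I_I -> 'I_J -> nat) i : R :=
  (lambda_n net n i - \sum_(j < J) mu_n net n i j * (z i j)%:R
   - gamma_n net n i * (queue x z i)%:~R) / Num.sqrt n%:R.

Definition total_rate (n : nat) (x : 'I_I -> nat) (z : 'I_I -> 'I_J -> nat) : R :=
  \sum_(i < I) (lambda_n net n i + \sum_(j < J) mu_n net n i j * (z i j)%:R
   + gamma_n net n i * (queue x z i)%:~R).

(** Boolean, so that it can mask the exceptional times inside an integrand. *)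
Definition feasible (n : nat) (x : 'I_I -> nat) (z : 'I_I -> 'I_J -> nat) : bool :=
  [&& [forall i, forall j, ~~ edge net i j ==> (z i j == 0)%N],
      [forall i, \sum_(j < J) z i j <= x i]%N
    & [forall j, \sum_(i < I) z i j <= servers_n net n j]%N].

Lemma action_feasible n x z : action net n x z -> feasible n x z.
Proof.
move=> [z0 act]; apply/and3P; split.
- by apply/forallP => i; apply/forallP => j; apply/implyP => /z0 ->.
- apply/forallP => i.
  have [[_ xi0 xiE] _] := xi_star_opt netP.
  have [j e] : exists j, edge net i j.
    apply: contrapT => /forallNP ne.
    have := lambda_gt0 netP i; rewrite -(xiE i) big1 ?ltxx// => j _.
    by rewrite xi0 ?mulr0//; apply/negP; exact: ne.
  have [_ + _] := act _ _ e.
  by rewrite /queue -(big_morph Posz PoszD (erefl _)) subr_ge0 lez_nat.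
- apply/forallP => j.
  have [[_ xi0 xiE] _] := xi_star_opt netP.
  have [i e] : exists i, edge net i j.
    apply: contrapT => /forallNP ne.
    have := xi_star_full netP j; rewrite big1 => [/eqP|i _]; first by rewrite eq_sym oner_eq0.
    by rewrite xi0//; apply/negP; exact: ne.
  have [_ _] := act _ _ e.
  by rewrite /idle -(big_morph Posz PoszD (erefl _)) subr_ge0 lez_nat.
Qed.

Lemma cvg_bounded (u : nat -> R) (l : R) : u @ \oo --> l ->
  exists C : R, 0 <= C /\ forall n, `|u n| <= C.
Proof.
move=> ul; have : cvgn u by apply/cvg_ex; exists l.
move=> /cvg_seq_bounded/pinfty_ex_gt0[C _ CP]; exists (Num.max C 0); split.
  by rewrite le_max lexx orbT.
by move=> n; rewrite le_max CP.
Qed.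

Lemma cvg_bounded_fin (K : finType) (u : nat -> K -> R) (l : K -> R) :
  (forall k, u ^~ k @ \oo --> l k) ->
  exists C : R, 0 <= C /\ forall n k, `|u n k| <= C.
Proof.
move=> ul.
have /choice[C CP] := fun k => cvg_bounded (ul k).
exists (\sum_k C k); split; first by apply: sumr_ge0 => k _; case: (CP k).
move=> n k; rewrite (bigD1 k)//= -[leLHS]addr0 lerD//; first by case: (CP k).
by apply: sumr_ge0 => j _; case: (CP j).
Qed.

Lemma scaling_bounds : exists C : R, 0 <= C /\ forall n : nat,
  [/\ forall i, `|(lambda_n net n i - n%:R * lambda net i) / Num.sqrt n%:R| <= C,
      forall i j, `|Num.sqrt n%:R * (mu_n net n i j - mu net i j)| <= C,
      forall j, `|((servers_n net n j)%:R - n%:R * nu net j) / Num.sqrt n%:R| <= C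
    & forall i, `|gamma_n net n i| <= C].
Proof.
have [C1 [C10 C1P]] := cvg_bounded_fin (lambda_cvg netP).
have [C2 [C20 C2P]] := @cvg_bounded_fin ('I_I * 'I_J)%type
  (fun n k => Num.sqrt n%:R * (mu_n net n k.1 k.2 - mu net k.1 k.2))
  (fun k => mu_hat net k.1 k.2) (fun k => mu_cvg netP (i := k.1) (j := k.2)).
have [C3 [C30 C3P]] := cvg_bounded_fin (nu_cvg netP).
have [C4 [C40 C4P]] := cvg_bounded_fin (gamma_cvg netP).
exists (C1 + C2 + C3 + C4); split; first by rewrite !addr_ge0.
move=> n; split=> [i|i j|j|i].
- by rewrite (le_trans (C1P n i))//; lra.
- by rewrite (le_trans (C2P n (i, j)))//; lra.
- by rewrite (le_trans (C3P n j))//; lra.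
- by rewrite (le_trans (C4P n i))//; lra.
Qed.

Section Fixed_n.
Variables (n : nat) (x : 'I_I -> nat) (z : 'I_I -> 'I_J -> nat) (C : R).
Hypotheses (n0 : (0 < n)%N) (fz : feasible n x z) (C0 : 0 <= C).
Hypothesis CP : [/\ forall i, `|(lambda_n net n i - n%:R * lambda net i) / Num.sqrt n%:R| <= C,
      forall i j, `|Num.sqrt n%:R * (mu_n net n i j - mu net i j)| <= C,
      forall j, `|((servers_n net n j)%:R - n%:R * nu net j) / Num.sqrt n%:R| <= C
    & forall i, `|gamma_n net n i| <= C].
Let s : R := Num.sqrt n%:R.
Let X : 'rV[R]_I := X_hat net n x.
Let qh i : R := (queue x z i)%:~R / s.
Let yh j : R := ((servers_n net n j)%:R - (\sum_(i < I) z i j)%N%:R) / s.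
Let nh j : R := ((servers_n net n j)%:R - n%:R * nu net j) / s.
Let zh i j : R := ((z i j)%:R - n%:R * z_star net i j) / s.
Let q : R := qsum n x z.

Let s_gt0 : 0 < s. Proof. by rewrite sqrtr_gt0 ltr0n. Qed.

Let s_ge1 : 1 <= s.
Proof. by rewrite -[leLHS]sqrtr1 ler_wsqrtr// ler1n. Qed.

Let s2 : s * s = n%:R.
Proof. by rewrite -expr2 sqr_sqrtr ?ler0n. Qed.

Let qhE i : (queue x z i)%:~R = (x i)%:R - (\sum_(j < J) z i j)%N%:R :> R.
Proof. by rewrite /queue -(big_morph Posz PoszD (erefl _)) intrB. Qed.

Let qh_ge0 i : 0 <= qh i.
Proof.
apply: divr_ge0; last exact: ltW.
by have /and3P[_ /forallP/(_ i) h _] := fz; rewrite qhE subr_ge0 ler_nat.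
Qed.

Let yh_ge0 j : 0 <= yh j.
Proof.
apply: divr_ge0; last exact: ltW.
by have /and3P[_ _ /forallP/(_ j) h] := fz; rewrite subr_ge0 ler_nat.
Qed.

Lemma qsum_ge0 : 0 <= qsum n x z.
Proof. by apply: sumr_ge0 => i _; exact: qh_ge0. Qed.

Let z_rows i : \sum_(j < J) zh i j = X 0 i - qh i.
Proof.
rewrite /zh -mulr_suml sumrB -mulr_sumr -/(x_star net i) -natr_sum /X /X_hat mxE.
by rewrite /qh qhE -mulrBl; congr (_ / _); ring.
Qed.

Let z_cols j : \sum_(i < I) zh i j = nh j - yh j.
Proof.
rewrite /zh -mulr_suml sumrB -mulr_sumr -natr_sum.
have -> : \sum_(i < I) z_star net i j = nu net j.
  by rewrite /z_star -mulr_suml (xi_star_full netP) mul1r.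
by rewrite /nh /yh -mulrBl; congr (_ / _); ring.
Qed.

Let edotX : edot X = q + \sum_(j < J) nh j - \sum_(j < J) yh j.
Proof.
have : \sum_(i < I) \sum_(j < J) zh i j = \sum_(j < J) \sum_(i < I) zh i j.
  exact: exchange_big.
under eq_bigr do rewrite z_rows; under [RHS]eq_bigr do rewrite z_cols.
by rewrite !sumrB -/(edot X) -/q => h; rewrite -addrA -h; rewrite /q /qsum /qh; ring.
Qed.

Let nh_sum : `|\sum_(j < J) nh j| <= J%:R * C.
Proof.
rewrite (le_trans (ler_norm_sum _ _ _))// mulr_natl -[X in _ *+ X]card_ord -sumr_const.
by apply: ler_sum => j _; have [_ _ h _] := CP; exact: h.
Qed.

(** The fluid fills all the servers, up to a fluctuation of the number of servers
    which is bounded after scaling: a surplus of customers has to queue. *)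
Lemma pospart_edot_le : pospart (edot X) <= q + J%:R * C.
Proof.
have := nh_sum; rewrite ler_norml => /andP[h1 h2].
have y0 : 0 <= \sum_j yh j by exact: sumr_ge0.
rewrite /pospart ge_max edotX; apply/andP; split; first lra.
by rewrite addr_ge0 ?mulr_ge0// qsum_ge0.
Qed.

Let z_le i j : (z i j)%:R / n%:R <= nu net j + C.
Proof.
have /and3P[_ _ /forallP/(_ j) h] := fz.
have [_ _ /(_ j) + _] := CP; rewrite ler_norml => /andP[_].
rewrite ler_pdivrMr// => hN.
rewrite ler_pdivrMr ?ltr0n//; apply: (@le_trans _ _ (servers_n net n j)%:R).
  by rewrite ler_nat (leq_trans _ h)// (bigD1 i)//= leq_addr.
have : C * s <= C * n%:R.
  by rewrite ler_wpM2l// -s2 ler_peMl ?(ltW s_gt0) ?s_ge1.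
move: hN; rewrite -/s; lra.
Qed.

(** Both matrices are supported on the edges of the tree, and their margins
    differ by the queues, the fluctuation of the number of servers and the
    discrepancy between the idleness and the negative part of [e.X]. *)
Lemma zh_bound u : in_U u -> (forall j, yh j = (\sum_(j < J) yh j) * u.2 0 j) ->
  forall i j, `|zh i j - Psi_hat Psi u X i j| <= 4 * q + 4 * J%:R * C.
Proof.
move=> uU yE i j.
have [h1 h2 h3] := Psi_hat_margins X uU.
have [u10 u20 u1 u2] := uU.
have /and3P[/forallP z0 _ _] := fz.
have [[_ xi0 _] _] := xi_star_opt netP.
apply: (le_trans (@tree_entry_le R I J net (fun i j => zh i j - Psi_hat Psi u X i j)
   (net_tree netP) _ i j)).
  move=> i' j' e; have /forallP/(_ j')/implyP/(_ e)/eqP ze := z0 i'.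
  by rewrite h3// /zh ze /z_star xi0// mul0r mulr0 subrr mul0r subrr.
under eq_bigr do rewrite sumrB h1 z_rows.
under [X in _ + X]eq_bigr do rewrite sumrB h2 z_cols.
set y := \sum_(j < J) yh j in yE *.
have pq := pospart_edot_le.
have qE : \sum_i qh i = q by [].
have q0 : 0 <= q := qsum_ge0.
have p0 := pospart_ge0 (edot X).
have ny : `|negpart (edot X) - y| <= 2 * q + 2 * (J%:R * C).
  have := pospartBnegpart (edot X); rewrite [in RHS]edotX -/y => h.
  have := nh_sum; rewrite !ler_norml => /andP[? ?]; apply/andP; split; lra.
apply: (@le_trans _ _ (\sum_(i < I) (pospart (edot X) * u.1 0 i + qh i) +
   \sum_(j < J) (`|nh j| + `|negpart (edot X) - y| * u.2 0 j))).
  apply: lerD; apply: ler_sum => k _.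
    rewrite (_ : _ - _ = pospart (edot X) * u.1 0 k - qh k); last by ring.
    by rewrite (le_trans (ler_normB _ _))// !ger0_norm// mulr_ge0.
  rewrite opprK -addrA (le_trans (ler_normD _ _))// lerD2l yE addrC -mulrBl.
  by rewrite normrM (ger0_norm (u20 k)).
rewrite !big_split/= -!mulr_sumr -/(edot u.1) -/(edot u.2) u1 u2 !mulr1 qE.
have : \sum_j `|nh j| <= J%:R * C.
  rewrite mulr_natl -[X in _ *+ X]card_ord -sumr_const.
  by apply: ler_sum => k _; have [_ _ h _] := CP; exact: h.
lra.
Qed.

Definition drift_gap_cst (C : R) i : R :=
  C + \sum_(j < J) C * (nu net j + C) + `|ell net i|
  + (\sum_(j < J) mu net i j) * (4 + 4 * J%:R * C) + C + gamma net i * (1 + J%:R * C).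

Lemma mu_ge0 i j : 0 <= mu net i j.
Proof.
by have [/(mu_gt0 netP)/ltW//|/(mu_eq0 netP)->] := boolP (edge net i j).
Qed.

Let sys_driftE i : sys_drift n x z i =
  (lambda_n net n i - n%:R * lambda net i) / s
  - \sum_(j < J) (s * (mu_n net n i j - mu net i j)) * ((z i j)%:R / n%:R)
  - \sum_(j < J) mu net i j * zh i j - gamma_n net n i * qh i.
Proof.
have sn0 : s != 0 by rewrite gt_eqF.
have lE : lambda net i = \sum_(j < J) mu net i j * z_star net i j.
  have [[_ _ <-] _] := xi_star_opt netP.
  by apply: eq_bigr => j _; rewrite /z_star; ring.
rewrite /sys_drift lE /qh.
set a := \sum_(j < J) (s * _) * _; set b := \sum_(j < J) mu net i j * zh i j.
have ab : - a - b =
  (n%:R * (\sum_(j < J) mu net i j * z_star net i j)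
   - \sum_(j < J) mu_n net n i j * (z i j)%:R) / s.
  rewrite -opprD -big_split/= mulr_sumr -sumrB mulr_suml -sumrN.
  by apply: eq_bigr => j _; rewrite /zh -s2; field.
transitivity ((lambda_n net n i - n%:R * (\sum_(j < J) mu net i j * z_star net i j)) / s
  + (- a - b) - gamma_n net n i * ((queue x z i)%:~R / s)); last by ring.
by rewrite ab -/s; field.
Qed.

Lemma sys_drift_near u i : in_U u -> (forall j, yh j = (\sum_(j < J) yh j) * u.2 0 j) ->
  `|sys_drift n x z i - drift net Psi X u i| <= drift_gap_cst C i * (1 + q).
Proof.
move=> uU yE.
have zb := zh_bound uU yE.
have [Cl Cm _ Cg] := CP.
have q0 : 0 <= q := qsum_ge0.
have pq := pospart_edot_le.
have p0 := pospart_ge0 (edot X).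
have [u10 u20 u1 u2] := uU.
have ui1 : u.1 0 i <= 1.
  by rewrite -u1 /edot (bigD1 i)//= lerDl sumr_ge0.
have qi : qh i <= q.
  by rewrite /q /qsum (bigD1 i)//= lerDl sumr_ge0// => k _; exact: qh_ge0.
have g0 := gamma_ge0 netP i.
have JC : 0 <= J%:R * C by rewrite mulr_ge0.
have -> : sys_drift n x z i - drift net Psi X u i =
  (lambda_n net n i - n%:R * lambda net i) / s
  - \sum_(j < J) (s * (mu_n net n i j - mu net i j)) * ((z i j)%:R / n%:R)
  - ell net i
  - \sum_(j < J) mu net i j * (zh i j - Psi_hat Psi u X i j) - gamma_n net n i * qh i
  + gamma net i * pospart (edot X) * u.1 0 i.
  rewrite sys_driftE /drift.
  have -> : \sum_(j < J | edge net i j) mu net i j * Psi_hat Psi u X i j =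
    \sum_(j < J) mu net i j * Psi_hat Psi u X i j.
    rewrite [RHS](bigID (edge net i))/= [X in _ + X]big1 ?addr0// => j e.
    by rewrite (mu_eq0 netP e) mul0r.
  have -> : \sum_(j < J) mu net i j * (zh i j - Psi_hat Psi u X i j) =
    \sum_(j < J) mu net i j * zh i j - \sum_(j < J) mu net i j * Psi_hat Psi u X i j.
    by rewrite -sumrB; apply: eq_bigr => j _; rewrite mulrBr.
  ring.
rewrite /drift_gap_cst.
have q1 : 1 <= 1 + q by rewrite lerDl.
have scale a b : a <= b -> 0 <= b -> a <= b * (1 + q) by nra.
rewrite [leRHS]mulrDl (le_trans (ler_normD _ _))// lerD//; last first.
  rewrite ger0_norm ?mulr_ge0// -!mulrA ler_wpM2l//.
  by have := u10 i; nra.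
rewrite [leRHS]mulrDl (le_trans (ler_normB _ _))// lerD//; last first.
  by rewrite normrM (ger0_norm (qh_ge0 i)) ler_pM// ?(le_trans qi)// lerDr.
rewrite [leRHS]mulrDl (le_trans (ler_normB _ _))// lerD//; last first.
  rewrite (le_trans (ler_norm_sum _ _ _))// -mulrA [leRHS]mulr_suml; apply: ler_sum => j _.
  rewrite normrM (ger0_norm (mu_ge0 _ _)) ler_wpM2l ?mu_ge0//.
  by apply: (le_trans (zb _ _)); nra.
rewrite [leRHS]mulrDl (le_trans (ler_normB _ _))// lerD//; last exact: scale.
rewrite [leRHS]mulrDl (le_trans (ler_normB _ _))// lerD//; first exact: scale.
apply: scale; last first.
  by apply: sumr_ge0 => j _; rewrite mulr_ge0// addr_ge0// ltW// (nu_gt0 netP).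
rewrite (le_trans (ler_norm_sum _ _ _))//; apply: ler_sum => j _.
rewrite normrM ler_pM// ger0_norm ?z_le//.
Qed.

Definition rate_cst (C : R) : R :=
  \sum_(i < I) (lambda net i + C + \sum_(j < J) (mu net i j + C) * (nu net j + C)) + C.

Lemma total_rate_le : total_rate n x z / n%:R <= rate_cst C * (1 + q).
Proof.
have [Cl Cm _ Cg] := CP.
have q0 : 0 <= q := qsum_ge0.
have div_s a : a <= C -> a / s <= C.
  by move=> aC; rewrite ler_pdivrMr// (le_trans aC)// ler_peMr ?s_ge1.
pose A i := lambda net i + C + \sum_(j < J) (mu net i j + C) * (nu net j + C).
have A0 i : 0 <= A i.
  rewrite /A !addr_ge0 ?(ltW (lambda_gt0 netP _))// sumr_ge0// => j _.
  by rewrite mulr_ge0 ?addr_ge0 ?mu_ge0 ?(ltW (nu_gt0 netP _)).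
apply: (@le_trans _ _ (\sum_i A i + C * q)); last first.
  rewrite (_ : rate_cst C = \sum_i A i + C)//.
  have B0 : 0 <= \sum_i A i by exact: sumr_ge0.
  move: (\sum_i A i) B0 => B B0.
  have := mulr_ge0 B0 q0; have := C0; have := q0; rewrite mulrDr mulr1 mulrDl; lra.
rewrite /total_rate mulr_suml /q /qsum mulr_sumr -big_split/=.
apply: ler_sum => i _; rewrite 2!mulrDl; apply: lerD; last first.
  rewrite (_ : _ / n%:R = gamma_n net n i * (qh i / s)); last first.
    by rewrite /qh -s2; field; rewrite gt_eqF.
  apply: (@le_trans _ _ (C * (qh i / s))).
    apply: ler_wpM2r; first exact: divr_ge0 (qh_ge0 i) (ltW s_gt0).
    exact: le_trans (ler_norm _) (Cg i).
  by rewrite ler_wpM2l// ler_pdivrMr// ler_peMr ?qh_ge0 ?s_ge1.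
apply: lerD.
  have := Cl i; rewrite ler_norml => /andP[_ /div_s].
  have -> : (lambda_n net n i - n%:R * lambda net i) / Num.sqrt n%:R / s =
     lambda_n net n i / n%:R - lambda net i.
    by rewrite -/s -s2; field; rewrite gt_eqF.
  lra.
rewrite mulr_suml; apply: ler_sum => j _; rewrite -mulrA.
apply: (@le_trans _ _ ((mu net i j + C) * ((z i j)%:R / n%:R))).
  rewrite ler_wpM2r ?divr_ge0//.
  have := Cm i j; rewrite ler_norml => /andP[_ /div_s].
  have -> : Num.sqrt n%:R * (mu_n net n i j - mu net i j) / s = mu_n net n i j - mu net i j.
    by rewrite -/s; field; rewrite gt_eqF.
  lra.
by rewrite ler_wpM2l ?addr_ge0 ?mu_ge0// z_le.
Qed.

Lemma sys_drift_approx : exists u, in_U u /\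
  forall i, `|sys_drift n x z i - drift net Psi X u i| <= drift_gap_cst C i * (1 + q).
Proof.
pose i0 := Ordinal (classes_gt0 netP); pose j0 := Ordinal (pools_gt0 netP).
pose y := \sum_(j < J) yh j.
(* idle servers in their actual proportions; without idle servers any direction will do *)
pose us : 'rV[R]_J := if y == 0 then delta_mx 0 j0 else \row_j (yh j / y).
pose u := (delta_mx 0 i0 : 'rV[R]_I, us).
have y0 : 0 <= y by exact: sumr_ge0.
have delta1 m (k : 'I_m) : edot (delta_mx 0 k : 'rV[R]_m) = 1.
  rewrite /edot (bigD1 k)//= mxE !eqxx big1 ?addr0// => l lk.
  by rewrite mxE (negbTE lk) andbF.
have uU : in_U u.
  split => /=.
  - by move=> i; rewrite mxE.
  - move=> j; rewrite /us; case: ifP => _; rewrite mxE//.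
    by rewrite divr_ge0 ?yh_ge0.
  - exact: delta1.
  - rewrite /us; case: ifPn => [_|yn0]; first exact: delta1.
    rewrite /edot; under eq_bigr do rewrite mxE.
    by rewrite -mulr_suml -/y divff.
exists u; split => // i; apply: sys_drift_near => // j /=.
rewrite -/y /us; case: ifPn => [/eqP y00|yn0]; last first.
  by rewrite mxE mulrCA divff// mulr1.
rewrite y00 mul0r; apply/eqP; have /eqP := y00; rewrite psumr_eq0// => /allP/(_ j)/=.
by rewrite mem_index_enum => /(_ isT).
Qed.

End Fixed_n.

(** The condition at exponent 2 gives the bound for the quadratic form, with a
    cross term in [1 + q] from the comparison of the drifts; multiplying by
    [r ^ (kappa/2 - 1)] and absorbing the cross term gives it for the power.
    The term with [C2] leaves room for the second-order effect of the jumps. *)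
Lemma sys_generator_le (kappa : R) : FL_plus net Psi -> 1 <= kappa ->
  exists beta : 'rV[R]_I, (forall i, 0 < beta 0 i) /\ forall C2 : R, 0 <= C2 ->
  exists c C : R, [/\ 0 < c, 0 <= C & forall n x z, (0 < n)%N -> feasible n x z ->
    (1 + sqbnorm beta (X_hat net n x)) `^ (kappa / 2 - 1) * (kappa * \sum_(i < I) beta 0 i * X_hat net n x 0 i * sys_drift n x z i
      + C2 * (total_rate n x z / n%:R))
    <= - c * (1 + sqbnorm beta (X_hat net n x)) `^ (kappa / 2) + C * (1 + qsum n x z) `^ kappa].
Proof.
move=> FL k1.
have [beta [delta [c0 [c1 [c2 [b0 d0 [c00 c10 c20] FLq]]]]]] := FL_plus_quadratic FL.
exists beta; split=> // C2 C20.
have [C [C0 CP]] := scaling_bounds.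
pose p := kappa / 2.
have p0 : 0 < p by rewrite /p; lra.
pose Kp := 1 + J%:R * C.
pose Kbg := \sum_i (1 + beta 0 i) * `|drift_gap_cst C i|.
pose B := \sum_i beta 0 i.
pose Ks := 1 + Num.sqrt B * (Kp / delta).
pose K3 := c0 + c2 + c1 * Ks + 2 * Kbg.
pose K4 := `|rate_cst C|.
pose K5 := p * K3 + C2 * K4.
pose c := p * c2 / 2.
pose K6 := K5 * (K5 / c) `^ (kappa - 1).
have JC : 0 <= J%:R * C by rewrite mulr_ge0.
have Kp0 : 0 <= Kp by rewrite /Kp addr_ge0.
have B0 : 0 <= B by apply: sumr_ge0 => i _; exact/ltW.
have Ks0 : 0 <= Ks.
  by rewrite /Ks addr_ge0 ?mulr_ge0 ?sqrtr_ge0 ?invr_ge0 ?(ltW d0).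
have Kbg0 : 0 <= Kbg.
  by apply: sumr_ge0 => i _; rewrite mulr_ge0 ?addr_ge0 ?(ltW (b0 i)).
have K30 : 0 <= K3.
  by have := mulr_ge0 c10 Ks0; rewrite /K3; lra.
have K40 : 0 <= K4 by exact: normr_ge0.
have K50 : 0 <= K5 by apply: addr_ge0; apply: mulr_ge0 => //; exact: ltW.
have c_gt0 : 0 < c by rewrite /c divr_gt0// mulr_gt0.
exists c, K6; split => //; first by apply: mulr_ge0 => //; exact: powR_ge0.
move=> n x z n0 fz; set r := 1 + sqbnorm _ _.
set X := X_hat net n x; set q := qsum n x z.
have CPn := CP n.
have q0 : 0 <= q := qsum_ge0 n0 fz.
have sq0 : 0 <= sqbnorm beta X := sqbnorm_ge0 X b0.
have r1 : 1 <= r by rewrite /r lerDl.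
have r0 : 0 < r by lra.
pose s := Num.sqrt r.
have s1 : 1 <= s by rewrite -[leLHS]sqrtr1 ler_wsqrtr.
have s0 : 0 < s by lra.
have s2 : s * s = r by rewrite -expr2 sqr_sqrtr ?ltW.
have pX : pospart (edot X) <= Kp * (1 + q).
  have h : pospart (edot X) <= q + J%:R * C := pospart_edot_le n0 fz C0 CPn.
  by apply: (le_trans h); rewrite /Kp; have := mulr_ge0 JC q0; lra.
(* on the cone where the condition gives no decay, the state is dominated by the queues *)
have cone : delta * enorm X < edot X -> s <= Ks * (1 + q).
  move=> dX; have : enorm X <= Kp / delta * (1 + q).
    rewrite mulrAC ler_pdivlMr// mulrC (le_trans (ltW dX))// (le_trans _ pX)//.
    by rewrite /pospart le_max lexx.
  move=> eX; have : s <= 1 + Num.sqrt B * enorm X.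
    rewrite -[leRHS]ger0_norm -?sqrtr_sqr ?addr_ge0 ?mulr_ge0 ?sqrtr_ge0//.
    rewrite ler_wsqrtr// /r sqrrD expr1n mul1r exprMn sqr_sqrtr// sqr_sqrtr; last first.
      by apply: sumr_ge0 => i _; rewrite sqr_ge0.
    rewrite -addrA lerD2l (@le_trans _ _ (B * \sum_(i < I) X 0 i ^+ 2))//; last first.
      by rewrite lerDr mulrn_wge0// mulr_ge0 ?sqrtr_ge0.
    rewrite mulr_sumr; apply: ler_sum => i _; rewrite ler_wpM2r ?sqr_ge0//.
    rewrite /B (bigD1 i)//= lerDl; apply: sumr_ge0 => j _; exact/ltW.
  have : Num.sqrt B * enorm X <= Num.sqrt B * (Kp / delta * (1 + q)).
    by rewrite ler_wpM2l ?sqrtr_ge0.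
  by rewrite /Ks; lra.
have [u [uU gap]] : exists u, in_U u /\ forall i,
    `|sys_drift n x z i - drift net Psi X u i| <= drift_gap_cst C i * (1 + q).
  exact: sys_drift_approx.
have sq1 : 1 <= s * (1 + q) by rewrite -[leLHS]mulr1 ler_pM ?lerDl.
have sq10 : 0 <= s * (1 + q) by lra.
have main : 2 * \sum_(i < I) beta 0 i * X 0 i * sys_drift n x z i <=
    - c2 * r + K3 * (s * (1 + q)).
  have h1 := FLq X u uU.
  have h2 : sqbnorm beta X * (delta * enorm X < edot X)%R%:R <= Ks * (s * (1 + q)).
    have [/cone sK|_] := ltP (delta * enorm X) (edot X); last first.
      by rewrite mulr0 mulr_ge0.
    rewrite mulr1 (@le_trans _ _ (s * s))//; first by rewrite s2 /r lerDr.
    by rewrite mulrCA ler_pM2l.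
  have h3 : \sum_(i < I) beta 0 i * X 0 i * (sys_drift n x z i - drift net Psi X u i)
     <= Kbg * (s * (1 + q)).
    rewrite mulr_suml; apply: ler_sum => i _.
    rewrite (le_trans (ler_norm _))// normrM.
    have bx : `|beta 0 i * X 0 i| <= (1 + beta 0 i) * s.
      have bi := b0 i.
      rewrite -(@ler_pXn2r _ 2)// ?nnegrE ?mulr_ge0 ?addr_ge0 ?(ltW bi) ?(ltW s0)//.
      rewrite real_normK ?num_real// !exprMn [s ^+ 2]expr2 s2.
      have : beta 0 i * X 0 i ^+ 2 <= r.
        rewrite /r /sqbnorm (bigD1 i)//= addrCA lerDl addr_ge0// sumr_ge0// => j _.
        by rewrite mulr_ge0 ?sqr_ge0 ?(ltW (b0 j)).
      move=> h; rewrite (expr2 (beta 0 i)) -mulrA (@le_trans _ _ (beta 0 i * r)) ?ler_pM2l//.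
      by rewrite ler_pM2r//; nra.
    apply: (le_trans (ler_pM _ _ bx (gap i))) => //.
    rewrite [leLHS]mulrACA [leRHS]mulrAC -[leRHS]mulrA -mulrA mulrCA.
    rewrite [leRHS]mulrCA mulrCA.
    have := ler_norm (drift_gap_cst C i).
    have : 0 <= (1 + beta 0 i) * (s * (1 + q)).
      by rewrite mulr_ge0 ?addr_ge0 ?(ltW (b0 i)).
    nra.
  have h4 : \sum_(i < I) beta 0 i * X 0 i * sys_drift n x z i =
     \sum_(i < I) beta 0 i * X 0 i * drift net Psi X u i +
     \sum_(i < I) beta 0 i * X 0 i * (sys_drift n x z i - drift net Psi X u i).
    by rewrite -big_split; apply: eq_bigr => i _ /=; ring.
  have h5 : c1 * (sqbnorm beta X * (delta * enorm X < edot X)%R%:R) <= c1 * (Ks * (s * (1 + q))).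
    by rewrite ler_wpM2l.
  have h6 : (c0 + c2) * 1 <= (c0 + c2) * (s * (1 + q)) by rewrite ler_wpM2l// addr_ge0// ltW.
  rewrite h4 /K3; move: h1 h3 h5 h6; rewrite mulrA.
  have -> : c2 * sqbnorm beta X = c2 * r - c2 by rewrite /r; ring.
  lra.
have tr : total_rate n x z / n%:R <= K4 * (s * (1 + q)).
  apply: (le_trans (total_rate_le n0 fz C0 CPn)).
  apply: (@le_trans _ _ (K4 * (1 + q))); first by rewrite ler_wpM2r ?ler_norm ?addr_ge0.
  by rewrite ler_wpM2l// ler_peMl ?addr_ge0.
have inner : kappa * \sum_(i < I) beta 0 i * X 0 i * sys_drift n x z i
      + C2 * (total_rate n x z / n%:R) <= - (2 * c) * r + K5 * (s * (1 + q)).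
  have : p * (2 * \sum_(i < I) beta 0 i * X 0 i * sys_drift n x z i) <=
    p * (- c2 * r + K3 * (s * (1 + q))) by rewrite ler_pM2l.
  have : C2 * (total_rate n x z / n%:R) <= C2 * (K4 * (s * (1 + q))) by rewrite ler_wpM2l.
  rewrite (mulrA p) (_ : p * 2 = kappa); last by rewrite /p; field.
  rewrite (_ : - (2 * c) * r + K5 * (s * (1 + q)) = p * (- c2 * r + K3 * (s * (1 + q)))
    + C2 * (K4 * (s * (1 + q)))); last by rewrite /c /K5; field.
  lra.
have rp : r `^ (p - 1) * r = r `^ p by rewrite mulrC mulr_powRB1// ltW.
(* either half of the decay absorbs the cross term, or [s] is dominated by the queues *)
have young : r `^ (p - 1) * (K5 * (s * (1 + q))) <= c * r `^ p + K6 * (1 + q) `^ kappa.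
  have rho0 := powR_ge0 r (p - 1).
  have [small|big] := leP (K5 * (1 + q)) (c * s).
    rewrite -[leLHS]addr0; apply: lerD; last first.
      by apply: mulr_ge0; [apply: mulr_ge0 => //|]; exact: powR_ge0.
    have -> : c * r `^ p = r `^ (p - 1) * (s * (c * s)).
      by rewrite -rp (_ : s * (c * s) = c * r); [ring|rewrite -s2; ring].
    by rewrite ler_wpM2l// mulrCA ler_pM2l.
  rewrite -[leLHS]add0r; apply: lerD; first exact: mulr_ge0 (ltW c_gt0) (powR_ge0 _ _).
  have rs : r `^ (p - 1) * s = s `^ (kappa - 1).
    rewrite -s2 powRM ?(ltW s0)// -mulrA [_ `^ _ * s]mulrC mulr_powRB1 ?(ltW s0)//.
    rewrite -powRD; first by congr (_ `^ _); rewrite /p; field.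
    by rewrite (gt_eqF s0) implybT.
  have sb : s <= K5 / c * (1 + q) by rewrite mulrAC ler_pdivlMr// mulrC ltW.
  have -> : r `^ (p - 1) * (K5 * (s * (1 + q))) = K5 * (r `^ (p - 1) * s) * (1 + q) by ring.
  rewrite rs /K6.
  have q10 : 0 <= 1 + q by rewrite addr_ge0.
  have Kc0 : 0 <= K5 / c by rewrite divr_ge0 ?(ltW c_gt0).
  apply: (@le_trans _ _ (K5 * (K5 / c * (1 + q)) `^ (kappa - 1) * (1 + q))).
    rewrite ler_wpM2r// ler_wpM2l// ge0_ler_powR ?nnegrE ?(ltW s0) ?subr_ge0//.
    exact: mulr_ge0.
  rewrite powRM// -!mulrA [_ `^ _ * (1 + q)]mulrC mulr_powRB1//; lra.
rewrite -/p; apply: (le_trans (ler_wpM2l (powR_ge0 r (p - 1)) inner)).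
rewrite mulrDr; move: young; rewrite -rp; lra.
Qed.
End Drift.

(** * The Lyapunov function at a jump *)

Lemma sqrtDsqbnorm_coord (R : realType) (n : nat) (beta x : 'rV[R]_n) i :
  (forall i, 0 < beta 0 i) ->
  `|beta 0 i * x 0 i| <= (1 + beta 0 i) * Num.sqrt (1 + sqbnorm beta x).
Proof.
move=> b0; have bi := b0 i; have q0 := sqbnorm_ge0 x b0.
rewrite -(@ler_pXn2r _ 2)// ?nnegrE ?mulr_ge0 ?addr_ge0 ?(ltW bi) ?sqrtr_ge0//.
rewrite real_normK ?num_real// !exprMn sqr_sqrtr ?addr_ge0//.
have h : beta 0 i * x 0 i ^+ 2 <= 1 + sqbnorm beta x.
  rewrite /sqbnorm (bigD1 i)//= addrCA lerDl addr_ge0// sumr_ge0// => j _.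
  by rewrite mulr_ge0 ?sqr_ge0 ?(ltW (b0 j)).
rewrite (expr2 (beta 0 i)) -mulrA (@le_trans _ _ (beta 0 i * (1 + sqbnorm beta x))) ?ler_pM2l//.
rewrite ler_wpM2r ?addr_ge0//; nra.
Qed.

Section Jump.
Context (R : realType) (I J : nat) (net : network R I J).
Context (beta : 'rV[R]_I) (kappa : R).
Hypotheses (b0 : forall i, 0 < beta 0 i) (k1 : 1 <= kappa).
Let p := kappa / 2.
Let rr n x := 1 + sqbnorm beta (X_hat net n x).

(** At most [L] simultaneous jumps move the scaled state by [O(S / sqrt n)], so
    that the squared displacement is at most [L * S / n]: the second-order error
    is linear in the number of jumps. *)
Lemma lyapunov_jump (L : nat) : exists C2 : R, 0 <= C2 /\
  forall n (x x' : 'I_I -> nat) (S : nat), (0 < n)%N -> (S <= L)%N ->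
  (forall i, `|(x' i)%:R - (x i)%:R| <= S%:R :> R) ->
  rr n x' `^ p <= rr n x `^ p + rr n x `^ (p - 1) *
    (kappa * (\sum_(i < I) beta 0 i * X_hat net n x 0 i * (((x' i)%:R - (x i)%:R) / Num.sqrt n%:R))
      + C2 * (S%:R / n%:R)).
Proof.
have p0 : 0 < p by rewrite /p; have := k1; lra.
pose B := \sum_i beta 0 i.
pose Kb := \sum_i (1 + beta 0 i).
have B0 : 0 <= B by apply: sumr_ge0 => i _; exact/ltW.
have Kb0 : 0 <= Kb by apply: sumr_ge0 => i _; rewrite addr_ge0 ?(ltW (b0 i)).
pose b := 2 * Kb * L%:R + B * L%:R * L%:R.
pose K := 8 * Kb ^+ 2 * L%:R + 2 * B ^+ 2 * L%:R ^+ 3.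
have K0 : 0 <= K by rewrite /K addr_ge0 ?mulr_ge0 ?exprn_ge0.
exists (p * (B * L%:R) + p ^+ 2 * expR (p * b) * K); split.
  have p0' := ltW p0.
  have pe : 0 <= p ^+ 2 * expR (p * b) by apply: mulr_ge0; rewrite ?sqr_ge0 ?expR_ge0.
  by apply: addr_ge0; apply: mulr_ge0 => //; exact: mulr_ge0.
move=> n x x' S n0 SL dx.
pose s : R := Num.sqrt n%:R.
have s0 : 0 < s by rewrite sqrtr_gt0 ltr0n.
have ss : s ^+ 2 = n%:R by rewrite sqr_sqrtr.
have n1 : 1 <= n%:R :> R by rewrite ler1n.
have n0' : 0 < n%:R :> R by lra.
have s1 : 1 <= s by rewrite -[leLHS]sqrtr1 ler_wsqrtr.
pose d i : R := ((x' i)%:R - (x i)%:R) / s.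
pose t : R := S%:R / s.
have SL' : S%:R <= L%:R :> R by rewrite ler_nat.
have S0 : 0 <= S%:R :> R by [].
have t0 : 0 <= t by rewrite divr_ge0 ?(ltW s0).
have tL : t <= L%:R by rewrite ler_pdivrMr//; nra.
have dt i : `|d i| <= t by rewrite normrM normfV (gtr0_norm s0) ler_pM2r ?invr_gt0.
have t2 : t ^+ 2 <= L%:R * (S%:R / n%:R).
  by rewrite exprMn exprVn ss mulrA ler_pM2r ?invr_gt0// expr2 ler_wpM2r.
have Sn1 : S%:R / n%:R <= L%:R :> R.
  by rewrite ler_pdivrMr//; have : 0 <= L%:R :> R by []; nra.
have Sn0 : 0 <= S%:R / n%:R :> R by rewrite divr_ge0.
set r := rr n x; set r' := rr n x'.
have sq0 : 0 <= sqbnorm beta (X_hat net n x) := sqbnorm_ge0 _ b0.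
have r1 : 1 <= r by rewrite /r /rr lerDl.
have r0 : 0 < r by lra.
have r'0 : 0 < r' by have := sqbnorm_ge0 (X_hat net n x') b0; rewrite /r' /rr; lra.
pose w := Num.sqrt r.
have w0 : 0 <= w by exact: sqrtr_ge0.
have ww : w ^+ 2 = r by rewrite sqr_sqrtr// ltW.
have wr : w <= r by have : 1 <= w by [rewrite -[leLHS]sqrtr1 ler_wsqrtr]; nra.
pose A := \sum_(i < I) beta 0 i * X_hat net n x 0 i * d i.
pose D := \sum_(i < I) beta 0 i * d i ^+ 2.
have rE : r' = r + (2 * A + D).
  rewrite /r' /r /rr -addrA; congr (_ + _).
  rewrite /sqbnorm /A /D mulr_sumr -!big_split/=; apply: eq_bigr => i _.
  rewrite !mxE /d -/s; by field; rewrite gt_eqF.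
have AK : `|A| <= Kb * (w * t).
  rewrite (le_trans (ler_norm_sum _ _ _))// mulr_suml; apply: ler_sum => i _.
  by rewrite normrM mulrA ler_pM//; exact: sqrtDsqbnorm_coord.
have DK : D <= B * t ^+ 2.
  rewrite mulr_suml; apply: ler_sum => i _; rewrite ler_pM2l//.
  by rewrite -real_normK ?num_real// ler_pXn2r ?nnegrE.
have D0 : 0 <= D by apply: sumr_ge0 => i _; rewrite mulr_ge0 ?sqr_ge0 ?(ltW (b0 i)).
have eb : `|2 * A + D| <= b * r.
  rewrite (le_trans (ler_normD _ _))// normrM (ger0_norm D0) ger0_norm//.
  have : Kb * (w * t) <= Kb * (r * L%:R) by rewrite ler_wpM2l// ler_pM.
  have : B * t ^+ 2 <= B * (L%:R * L%:R).
    by rewrite ler_wpM2l// (le_trans t2)// ler_wpM2l.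
  have : B * (L%:R * L%:R) <= B * (L%:R * L%:R) * r by rewrite ler_peMr// !mulr_ge0.
  rewrite /b; lra.
have e2 : (2 * A + D) ^+ 2 / r <= K * (S%:R / n%:R).
  rewrite ler_pdivrMr//.
  have h1 : A ^+ 2 <= Kb ^+ 2 * (r * (L%:R * (S%:R / n%:R))).
    rewrite -real_normK ?num_real// (@le_trans _ _ ((Kb * (w * t)) ^+ 2))//.
      by apply: lerXn2r; rewrite ?nnegrE//; apply: mulr_ge0 => //; exact: mulr_ge0.
    rewrite exprMn [(w * t) ^+ 2]exprMn ww.
    by apply: ler_wpM2l; [exact: sqr_ge0|apply: ler_wpM2l => //; exact: ltW].
  have h2 : D ^+ 2 <= B ^+ 2 * (L%:R ^+ 3 * (S%:R / n%:R)) * r.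
    rewrite (@le_trans _ _ ((B * t ^+ 2) ^+ 2))//.
      by apply: lerXn2r; rewrite ?nnegrE//; apply: mulr_ge0 => //; exact: exprn_ge0.
    rewrite exprMn (@le_trans _ _ (B ^+ 2 * (L%:R ^+ 3 * (S%:R / n%:R))))//; last first.
      by rewrite ler_peMr ?mulr_ge0 ?exprn_ge0.
    rewrite ler_wpM2l ?sqr_ge0// (_ : L%:R ^+ 3 * _ = (L%:R * L%:R) * (L%:R * (S%:R / n%:R))).
      rewrite (expr2 (t ^+ 2)) ler_pM ?exprn_ge0//.
      by rewrite (le_trans t2)// ler_wpM2l.
    by ring.
  have h3 : (2 * A + D) ^+ 2 <= 8 * A ^+ 2 + 2 * D ^+ 2.
    have := sqr_ge0 (2 * A - D); rewrite !expr2; nra.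
  rewrite (le_trans h3)// /K; lra.
have re0 : 0 < r + (2 * A + D) by rewrite -rE.
have := powR_le_taylor2 p0 r0 re0 eb; rewrite -rE => /le_trans; apply.
rewrite -[X in _ <= X + _](mulr_powRB1 (ltW r0) p0) [r * _]mulrC -mulrDr ler_wpM2l ?powR_ge0//.
rewrite -/A -addrA lerD2l.
have h1 : p ^+ 2 * expR (p * b) * ((2 * A + D) ^+ 2 / r) <= p ^+ 2 * expR (p * b) * (K * (S%:R / n%:R)).
  by rewrite ler_wpM2l// mulr_ge0 ?sqr_ge0 ?expR_ge0.
have h2 : p * D <= p * (B * (L%:R * (S%:R / n%:R))).
  by rewrite ler_pM2l// (le_trans DK)// ler_wpM2l.
have h3 : p * (2 * A + D) = kappa * A + p * D by rewrite /p; field.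
rewrite h3; lra.
Qed.
End Jump.

(** * Comparison with the Euclidean norm *)

Lemma enorm_powR_le (R : realType) (n : nat) (beta : 'rV[R]_n) (kappa : R) :
  (forall i, 0 < beta 0 i) -> 0 <= kappa -> exists C : R, 0 <= C /\
  forall x, enorm x `^ kappa <= C * (1 + sqbnorm beta x) `^ (kappa / 2).
Proof.
move=> b0 k0; pose K := \sum_(i < n) (beta 0 i)^-1.
have K0 : 0 <= K by apply: sumr_ge0 => i _; rewrite invr_ge0 ltW.
exists (K `^ (kappa / 2)); split; first exact: powR_ge0.
move=> x; have q0 := sqbnorm_ge0 x b0.
rewrite -powRM ?addr_ge0// [kappa in leLHS](_ : _ = 2 * (kappa / 2)); last by field.
rewrite powRrM powR_mulrn ?enorm_ge0// ge0_ler_powR ?nnegrE ?divr_ge0 ?sqr_ge0//.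
  by rewrite mulr_ge0 ?addr_ge0.
rewrite sqr_sqrtr; last by apply: sumr_ge0 => i _; rewrite sqr_ge0.
rewrite mulr_suml; apply: ler_sum => i _; rewrite mulrC ler_pdivlMr// mulrC.
rewrite /sqbnorm (bigD1 i)//= addrCA lerDl addr_ge0// sumr_ge0// => j _.
by rewrite mulr_ge0 ?sqr_ge0 ?(ltW (b0 j)).
Qed.

Lemma powR_sqbnorm_le (R : realType) (n : nat) (beta : 'rV[R]_n) (kappa : R) :
  (forall i, 0 < beta 0 i) -> 0 <= kappa -> exists C : R, 0 <= C /\
  forall x, (1 + sqbnorm beta x) `^ (kappa / 2) <= C * (1 + enorm x `^ kappa).
Proof.
move=> b0 k0; pose B := \sum_(i < n) beta 0 i.
have B0 : 0 <= B by apply: sumr_ge0 => i _; rewrite ltW.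
exists ((1 + B) `^ (kappa / 2)); split; first exact: powR_ge0.
move=> x; have q0 := sqbnorm_ge0 x b0; have x0 := enorm_ge0 x.
pose m := Num.max 1 (enorm x).
have m1 : 1 <= m by rewrite le_max lexx.
have xm : enorm x <= m by rewrite le_max lexx orbT.
have m2 : 1 <= m ^+ 2 by rewrite exprn_ege1.
have le1 : 1 + sqbnorm beta x <= (1 + B) * m ^+ 2.
  have : sqbnorm beta x <= B * m ^+ 2.
    rewrite mulr_suml; apply: ler_sum => i _; rewrite ler_pM2l//.
    rewrite -real_normK ?num_real// lerXn2r ?nnegrE//; first lra.
    exact: le_trans (enorm_coord _ _) xm.
  lra.
apply: (@le_trans _ _ (((1 + B) * m ^+ 2) `^ (kappa / 2))).
  have h0 : 0 <= 1 + sqbnorm beta x by lra.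
  by apply: ge0_ler_powR => //; rewrite ?nnegrE ?divr_ge0//; exact: le_trans le1.
rewrite powRM ?addr_ge0 ?sqr_ge0// ler_wpM2l ?powR_ge0//.
rewrite -powR_mulrn; last lra.
rewrite -powRrM (_ : 2%:R * (kappa / 2) = kappa); last by field.
rewrite /m; case: (leP 1 (enorm x)) => _; first by rewrite lerDr.
by rewrite powR1 lerDl powR_ge0.
Qed.

Lemma qsum_powR_le (R : realType) (I J : nat) (kappa : R) : 0 <= kappa ->
  exists C : R, 0 <= C /\
  forall n (x : 'I_I -> nat) (z : 'I_I -> 'I_J -> nat), 0 <= qsum R n x z ->
  (1 + qsum R n x z) `^ kappa <= C * (1 + enorm (Q_hat R n x z)) `^ kappa.
Proof.
move=> k0; exists ((1 + I%:R) `^ kappa); split; first exact: powR_ge0.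
move=> n x z q0; have e0 := enorm_ge0 (Q_hat R n x z).
rewrite -powRM ?addr_ge0// ge0_ler_powR ?nnegrE ?mulr_ge0 ?addr_ge0//.
have : qsum R n x z <= I%:R * enorm (Q_hat R n x z).
  apply: le_trans (sum_coord_le _); apply: ler_sum => i _.
  by rewrite mxE ler_norm.
have : 0 <= I%:R :> R by [].
lra.
Qed.

(** * Events described by countably many values *)

Section SigmaAlgebra.
Context (T : Type) (C : set (set T)).
Hypothesis CP : sigma_algebra setT C.

Lemma salg_setC A : C A -> C (~` A).
Proof. by case: CP => _ h _ /h; rewrite setTD. Qed.

Lemma salg_bigcup (A : nat -> set T) : (forall k, C (A k)) -> C (\bigcup_k A k).
Proof. by case: CP => _ _; apply. Qed.

Lemma salg_setU A B : C A -> C B -> C (A `|` B).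
Proof.
move=> CA CB; rewrite -bigcup2E; apply: salg_bigcup => -[|[|k]]//=.
by case: CP.
Qed.

Lemma salg_setI A B : C A -> C B -> C (A `&` B).
Proof.
move=> CA CB; rewrite -[A `&` B]setCK setCI.
by apply: salg_setC; apply: salg_setU; exact: salg_setC.
Qed.

Lemma salg_setT : C setT.
Proof. by rewrite -setC0; apply: salg_setC; case: CP. Qed.

Lemma salg_preimage (K : countType) (F : T -> K) :
  (forall k, C [set x | F x = k]) -> forall B : set K, C (F @^-1` B).
Proof.
move=> CF B.
have -> : F @^-1` B = \bigcup_n
   (if unpickle n is Some k then (if `[< B k >] then [set x | F x = k] else set0) else set0).
  apply/seteqP; split => x /=.
    by move=> Bx; exists (pickle (F x)) => //; rewrite pickleK; case: asboolP.
  by move=> [n _]; case: unpickle => [k|//]; case: asboolP => [Bk|//] /= ->.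
apply: salg_bigcup => n; case: unpickle => [k|]; last by case: CP.
by case: asboolP => // _; case: CP => + _ _.
Qed.

Lemma salg_forall (K : finType) (F : K -> set T) :
  (forall k, C (F k)) -> C [set x | forall k, F k x].
Proof.
move=> CF; rewrite (_ : [set x | _] = [set x | forall k, k \in enum K -> F k x]); last first.
  by apply/seteqP; split => x /= h k; [move=> _|apply: h; rewrite mem_enum].
elim: (enum K) => [|a s IH].
  by rewrite (_ : [set x | _] = setT)//; [exact: salg_setT|exact/seteqP].
rewrite (_ : [set x | _] = F a `&` [set x | forall k, k \in s -> F k x]).
  exact: salg_setI.
apply/seteqP; split => x /=.
  move=> h; split; first by apply: h; rewrite mem_head.
  by move=> k ks; apply: h; rewrite in_cons ks orbT.
by move=> [Fa h] k; rewrite in_cons => /predU1P[->//|/h].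
Qed.

Lemma salg_ffun (K : finType) (L : countType) (F : T -> K -> L) :
  (forall k l, C [set x | F x k = l]) ->
  forall B : set {ffun K -> L}, C [set x | B [ffun k => F x k]].
Proof.
move=> CF B.
apply: (@salg_preimage _ (fun x => [ffun k => F x k]) _ B) => f.
rewrite (_ : [set x | _] = [set x | forall k, F x k = f k]).
  by apply: (@salg_forall _ (fun k => [set x | F x k = f k])) => k; exact: CF.
apply/seteqP; split => x /=; first by move=> <- k; rewrite ffunE.
by move=> h; apply/ffunP => k; rewrite ffunE.
Qed.

Lemma salg_pair (K L : countType) (F : T -> K) (G : T -> L) :
  (forall k, C [set x | F x = k]) -> (forall k, C [set x | G x = k]) ->
  forall B : set (K * L), C [set x | B (F x, G x)].
Proof.
move=> CF CG B; apply: (@salg_preimage _ (fun x => (F x, G x)) _ B) => -[k l].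
rewrite (_ : [set x | _] = [set x | F x = k] `&` [set x | G x = l]).
  exact: salg_setI.
by apply/seteqP; split => x /=; [case|move=> [-> ->]].
Qed.

End SigmaAlgebra.

Lemma measurable_fun_natP d (T : measurableType d) (f : T -> nat) :
  (forall k, measurable [set x | f x = k]) <-> measurable_fun setT f.
Proof.
split=> [h _ B _|mf k].
  by rewrite setTI; apply: (salg_preimage (@sigma_algebra_measurable d T) h).
by rewrite -[X in measurable X]setTI; exact: (mf measurableT [set k] I).
Qed.

(** A counting process evaluated at a random time: by right-continuity,
    [N t <= m] holds iff [N q <= m] for some rational [q > t]. *)
Lemma measurable_counting (R : realType) d d' (T : measurableType d)
    (S : measurableType d') (N : R -> T -> nat) (tau : S -> R) (pi : S -> T) :
  (forall t, measurable_fun setT (N t)) ->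
  (forall s t w, s <= t -> (N s w <= N t w)%N) ->
  (forall t w, \forall s \near t^'+, N s w = N t w) ->
  measurable_fun setT tau -> measurable_fun setT pi ->
  measurable_fun setT (fun x => N (tau x) (pi x)).
Proof.
move=> mN monoN rcN mtau mpi.
have le m : measurable [set x | (N (tau x) (pi x) <= m)%N].
  have -> : [set x | (N (tau x) (pi x) <= m)%N] =
    \bigcup_(q in [set: rat]) ([set x | tau x < ratr q] `&` [set x | (N (ratr q) (pi x) <= m)%N]).
    apply/seteqP; split => x /=.
      move=> Nm; have NE := rcN (tau x) (pi x).
      near (tau x)^'+ => s.
      have /rat_in_itvoo[q] : tau x < s by near: s; exact: nbhs_right_gt.
      rewrite in_itv/= => /andP[xq qs]; exists q => //; split=> //=.
      by apply: leq_trans (monoN _ _ _ (ltW qs)) _; rewrite (near NE s).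
    move=> [q _ [/= xq]]; apply: leq_trans; exact/monoN/ltW.
  apply: bigcupT_measurable_rat => q; apply: measurableI.
    rewrite -[X in measurable X]setTI (_ : [set x | _] = tau @^-1` `]-oo, ratr q[%classic).
      exact: mtau.
    by apply/seteqP; split => x /=; rewrite in_itv.
  have := measurableT_comp (mN (ratr q)) mpi => /(_ measurableT [set k | (k <= m)%N] I).
  by rewrite setTI.
apply/measurable_fun_natP => -[|k].
  rewrite (_ : [set x | _] = [set x | (N (tau x) (pi x) <= 0)%N]) //.
  by apply/seteqP; split => x /=; [move=> ->|rewrite leqn0 => /eqP].
rewrite (_ : [set x | _] = [set x | (N (tau x) (pi x) <= k.+1)%N] `&`
   ~` [set x | (N (tau x) (pi x) <= k)%N]).
  by apply: measurableI => //; exact: measurableC.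
apply/seteqP; split => x /=; first by move=> ->; split => //; rewrite ltnn.
by move=> [h /negP]; rewrite -ltnNge => h'; apply/eqP; rewrite eqn_leq h h'.
Unshelve. all: by end_near. Qed.

Lemma measurable_of_nat d d' (T : measurableType d) (S : measurableType d')
    (Y : T -> nat) (g : nat -> S) :
  measurable_fun setT Y -> measurable_fun setT (fun w => g (Y w)).
Proof.
move=> mY _ B mB; have := mY measurableT (g @^-1` B) I.
by rewrite !setTI.
Qed.

Lemma integral_nat_fun (R : realType) d (T : measurableType d)
    (mu : {measure set T -> \bar R}) (F : set T) (Y : T -> nat) (g : nat -> R) :
  measurable F -> measurable_fun setT Y -> (forall m, 0 <= g m) ->
  (\int[mu]_(w in F) (g (Y w))%:E = \sum_(m <oo) (g m)%:E * mu (F `&` [set w | Y w = m]))%E.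
Proof.
move=> mF mY g0.
have mYm m : measurable [set w | Y w = m] by apply: (measurable_fun_natP Y).2.
have {1}-> : F = \bigcup_m (F `&` [set w | Y w = m]).
  apply/seteqP; split => w /=; last by move=> [m _ []].
  by move=> Fw; exists (Y w).
rewrite ge0_integral_bigcup//.
- apply: eq_eseriesr => m _.
  rewrite -integral_cst//; last exact: measurableI.
  by apply: eq_integral => w; rewrite inE => -[_ /= ->].
- by move=> m; exact: measurableI.
- by apply/measurable_EFinP; apply: measurable_funTS; exact: measurable_of_nat.
- by move=> w _; rewrite lee_fin.
- by move=> i j _ _ [w [[_ /= <-] [_ /= <-]]].
Qed.

(** * Moments of the Poisson distribution *)

Section PoissonMoments.
Context (R : realType) (r : R).
Hypothesis r0 : 0 < r.

Lemma poisson_pmf_sum : (\sum_(m <oo) (poisson_pmf r m)%:E = 1)%E.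
Proof.
have : poisson_prob r 0%N setT = 1%E by exact: probability_setT.
rewrite /poisson_prob r0 => <-.
by rewrite nneseries_esumT// => m; rewrite lee_fin poisson_pmf_ge0.
Qed.

Let pmfS m : poisson_pmf r m.+1 * m.+1%:R = r * poisson_pmf r m.
Proof.
rewrite /poisson_pmf r0 factS natrM exprS invfM.
by field; rewrite pnatr_eq0 -lt0n fact_gt0 -[1]/(1%:R) -natrD pnatr_eq0.
Qed.

Let series_shift (f : nat -> R) : (forall m, 0 <= f m) -> f 0%N = 0 ->
  (\sum_(m <oo) (f m)%:E = \sum_(m <oo) (f m.+1)%:E)%E.
Proof.
move=> f0 f00; rewrite nneseries_recl//; last by move=> k _; rewrite lee_fin.
rewrite f00 add0e -(@nneseries_addn _ (fun m => (f m)%:E) 1); last first.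
  by move=> m; rewrite lee_fin.
by apply: eq_eseriesr => m _; rewrite addn1.
Qed.

Lemma poisson_pmf_mean : (\sum_(m <oo) (m%:R * poisson_pmf r m)%:E = r%:E)%E.
Proof.
rewrite (@series_shift (fun m => m%:R * poisson_pmf r m)) ?mul0r//; last first.
  by move=> m; rewrite mulr_ge0 ?poisson_pmf_ge0.
under eq_eseriesr do rewrite mulrC pmfS EFinM.
rewrite nneseriesZl; last by move=> m _; rewrite lee_fin poisson_pmf_ge0.
by rewrite poisson_pmf_sum mule1.
Qed.

Lemma poisson_pmf_moment2 :
  (\sum_(m <oo) ((m * m.-1)%:R * poisson_pmf r m)%:E = (r ^+ 2)%:E)%E.
Proof.
rewrite (@series_shift (fun m => (m * m.-1)%:R * poisson_pmf r m)) ?mul0r//; last first.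
  by move=> m; rewrite mulr_ge0 ?poisson_pmf_ge0.
rewrite (eq_eseriesr (g := fun m => r%:E * (m%:R * poisson_pmf r m)%:E)%E); last first.
  move=> m _ /=; rewrite natrM -EFinM; congr EFin.
  by rewrite [RHS]mulrCA -pmfS; ring.
rewrite nneseriesZl; last by move=> m _; rewrite lee_fin mulr_ge0 ?poisson_pmf_ge0.
by rewrite poisson_pmf_mean.
Qed.

End PoissonMoments.

(** * Time integrals of a process *)

Section TimeIntegral.
Context (R : realType) d (T : measurableType d).
Implicit Types f : R * T -> R.
Local Notation leb := (@lebesgue_measure R).

Lemma measurable_path f w : measurable_fun setT f ->
  measurable_fun setT (fun s => f (s, w)).
Proof. by move=> mf; apply: measurableT_comp => //; exact: pair2_measurable. Qed.

Lemma lebesgue_itvcc (a c : R) : a <= c -> leb `[a, c] = (c - a)%:E.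
Proof.
rewrite lebesgue_measure_itv /= lte_fin le_eqVlt => /predU1P[->|->//].
by rewrite ltxx subrr.
Qed.

Lemma path_integrable f w (a c K : R) : measurable_fun setT f ->
  (forall s, a <= s <= c -> `|f (s, w)| <= K) ->
  leb.-integrable `[a, c] (fun s => (f (s, w))%:E).
Proof.
move=> mf fK.
have fin : (leb `[a, c] < +oo)%E.
  by rewrite lebesgue_measure_itv/=; case: ifP => // _; rewrite ltry.
apply: (@measurable_bounded_integrable _ _ _ leb (fun s => f (s, w)) _ _ fin) => //.
- by apply: measurable_funTS; exact: measurable_path.
- exists K; split; first exact: num_real.
  move=> M KM s /=; rewrite in_itv /= => /fK h; exact: le_trans h (ltW KM).
Qed.

Let restrictE (g : R * T -> \bar R) (a c : R) s w :
  (g \_ (`[a, c] `*` setT)) (s, w) = ((fun s => g (s, w)) \_ `[a, c]) s.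
Proof.
rewrite !patchE (_ : ((s, w) \in `[a, c] `*` setT) = (s \in `[a, c]%classic))//.
by apply/idP/idP; rewrite !inE /=; [case|].
Qed.

Let mrestrict (g : R * T -> \bar R) (a c : R) : measurable_fun setT g ->
  measurable_fun setT (g \_ (`[a, c] `*` setT)).
Proof.
move=> mg; apply/(measurable_restrictT _ _).1; first exact: measurableX.
exact: measurable_funTS.
Qed.

Let restrict_ge0 (g : R * T -> \bar R) (a c : R) : (forall p, 0 <= g p)%E ->
  forall p, (0 <= (g \_ (`[a, c] `*` setT)) p)%E.
Proof. by move=> g0 p; rewrite patchE; case: ifP. Qed.

Lemma measurable_time_integral (g : R * T -> \bar R) (a c : R) :
  measurable_fun setT g -> (forall p, 0 <= g p)%E ->
  measurable_fun setT (fun w => \int[leb]_(s in `[a, c]) g (s, w))%E.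
Proof.
move=> mg g0.
rewrite (_ : (fun w => _) = fubini_G leb (g \_ (`[a, c] `*` setT))).
  by apply: measurable_fun_fubini_tonelli_G; [exact: mrestrict|exact: restrict_ge0].
apply/funext => w; rewrite integral_mkcond; apply: eq_integral => s _.
by rewrite restrictE.
Qed.

Lemma time_tonelli (P : probability T R) (g : R * T -> \bar R) (a c : R) :
  measurable_fun setT g -> (forall p, 0 <= g p)%E ->
  (\int[P]_w \int[leb]_(s in `[a, c]) g (s, w) =
   \int[leb]_(s in `[a, c]) \int[P]_w g (s, w))%E.
Proof.
move=> mg g0.
have E := @fubini_tonelli _ _ _ _ _ leb P _ (mrestrict a c mg) (restrict_ge0 a c g0).
transitivity (\int[P]_w \int[leb]_s (g \_ (`[a, c] `*` setT)) (s, w))%E.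
  apply: eq_integral => w _; rewrite integral_mkcond; apply: eq_integral => s _.
  by rewrite restrictE.
rewrite -E [RHS]integral_mkcond; apply: eq_integral => s _.
rewrite patchE; case: ifPn => sac.
  by apply: eq_integral => w _; rewrite restrictE patchE sac.
apply: integral0_eq => w _; rewrite restrictE patchE (negbTE sac)//.
Qed.

Definition tint f (a c : R) (w : T) : R := \int[leb]_(s in `[a, c]) f (s, w).

Lemma measurable_tint f (a c : R) : measurable_fun setT f ->
  measurable_fun setT (tint f a c).
Proof.
move=> mf; have mF : measurable_fun setT (EFin \o f) by exact/measurable_EFinP.
rewrite /tint /Rintegral; under eq_fun do rewrite integralE.
apply: measurableT_comp => //; apply: emeasurable_funB.
  rewrite (_ : (fun w => _) = fun w => (\int[leb]_(s in `[a, c]) ((EFin \o f)^\+ (s, w)))%E).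
    by apply: measurable_time_integral => //; exact: measurable_funepos.
  by apply/funext => w; apply: eq_integral => s _; rewrite !funeposE.
rewrite (_ : (fun w => _) = fun w => (\int[leb]_(s in `[a, c]) ((EFin \o f)^\- (s, w)))%E).
  by apply: measurable_time_integral => //; exact: measurable_funeneg.
by apply/funext => w; apply: eq_integral => s _; rewrite !funenegE.
Qed.

End TimeIntegral.

(** * Sampling a time integral at deterministic times *)

Section Sampling.
Context (R : realType) d (T : measurableType d) (P : probability T R).
Context (f : R * T -> R) (b a c : R).
Hypotheses (mf : measurable_fun setT f) (f0 : forall p, 0 <= f p) (fb : forall p, f p <= b).
Hypothesis ac : a < c.
Local Notation leb := (@lebesgue_measure R).
Let h := c - a.
Let fbar w := tint f a c w / h.
Let err (us : seq R) w := \sum_(u <- us) f (u, w) - (size us)%:R * fbar w.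

Let h0 : 0 < h. Proof. by rewrite subr_gt0. Qed.

Let mfbar : measurable_fun setT fbar.
Proof. by apply: measurable_funM => //; exact: measurable_tint. Qed.

Let msection u : measurable_fun setT (fun w => f (u, w)).
Proof. by apply: measurableT_comp => //; exact: pair1_measurable. Qed.

Let merr us : measurable_fun setT (err us).
Proof.
apply: measurable_funB; last by apply: measurable_funM.
exact: measurable_sum.
Qed.

Let fintegrable w : leb.-integrable `[a, c] (fun s => (f (s, w))%:E).
Proof. by apply: (@path_integrable _ _ _ _ _ _ _ b) => // s _; rewrite ger0_norm. Qed.

Let fbar_bound w : 0 <= fbar w <= b.
Proof.
apply/andP; split.
  by rewrite divr_ge0 ?(ltW h0)// Rintegral_ge0// => s _.
rewrite ler_pdivrMr// -[leRHS]/(b * h).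
have -> : b * h = \int[leb]_(s in `[a, c]) b.
  by rewrite Rintegral_cst//= lebesgue_itvcc// ltW.
apply: le_Rintegral => //; first exact: fintegrable.
by apply: (@path_integrable _ _ _ (fun=> b) w _ _ `|b|).
Qed.

Let tint_split w : \int[leb]_(s in `[a, c]) (f (s, w) - fbar w) = 0.
Proof.
rewrite RintegralB//; [|exact: fintegrable|]; last first.
  by apply: (@path_integrable _ _ _ (fun=> fbar w) w _ _ `|fbar w|).
rewrite Rintegral_cst//= lebesgue_itvcc ?(ltW ac)//= -/h.
by rewrite /fbar mulfVK ?gt_eqF// subrr.
Qed.

(** The deviation from the time average integrates to zero, so that there is no
    cross term. *)
Let path_variance (S : R) w :
  (\int[leb]_(s in `[a, c]) ((S + (f (s, w) - fbar w)) ^+ 2)%:E <= (h * (S ^+ 2 + b ^+ 2))%:E)%E.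
Proof.
have /andP[fw0 fwb] := fbar_bound w.
have mg : measurable_fun setT (fun p : R * T => S ^+ 2 + b ^+ 2 + 2 * S * (f p - fbar w)).
  by apply: measurable_funD => //; apply: measurable_funM => //; apply: measurable_funB.
have gb (s : R) : `|f (s, w) - fbar w| <= b.
  by rewrite ler_norml; have := f0 (s, w); have := fb (s, w) => ? ?; apply/andP; split; lra.
have ig : leb.-integrable `[a, c] (fun s => (S ^+ 2 + b ^+ 2 + 2 * S * (f (s, w) - fbar w))%:E).
  apply: (@path_integrable _ _ _ _ w _ _ (S ^+ 2 + b ^+ 2 + `|2 * S| * b) mg) => s _.
  rewrite (le_trans (ler_normD _ _))// ger0_norm ?addr_ge0 ?sqr_ge0// lerD2l normrM.
  by rewrite ler_wpM2l.
have -> : (h * (S ^+ 2 + b ^+ 2))%:E = (\int[leb]_(s in `[a, c])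
    (S ^+ 2 + b ^+ 2 + 2 * S * (f (s, w) - fbar w))%:E)%E.
  rewrite -[RHS]fineK; last exact: integrable_fin_num.
  congr EFin; rewrite -/(Rintegral _ _ _) RintegralD//; last 2 first.
  - by apply: (@path_integrable _ _ _ (fun=> S ^+ 2 + b ^+ 2) w _ _ `|S ^+ 2 + b ^+ 2|).
  - apply: (@path_integrable _ _ _ (fun p => 2 * S * (f p - fbar w)) w _ _ (`|2 * S| * b)).
      by apply: measurable_funM => //; apply: measurable_funB.
    by move=> s _; rewrite normrM ler_wpM2l.
  rewrite RintegralZl//; last first.
    apply: (@path_integrable _ _ _ (fun p => f p - fbar w) w _ _ b) => //.
    exact: measurable_funB.
  by rewrite tint_split mulr0 addr0 Rintegral_cst//= lebesgue_itvcc ?(ltW ac)//= mulrC.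
apply: ge0_le_integral => //.
- by move=> s _; rewrite lee_fin sqr_ge0.
- apply/measurable_EFinP/measurable_funTS/measurable_funX/measurable_funD => //.
  by apply: measurable_funB => //; exact: measurable_path.
- exact: measurable_int ig.
- move=> s _; rewrite lee_fin; have := gb s; rewrite ler_norml => /andP[? ?]; nra.
Qed.

Let errS u us w : err (u :: us) w = err us w + (f (u, w) - fbar w).
Proof. by rewrite /err big_cons /= -natr1; ring. Qed.

(** Averaging the second moment over the position of the next time shows that
    some position does no worse than the average; the extra 1 makes the
    inequality strict. *)
Let next_time us (K : R) :
  (\int[P]_w ((err us w) ^+ 2)%:E <= K%:E)%E ->
  exists u, a <= u <= c /\
    (\int[P]_w ((err (u :: us) w) ^+ 2)%:E <= (K + (b ^+ 2 + 1))%:E)%E.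
Proof.
move=> EK; apply: contrapT => /forallNP no.
pose g (p : R * T) := ((err us p.2 + (f p - fbar p.2)) ^+ 2)%:E.
have mg : measurable_fun setT g.
  apply/measurable_EFinP/measurable_funX/measurable_funD.
    exact: measurableT_comp (merr us) measurable_snd.
  by apply: measurable_funB => //; exact: measurableT_comp mfbar measurable_snd.
have g0 p : (0 <= g p)%E by rewrite lee_fin sqr_ge0.
have up : (\int[P]_w \int[leb]_(s in `[a, c]) g (s, w) <= (h * (K + b ^+ 2))%:E)%E.
  apply: (@le_trans _ _ (\int[P]_w (h%:E * (err us w ^+ 2)%:E + (h * b ^+ 2)%:E))%E).
    apply: ge0_le_integral => //.
    - by move=> w _; apply: integral_ge0.
    - exact: measurable_time_integral.
    - apply: emeasurable_funD => //; apply: measurable_funeM.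
      exact/measurable_EFinP/measurable_funX.
    - by move=> w _; rewrite -EFinM -EFinD -mulrDr; exact: (path_variance (err us w) w).
  rewrite ge0_integralD//; last 3 first.
  - by move=> w _; rewrite -EFinM lee_fin mulr_ge0 ?sqr_ge0 ?(ltW h0).
  - by apply: measurable_funeM; exact/measurable_EFinP/measurable_funX.
  - by move=> w _; rewrite lee_fin mulr_ge0 ?sqr_ge0 ?(ltW h0).
  rewrite ge0_integralZl//; last 3 first.
  - exact/measurable_EFinP/measurable_funX.
  - by move=> w _; rewrite lee_fin sqr_ge0.
  - by rewrite lee_fin ltW.
  rewrite integral_cst//= probability_setT mule1 mulrDr (EFinD (h * K)); apply: leeD2r.
  by rewrite (EFinM h) lee_pmul2l ?lte_fin.
have low : ((h * (K + (b ^+ 2 + 1)))%:E <= \int[P]_w \int[leb]_(s in `[a, c]) g (s, w))%E.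
  rewrite (time_tonelli P _ _ mg g0).
  have -> : (h * (K + (b ^+ 2 + 1)))%:E = (\int[leb]_(s in `[a, c]) (K + (b ^+ 2 + 1))%:E)%E.
    by rewrite integral_cst//= lebesgue_itvcc ?(ltW ac)// -EFinM mulrC.
  have K0 : (0 <= K%:E)%E.
    by apply: le_trans EK; apply: integral_ge0 => w _; rewrite lee_fin sqr_ge0.
  apply: ge0_le_integral => //.
  - move=> s _; rewrite lee_fin; move: K0; rewrite lee_fin; have := sqr_ge0 b; lra.
  - apply: measurable_funTS; exact: (@measurable_fun_fubini_tonelli_F _ _ _ _ _ P g mg g0).
  - move=> s; rewrite /= in_itv/= => sac; apply: ltW; rewrite ltNge; apply/negP => le.
    apply: (no s); split => //; under eq_integral do rewrite errS; exact: le.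
have := le_trans low up; rewrite lee_fin ler_pM2l//; lra.
Qed.

(** The second moment of the error grows linearly with the number of times, not
    quadratically.  The time integral of an adapted process is thereby a limit
    in probability of finite sums of adapted variables, and can be handled as
    an adapted variable without a progressively measurable version of the
    process. *)
Lemma sampling_times m : exists us : seq R,
  [/\ size us = m, forall u, u \in us -> a <= u <= c &
   (\int[P]_w ((\sum_(u <- us) f (u, w) - m%:R * (tint f a c w / (c - a))) ^+ 2)%:E
     <= (m%:R * (b ^+ 2 + 1))%:E)%E].
Proof.
elim: m => [|m [us [<- usI us2]]].
  exists [::]; split => //; rewrite mul0r.
  by under eq_integral do rewrite big_nil mul0r subrr expr0n; rewrite integral0.
have [u [uI u2]] := next_time us2.
exists (u :: us); split => //.
  by move=> v; rewrite in_cons => /predU1P[->//|/usI].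
rewrite -[in leRHS]natr1 (mulrDl _ 1) mul1r; exact: u2.
Qed.

End Sampling.

(** * State and past of the system *)

Section Sys.
Context (R : realType) (I J : nat) (net : network R I J) (n : nat).
Context (d : measure_display) (Omega : measurableType d) (P : probability Omega R).
Context (N : source I J -> R -> Omega -> nat).
Context (X : R -> Omega -> 'I_I -> nat).
Context (Z : R -> Omega -> 'I_I -> 'I_J -> nat).
Context (x0 : 'I_I -> nat).
Hypothesis netP : network_assumptions net.
Hypothesis n0 : (0 < n)%N.
Hypothesis hs : is_system net n P N X Z x0.
Hypothesis ha : admissible net n P N X Z.
Local Notation leb := (@lebesgue_measure R).
Local Notation state := (('I_I -> nat) * ('I_I -> 'I_J -> nat))%type.
Local Notation rate := (rate net n).
Local Notation past := (past net n P N X Z).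

Let pastP t : sigma_algebra setT (past t).
Proof. exact: smallest_sigma_algebra. Qed.

(** There are countably many states, hence events on the coordinates generate
    everything. *)
Lemma salg_state (T : Type) (C : set (set T)) (x : T -> 'I_I -> nat)
    (z : T -> 'I_I -> 'I_J -> nat) (B : set state) :
  sigma_algebra setT C ->
  (forall i k, C [set p | x p i = k]) -> (forall i j k, C [set p | z p i j = k]) ->
  C [set p | B (x p, z p)].
Proof.
move=> CP Cx Cz.
pose B' : set ({ffun 'I_I -> nat} * {ffun 'I_I * 'I_J -> nat}) :=
  fun s => B (fun i => s.1 i, fun i j => s.2 (i, j)).
rewrite (_ : [set p | _] =
    [set p | B' ([ffun i => x p i], [ffun ij => z p ij.1 ij.2])]); last first.
  apply: eq_set => p; rewrite /B' /=; congr (B (_, _)).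
    by apply/funext => i; rewrite ffunE.
  by apply/funext => i; apply/funext => j; rewrite ffunE.
apply: (salg_pair CP) => [f|f].
  apply: (salg_ffun (F := x) CP _ [set f]) => i k; exact: Cx.
by apply: (salg_ffun (F := fun p ij => z p ij.1 ij.2) CP _ [set f]) => ij k; exact: Cz.
Qed.

Let D := [set p : R * Omega | 0 <= p.1].

Let mD : measurable D.
Proof.
rewrite -[D]setTI (_ : D = fst @^-1` `[0, +oo[%classic); first exact: measurable_fst.
by apply/seteqP; split => p /=; rewrite /D/= in_itv/= andbT.
Qed.

Lemma measurable_state (B : set state) :
  measurable [set p : R * Omega | 0 <= p.1 /\ B (X p.1 p.2, Z p.1 p.2)].
Proof.
rewrite (_ : [set p | _] = D `&` [set p | B (X p.1 p.2, Z p.1 p.2)])//.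
pose C := [set A : set (R * Omega) | measurable (D `&` A)].
have CP : sigma_algebra setT C.
  split; first by rewrite /C /= setI0.
    move=> A mA; rewrite /C /= setTD (_ : D `&` ~` A = D `\` (D `&` A)).
      exact: measurableD.
    by rewrite setDIr setDv set0U setDE.
  by move=> A mA; rewrite /C /= setI_bigcupr; exact: bigcupT_measurable.
apply: (@salg_state _ C (fun p => X p.1 p.2) (fun p => Z p.1 p.2)) => //.
  by move=> i k; exact: (sys_X_meas hs i mD (Y := [set k])).
by move=> i j k; exact: (sys_Z_meas hs i j mD (Y := [set k])).
Qed.

Lemma measurable_state_at t (B : set state) : 0 <= t ->
  measurable [set w | B (X t w, Z t w)].
Proof.
move=> t0; have := measurable_state B.
move/(measurable_xsection t); congr measurable; apply/seteqP; split => w.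
  by rewrite /xsection /= inE /= => -[].
by rewrite /xsection /= inE /=.
Qed.

(** Extended by 0 to negative times, where the state is arbitrary. *)
Definition on_path (phi : state -> R) (p : R * Omega) : R :=
  if 0 <= p.1 then phi (X p.1 p.2, Z p.1 p.2) else 0.

Lemma measurable_on_path phi : measurable_fun setT (on_path phi).
Proof.
move=> _ Y mY; rewrite setTI.
rewrite (_ : _ @^-1` _ = [set p : R * Omega | 0 <= p.1 /\ Y (phi (X p.1 p.2, Z p.1 p.2))]
   `|` (~` D `&` [set p | Y 0])).
  apply: measurableU; first exact: (measurable_state (fun s => Y (phi s))).
  apply: measurableI; first exact: measurableC.
  case: (pselect (Y 0)) => Y0; last by rewrite (_ : [set p | _] = set0)//; apply/seteqP; split.
  by rewrite (_ : [set p | _] = setT)//; apply/seteqP; split.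
apply/seteqP; split => p; rewrite /on_path /D /=.
  by case: ifPn => [p0 Yp|/negP p0 Y0]; [left|right].
by case: ifPn => [p0 [[]//|[]//]|/negP p0 [[]//|[]//]].
Qed.

Lemma tint_on_path phi (a c : R) w : 0 <= a ->
  tint (on_path phi) a c w = \int[leb]_(s in `[a, c]) phi (X s w, Z s w).
Proof.
move=> a0; apply: eq_Rintegral => s; rewrite inE /= in_itv/= => /andP[h _].
by rewrite /on_path /= (le_trans a0 h).
Qed.

Lemma measurable_clock k t : measurable_fun setT (clock net n X Z k t).
Proof.
have mt phi : measurable_fun setT (fun w => \int[leb]_(s in `[0, t]) phi (X s w, Z s w)).
  under eq_fun do rewrite -tint_on_path//.
  by apply: measurable_tint; exact: measurable_on_path.
case: k => [[i|[i j]]|i] /=.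
- exact: measurable_cst.
- by apply: measurable_funM => //; exact: (mt (fun s => (s.2 i j)%:R)).
- by apply: measurable_funM => //; exact: (mt (fun s => (queue s.1 s.2 i)%:~R)).
Qed.

Lemma measurable_source k (tau : Omega -> R) : active net k ->
  measurable_fun setT tau -> measurable_fun setT (fun w => N k (tau w) w).
Proof.
move=> ak mtau; have pk := sys_poisson hs ak.
apply: (@measurable_counting _ _ _ _ _ (N k) tau id) => //.
- exact: poisson_meas pk.
- exact: poisson_mono pk.
- exact: poisson_rcont pk.
Qed.

Lemma past_measurable t A : past t A -> measurable A.
Proof.
apply: smallest_sub; first exact: sigma_algebra_measurable.
move=> E [[[i _ [B ->]]|[[k r] [/= ak _] [B ->]]]|[]//].
  exact: (measurable_state_at (fun s => B (s.1 i)) (lexx 0)).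
have mT := measurable_source ak (measurable_clock k r).
by have := mT measurableT B Logic.I; rewrite setTI.
Qed.

Lemma past_mono s t A : s <= t -> past s A -> past t A.
Proof.
move=> st; apply: sub_sigma_algebra2 => E [[|[[k r] [/= ak /andP[r0 rs]] h]]|].
- by left; left.
- left; right; exists (k, r) => //=; split => //; rewrite r0 /=; exact: le_trans st.
- by right.
Qed.

Lemma past_null t A : measurable A -> P A = 0%E -> past t A.
Proof. by move=> mA A0; apply: sub_sigma_algebra; right. Qed.

(** The past contains the null sets. *)
Lemma past_ae t A A' : past t A -> measurable A' ->
  {ae P, forall w, A w <-> A' w} -> past t A'.
Proof.
move=> pA mA' [Nl [mNl Nl0 sub]].
have out w : ~ Nl w -> (A w <-> A' w) by move=> /contra_notP; apply; exact: sub.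
have -> : A' = (A `&` ~` Nl) `|` (A' `&` Nl).
  apply/seteqP; split => w /=.
    by move=> A'w; have [|Nw] := pselect (Nl w); [right|left; split => //; exact/out].
  by move=> [[Aw /out]|[]//]; tauto.
apply: (salg_setU (pastP t)).
  apply: (salg_setI (pastP t)) => //; apply: (salg_setC (pastP t)).
  by apply: past_null => //; exact: Nl0.
apply: past_null; first exact: measurableI.
exact: (subset_measure0 (measurableI _ _ mA' mNl) mNl (@subIsetr _ A' Nl) Nl0).
Qed.

Lemma past_counts r t (B : set {ffun source I J -> nat}) : 0 <= r <= t ->
  past t [set w | B [ffun k => if active net k then time_changed net n N X Z k r w else 0%N]].
Proof.
move=> rt; apply: (salg_ffun (F := fun w k => if active net k then
  time_changed net n N X Z k r w else 0%N) (pastP t)) => k l.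
have [ak|ak] := boolP (active net k); last first.
  have [<-|l0] := eqVneq 0%N l.
    by rewrite (_ : [set w | _] = setT); [exact: (salg_setT (pastP t))|exact/seteqP].
  rewrite (_ : [set w | _] = set0); first by case: (pastP t).
  by apply/seteqP; split => // w /= /eqP; rewrite (negbTE l0).
by apply: sub_sigma_algebra; left; right; exists (k, r) => //; exists [set l].
Qed.

(** The balance equation recovers [X] from the counts; [Z] is adapted. *)
Lemma past_state r t (B : set state) : 0 <= r <= t -> past t [set w | B (X r w, Z r w)].
Proof.
move=> rt; have /andP[r0 _] := rt.
apply: (@salg_state _ (past t) (X r) (Z r)) => //; last first.
  move=> i j k; have /andP[_ le_rt] := rt; apply: (past_mono le_rt).
  exact: (adm_adapted ha).
move=> i m.
pose E : set {ffun source I J -> nat} := [set c | (x0 i)%:Z + (c (inl (inl i)))%:Z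
  - \sum_(j < J | edge net i j) (c (inl (inr (i, j))))%:Z - (c (inr i))%:Z = m%:Z].
apply: past_ae (past_counts E rt) _ _.
  exact: (measurable_state_at (fun s => s.1 i = m) r0).
have [Nl [mNl Nl0 sub]] := sys_balance hs.
exists Nl; split => // w /= h; apply: sub => /= bal; apply: h.
rewrite /E /= !ffunE /=.
under eq_bigr => j ej do rewrite ffunE /= ej.
rewrite -(bal r i r0); split => [[->//]|->//].
Qed.

(** * Occupation times *)

(** Source [k] fires at rate [rate k * occN k s] in state [s].  In an infeasible
    state every source is switched off, arrivals included: the bound on the
    generator then reads [0 <= 0] there. *)
Definition occN (k : source I J) (s : state) : nat :=
  if feasible net n s.1 s.2 then
    match k with
    | inl (inl _) => 1
    | inl (inr (i, j)) => s.2 i j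
    | inr i => (s.1 i - \sum_(j < J) s.2 i j)%N
    end
  else 0.

Definition occ k : R * Omega -> R := on_path (fun s => (occN k s)%:R).

Definition busy k t w : R := tint (occ k) 0 t w.

(** The counting process run with the clock of the masked occupation; it agrees
    with [time_changed] almost surely. *)
Definition cnt k t w : nat := N k (rate k * busy k t w) w.

Lemma occ_ge0 k p : 0 <= occ k p.
Proof. by rewrite /occ /on_path; case: ifP. Qed.

Lemma measurable_occ k : measurable_fun setT (occ k).
Proof. exact: measurable_on_path. Qed.

Lemma measurable_busy k t : measurable_fun setT (busy k t).
Proof. by apply: measurable_tint; exact: measurable_occ. Qed.

Lemma measurable_cnt k t : active net k -> measurable_fun setT (cnt k t).
Proof.
by move=> ak; apply: measurable_source => //; apply: measurable_funM => //; exact: measurable_busy.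
Qed.

Lemma rate_ge0 k : active net k -> 0 <= rate k.
Proof.
case: k => [[i _|[i j] /= e]|i _] /=.
- exact/ltW/(lambda_n_gt0 netP).
- exact/ltW/(mu_n_gt0 netP).
- exact: (gamma_n_ge0 netP).
Qed.

Lemma feasible_at t : 0 <= t -> {ae P, forall w, feasible net n (X t w) (Z t w)}.
Proof.
move=> t0; apply: filterS (adm_action ha t0) => w; exact: action_feasible.
Qed.

Let infeasible := on_path (fun s => (~~ feasible net n s.1 s.2)%:R).

(** Fubini: feasibility holds almost surely at each fixed time. *)
Lemma feasible_ae : {ae P, forall w, {ae leb, forall s, 0 <= s -> feasible net n (X s w) (Z s w)}}.
Proof.
have mb : measurable_fun setT (fun p => (infeasible p)%:E).
  by apply/measurable_EFinP; exact: measurable_on_path.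
have b0 p : (0 <= (infeasible p)%:E)%E.
  by rewrite lee_fin /infeasible /on_path; case: ifP.
have E : (\int[P]_w \int[leb]_s (infeasible (s, w))%:E = 0)%E.
  rewrite -(@fubini_tonelli _ _ _ _ _ leb P _ mb b0).
  apply: integral0_eq => s _.
  have [s0|s0] := leP 0 s; last first.
    by apply: integral0_eq => w _; rewrite /infeasible /on_path /= leNgt s0.
  rewrite (@ge0_ae_eq_integral _ _ _ P setT _ (cst 0%E))//; first by rewrite integral0.
  - exact/measurable_EFinP/(measurableT_comp (measurable_on_path _) (pair1_measurable _)).
  - apply: filterS (feasible_at s0) => w fw _.
    by rewrite /infeasible /on_path /= s0 fw.
have mI := @measurable_fun_fubini_tonelli_G _ _ _ _ _ leb _ mb b0.
have := (ae_eq_integral_abs P measurableT mI).1.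
rewrite (_ : (\int[P]_x _)%E = 0%E); last first.
  by rewrite -[RHS]E; apply: eq_integral => w _; apply: gee0_abs; exact: integral_ge0.
move=> /(_ erefl); apply: filterS => w /(_ Logic.I) Iw.
have mw : measurable_fun setT (fun s => (infeasible (s, w))%:E).
  by apply/measurable_EFinP; apply: measurable_path; exact: measurable_on_path.
have := (ae_eq_integral_abs leb measurableT mw).1.
rewrite (_ : (\int[leb]_x _)%E = 0%E); last first.
  by rewrite -[RHS]Iw; apply: eq_integral => s _; exact: gee0_abs.
move=> /(_ erefl); apply: filterS => s /(_ Logic.I) /= + s0.
rewrite /infeasible /on_path /= s0 => -[] /eqP.
by rewrite pnatr_eq0 eqb0 negbK.
Qed.

Lemma queue_feasible x z i : feasible net n x z ->
  queue x z i = (x i - \sum_(j < J) z i j)%N%:Z.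
Proof.
move=> /and3P[_ /forallP/(_ i) h _].
by rewrite /queue -(big_morph Posz PoszD (erefl _)) -subzn.
Qed.

Lemma clock_busy : {ae P, forall w, forall k t, active net k -> 0 <= t ->
  clock net n X Z k t w = rate k * busy k t w}.
Proof.
apply: filterS feasible_ae => w fw.
have E (phi psi : state -> R) t : 0 <= t ->
    (forall x z, feasible net n x z -> phi (x, z) = psi (x, z)) ->
    \int[leb]_(s in `[0, t]) phi (X s w, Z s w) = \int[leb]_(s in `[0, t]) psi (X s w, Z s w).
  move=> t0 h; rewrite -!tint_on_path//; congr fine.
  apply: ae_eq_integral => //.
  - apply: measurable_funTS; apply/measurable_EFinP.
    by apply: measurable_path; exact: measurable_on_path.
  - apply: measurable_funTS; apply/measurable_EFinP.
    by apply: measurable_path; exact: measurable_on_path.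
  - have [A [mA A0 sub]] := fw; exists A; split => // s /= hs'; apply: sub => /= fs.
    apply: hs'; rewrite in_itv /= => /andP[s0 _].
    by rewrite /on_path /= s0 h// fs.
move=> [[i|[i j]]|i] t ak t0 /=.
- congr (_ * _); rewrite /busy /occ tint_on_path//=.
  rewrite -(E (fun=> 1) (fun s => (occN (inl (inl i)) s)%:R)) // => [|x z f /=].
    by rewrite Rintegral_cst//= lebesgue_itvcc//= mul1r subr0.
  by rewrite /occN /= f.
- congr (_ * _); rewrite /busy /occ tint_on_path//=.
  apply: (E (fun s => (s.2 i j)%:R) (fun s => (occN (inl (inr (i, j))) s)%:R)) => // x z f /=.
  by rewrite /occN /= f.
- congr (_ * _); rewrite /busy /occ tint_on_path//=.
  apply: (E (fun s => (queue s.1 s.2 i)%:~R) (fun s => (occN (inr i) s)%:R)) => // x z f /=.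
  by rewrite /occN /= f queue_feasible.
Qed.

(** The almost sure properties that allow the dynamics to be followed path by
    path. *)
Definition regular (w : Omega) : Prop :=
  (forall t i, 0 <= t ->
    (X t w i + (\sum_(j < J | edge net i j) cnt (inl (inr (i, j))) t w + cnt (inr i) t w)
     = x0 i + cnt (inl (inl i)) t w)%N) /\
  (forall k t, active net k -> 0 <= t -> clock net n X Z k t w = rate k * busy k t w).

Lemma regular_ae : {ae P, forall w, regular w}.
Proof.
apply: filterS2 (sys_balance hs) clock_busy => w bal cb; split => // t i t0.
have tc k : active net k -> time_changed net n N X Z k t w = cnt k t w.
  by move=> ak; rewrite /time_changed cb.
have := bal t i t0; rewrite !tc//.
under eq_bigr => j ej do rewrite tc//.
rewrite -(big_morph Posz PoszD (erefl _)) => h.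
apply/eqP; rewrite -eqz_nat !PoszD h; apply/eqP; ring.
Qed.

Lemma busy_arrival i t w : regular w -> 0 <= t -> busy (inl (inl i)) t w = t.
Proof.
move=> [_ /(_ (inl (inl i)) t isT)] h /h /= => {}h.
by apply: (mulfI (lt0r_neq0 (lambda_n_gt0 netP i n0))); rewrite -h.
Qed.

(** * Increments of the driving processes *)

(** Defined for every amount [v] of service, which may depend on [w]; for a
    constant [v] it is the increment that generates the future at [t]. *)
Definition incr k t v w : nat :=
  (N k (rate k * busy k t w + rate k * v) w - N k (rate k * busy k t w) w)%N.

Lemma measurable_incr k t (tau : Omega -> R) : active net k ->
  measurable_fun setT tau -> measurable_fun setT (fun w => incr k t (tau w) w).
Proof.
move=> ak mtau.
have m1 : measurable_fun setT (fun w => N k (rate k * busy k t w + rate k * tau w) w).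
  apply: measurable_source => //; apply: measurable_funD.
    by apply: measurable_funM => //; exact: measurable_busy.
  exact: measurable_funM.
have m2 := measurable_cnt t ak.
apply/measurable_fun_natP => m.
by apply: (salg_pair (@sigma_algebra_measurable _ Omega) _ _ [set p | (p.1 - p.2)%N = m]) => k';
  apply: (measurable_fun_natP _).2.
Qed.

Lemma measurable_future_incr k t v : active net k ->
  measurable_fun setT (future_incr net n N X Z k t v).
Proof.
move=> ak.
have m1 : measurable_fun setT (fun w => N k (clock net n X Z k t w + rate k * v) w).
  apply: measurable_source => //; apply: measurable_funD => //; exact: measurable_clock.
have m2 : measurable_fun setT (time_changed net n N X Z k t).
  by apply: measurable_source => //; exact: measurable_clock.
apply/measurable_fun_natP => m.
by apply: (salg_pair (@sigma_algebra_measurable _ Omega) _ _ [set p | (p.1 - p.2)%N = m]) => k';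
  apply: (measurable_fun_natP _).2.
Qed.

Lemma incrE k t v : active net k -> 0 <= t ->
  {ae P, forall w, incr k t v w = future_incr net n N X Z k t v w}.
Proof.
move=> ak t0; apply: filterS regular_ae => w [_ /(_ k t ak t0) c].
by rewrite /incr /future_incr /time_changed c.
Qed.

Lemma future_incr_law k t v m : active net k -> 0 <= t -> 0 <= v -> 0 < rate k * v ->
  P [set w | future_incr net n N X Z k t v w = m] = (poisson_pmf (rate k * v) m)%:E.
Proof.
move=> ak t0 v0 rv0.
have from0 k' : active net k' -> 0 < rate k' * v ->
    P [set w | N k' (rate k' * v) w = m] = (poisson_pmf (rate k' * v) m)%:E.
  move=> ak' rv; have pk := sys_poisson hs ak'.
  rewrite -[in RHS](subr0 (rate k' * v)) -(poisson_incr pk m (lexx 0) rv).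
  by congr (P _); apply: eq_set => w; rewrite (poisson_zero pk w (lexx 0)) subn0.
have same (U V : R -> Omega -> nat) : same_law P U V ->
    P [set w | U v w = m] = P [set w | V v w = m].
  move=> /(_ 1%N (fun=> v) (fun=> m) (fun=> v0)).
  have E (W : R -> Omega -> nat) :
      [set w | forall l : 'I_1, W v w = m] = [set w | W v w = m].
    by apply/seteqP; split => w /= h //; exact: (h ord0).
  by rewrite !E.
case: k ak rv0 => [[i|[i j]]|i] ak rv0.
- have pk := sys_poisson hs ak.
  have l0 : 0 <= lambda_n net n i * t by rewrite mulr_ge0// ltW// (lambda_n_gt0 netP).
  rewrite -[in RHS](addKr (lambda_n net n i * t) (rate _ * v)) addrC.
  by rewrite -(poisson_incr pk m l0)// ltrDl.
- by rewrite (same _ _ (adm_law_service ha t0 ak)) (from0 (inl (inr (i, j)))).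
- by rewrite (same _ _ (adm_law_abandon ha i t0)) (from0 (inr i)).
Qed.

Lemma incr0 k t v w : rate k * v = 0 -> incr k t v w = 0%N.
Proof. by move=> h; rewrite /incr h addr0 subnn. Qed.

Lemma incr_integral (g : nat -> R) F k t v : (forall m, 0 <= g m) -> past t F ->
  active net k -> 0 <= t -> 0 <= v -> 0 < rate k * v ->
  (\int[P]_(w in F) (g (incr k t v w))%:E =
   P F * \sum_(m <oo) (g m * poisson_pmf (rate k * v) m)%:E)%E.
Proof.
move=> g0 pF ak t0 v0 rv0; have mF := past_measurable pF.
have mi : measurable_fun setT (incr k t v) by exact: (@measurable_incr k t (cst v)).
have mfi := measurable_future_incr t v ak.
rewrite (@ge0_ae_eq_integral _ _ _ P F _ (fun w => (g (future_incr net n N X Z k t v w))%:E))//;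
  last 5 first.
- by apply: measurable_funTS; apply/measurable_EFinP; exact: measurable_of_nat.
- by apply: measurable_funTS; apply/measurable_EFinP; exact: measurable_of_nat.
- by move=> w _; rewrite lee_fin.
- by move=> w _; rewrite lee_fin.
- by apply: filterS (incrE v ak t0) => w -> _.
rewrite integral_nat_fun//.
have PF : (0 <= P F)%E by [].
have -> : P F = (fine (P F))%:E by rewrite fineK// fin_num_measure.
rewrite -nneseriesZl; last by move=> m _; rewrite lee_fin mulr_ge0 ?poisson_pmf_ge0.
apply: eq_eseriesr => m _.
rewrite fineK ?fin_num_measure// EFinM muleCA; congr (_ * _)%E.
rewrite -(future_incr_law m ak t0 v0 rv0); apply: (adm_indep ha t0) => //.
by apply: sub_sigma_algebra; exists (k, v) => //=; exists [set m].
Qed.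

Lemma incr_mean F k t v : past t F -> active net k -> 0 <= t -> 0 <= v ->
  (\int[P]_(w in F) (incr k t v w)%:R%:E = P F * (rate k * v)%:E)%E.
Proof.
move=> pF ak t0 v0; have := mulr_ge0 (rate_ge0 ak) v0.
rewrite le_eqVlt => /predU1P[rv0|rv0].
  rewrite -rv0 mule0; apply: integral0_eq => w _; rewrite incr0//.
by rewrite (@incr_integral (fun m => m%:R))// poisson_pmf_mean.
Qed.

Lemma incr_moment2 k t v : active net k -> 0 <= t -> 0 <= v ->
  (\int[P]_w (incr k t v w * (incr k t v w).-1)%:R%:E = ((rate k * v) ^+ 2)%:E)%E.
Proof.
move=> ak t0 v0; have := mulr_ge0 (rate_ge0 ak) v0.
rewrite le_eqVlt => /predU1P[rv0|rv0].
  rewrite -rv0 expr0n; apply: integral0_eq => w _; rewrite incr0//.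
rewrite (@incr_integral (fun m => (m * m.-1)%:R))//; last exact: salg_setT (pastP t).
by rewrite poisson_pmf_moment2// probability_setT mul1e.
Qed.

Lemma incr_monotone k t v v' w : active net k -> v <= v' -> (incr k t v w <= incr k t v' w)%N.
Proof.
move=> ak vv'; apply: leq_sub2r; apply: (poisson_mono (sys_poisson hs ak)).
by rewrite lerD2l ler_wpM2l// rate_ge0.
Qed.

(** On each event [G w = j] of the past the amount of service is constant. *)
Lemma incr_adapted F k t (G : Omega -> nat) (u : nat -> R) : past t F ->
  active net k -> 0 <= t -> (forall j, past t [set w | G w = j]) -> (forall j, 0 <= u j) ->
  (\int[P]_(w in F) (incr k t (u (G w)) w)%:R%:E = \int[P]_(w in F) (rate k * u (G w))%:E)%E.
Proof.
move=> pF ak t0 pG u0; have mF := past_measurable pF.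
have mG : measurable_fun setT G by apply/measurable_fun_natP => j; exact: past_measurable.
have muG : measurable_fun setT (fun w => u (G w)) by exact: measurable_of_nat.
have pFG j : past t (F `&` [set w | G w = j]) by exact: (salg_setI (pastP t) pF (pG j)).
have mFG j := past_measurable (pFG j).
have {1 2}-> : F = \bigcup_j (F `&` [set w | G w = j]).
  apply/seteqP; split => w /=; last by move=> [m _ []].
  by move=> Fw; exists (G w).
have tr : trivIset setT (fun j => F `&` [set w | G w = j]).
  by move=> i j _ _ [w [[_ /= <-] [_ /= <-]]].
rewrite ge0_integral_bigcup//; last first.
  apply: measurable_funTS; apply/measurable_EFinP.
  exact: (measurable_of_nat _ (measurable_incr t ak muG)).
rewrite ge0_integral_bigcup//; last 2 first.
- by apply: measurable_funTS; apply/measurable_EFinP; exact: measurable_funM.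
- by move=> w _; rewrite lee_fin mulr_ge0// rate_ge0.
apply: eq_eseriesr => j _.
transitivity (\int[P]_(w in F `&` [set w | G w = j]) (incr k t (u j) w)%:R%:E)%E.
  by apply: eq_integral => w; rewrite inE => -[_ /= ->].
rewrite incr_mean// muleC -integral_cst; last exact: past_measurable.
by apply: eq_integral => w; rewrite inE => -[_ /= ->].
Qed.

(** The form in which the control is known at time [t]: a limit in probability of
    countably valued variables of the past. *)
Definition past_approx t (tau : Omega -> R) (K : R) : Prop := forall eta : R, 0 < eta ->
  exists (G : Omega -> nat) (u : nat -> R),
  [/\ forall j, past t [set w | G w = j], forall j, 0 <= u j <= K
   & (P [set w | (eta < `|tau w - u (G w)|)%R] <= eta%:E)%E].

(** Off the exceptional set, of probability at most [theta ^+ 2], the increment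
    lies between the increments over the amounts [u (G w) - theta ^+ 2] and
    [u (G w) + theta ^+ 2], which are known at time [t]. *)
Lemma incr_stopped_approx F k t (tau : Omega -> R) (K theta : R) (G : Omega -> nat) (u : nat -> R) :
  past t F -> active net k -> 0 <= t -> measurable_fun setT tau ->
  (forall w, 0 <= tau w <= K) -> 0 < theta <= 1 ->
  (forall j, past t [set w | G w = j]) -> (forall j, 0 <= u j <= K) ->
  (P [set w | (theta ^+ 2 < `|tau w - u (G w)|)%R] <= (theta ^+ 2)%:E)%E ->
  let C := (rate k * K) ^+ 2 + rate k * K + 1 + rate k * (2 + K) in
  (\int[P]_(w in F) (incr k t (tau w) w)%:R%:E
     <= \int[P]_(w in F) (rate k * tau w)%:E + (theta * C)%:E)%E /\
  (\int[P]_(w in F) (rate k * tau w)%:E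
     <= \int[P]_(w in F) (incr k t (tau w) w)%:R%:E + (theta * C)%:E)%E.
Proof.
move=> pF ak t0 mtau tauK /andP[th0 th1] pG uK; set B := [set w | _] => PB C.
have mF := past_measurable pF; have rk := rate_ge0 ak.
have K0 : 0 <= K by have /andP[h1 h2] := uK 0%N; exact: le_trans h2.
have mG : measurable_fun setT G by apply/measurable_fun_natP => j; exact: past_measurable.
have mu u' : measurable_fun setT (fun w => u' (G w) : R) by exact: measurable_of_nat.
have mB : measurable B.
  rewrite -[B]setTI; have md : measurable_fun setT (fun w => `|tau w - u (G w)|).
    by apply: measurableT_comp => //; apply: measurable_funB.
  have := md measurableT `]theta ^+ 2, +oo[%classic (measurable_itv _).
  by congr measurable; apply/seteqP; split => w /=; rewrite /B /= in_itv /= andbT.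
pose nK w := (incr k t K w)%:R : R.
have mnatK : measurable_fun setT (incr k t K).
  exact: (@measurable_incr k t (cst K) ak (measurable_cst K)).
have mnK : measurable_fun setT nK.
  exact: (measurable_of_nat (fun m => m%:R : R) mnatK).
have mi u' : measurable_fun setT u' -> measurable_fun setT (fun w => (incr k t (u' w) w)%:R : R).
  by move=> mu'; exact: (measurable_of_nat (fun m => m%:R : R) (measurable_incr t ak mu')).
have m1B : measurable_fun setT (\1_B : Omega -> R) by exact: measurable_indic.
(* [2 * a <= theta * a ^+ 2 + theta^-1] trades the increment on the exceptional
   set for its second moment and the probability of that set *)
pose e1 w := theta * nK w ^+ 2 + theta^-1 * \1_B w.
pose e2 w := rate k * 2 * theta ^+ 2 + rate k * K * \1_B w.
have me1 : measurable_fun setT e1.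
  by apply: measurable_funD; apply: measurable_funM => //; exact: measurable_funX.
have me2 : measurable_fun setT e2.
  by apply: measurable_funD => //; apply: measurable_funM.
have iB w : 0 <= \1_B w :> R by rewrite indicE.
have th0' : 0 <= theta by exact: ltW.
have ti0 : 0 <= theta^-1 by rewrite invr_ge0.
have e10 w : 0 <= e1 w := addr_ge0 (mulr_ge0 th0' (sqr_ge0 _)) (mulr_ge0 ti0 (iB w)).
have rK : 0 <= rate k * K by rewrite mulr_ge0.
have r2 : 0 <= rate k * 2 * theta ^+ 2 by rewrite !mulr_ge0.
have e20 w : 0 <= e2 w := addr_ge0 r2 (mulr_ge0 rK (iB w)).
have big w : B w -> nK w <= e1 w.
  move=> Bw; rewrite /e1 indicE mem_set// mulr1.
  have : 0 <= theta^-1 * (theta * nK w - 1) ^+ 2 by rewrite mulr_ge0 ?sqr_ge0.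
  have -> : theta^-1 * (theta * nK w - 1) ^+ 2 = theta * nK w ^+ 2 - 2 * nK w + theta^-1.
    by field; rewrite gt_eqF.
  have : 0 <= nK w by rewrite /nK.
  lra.
have E1 : (\int[P]_(w in F) (e1 w)%:E <= (theta * ((rate k * K) ^+ 2 + rate k * K + 1))%:E)%E.
  apply: (@le_trans _ _ (\int[P]_w (e1 w)%:E)%E).
    apply: ge0_subset_integral => //; first exact/measurable_EFinP.
    by move=> w _; rewrite lee_fin.
  under eq_integral do rewrite EFinD.
  rewrite ge0_integralD//; last 4 first.
  - by move=> w _; rewrite lee_fin mulr_ge0 ?sqr_ge0.
  - by apply/measurable_EFinP; apply: measurable_funM => //; exact: measurable_funX.
  - by move=> w _; rewrite lee_fin mulr_ge0.
  - by apply/measurable_EFinP; apply: measurable_funM.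
  rewrite mulrDr mulr1 EFinD; apply: leeD.
    under eq_integral do rewrite EFinM.
    rewrite ge0_integralZl//; last 2 first.
    - exact/measurable_EFinP/measurable_funX.
    - by move=> w _; rewrite lee_fin sqr_ge0.
    rewrite EFinM lee_pmul2l ?lte_fin//.
    rewrite (eq_integral (fun w => (incr k t K w * (incr k t K w).-1)%:R%:E
       + (incr k t K w)%:R%:E)%E); last first.
      move=> w _; rewrite -EFinD -natrD /nK -natrX; congr (_%:R%:E).
      by case: (incr k t K w) => //= m; rewrite expnS expn1 mulnS addnC.
    rewrite ge0_integralD//; last 2 first.
    - apply/measurable_EFinP.
      exact: (measurable_of_nat (fun m => (m * m.-1)%:R : R) mnatK).
    - exact/measurable_EFinP.
    rewrite incr_moment2// EFinD leeD2l// incr_mean//; last exact: salg_setT (pastP t).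
    by rewrite probability_setT mul1e.
  under eq_integral do rewrite EFinM.
  rewrite ge0_integralZl//; last exact/measurable_EFinP.
  rewrite integral_indic// setIT.
  apply: (@le_trans _ _ (theta^-1%:E * (theta ^+ 2)%:E)%E).
    by rewrite lee_pmul2l// lte_fin invr_gt0.
  by rewrite -EFinM lee_fin expr2 mulKf// gt_eqF.
have E2 : (\int[P]_(w in F) (e2 w)%:E <= (theta * (rate k * (2 + K)))%:E)%E.
  apply: (@le_trans _ _ (\int[P]_w (e2 w)%:E)%E).
    apply: ge0_subset_integral => //; first exact/measurable_EFinP.
    by move=> w _; rewrite lee_fin.
  under eq_integral do rewrite EFinD.
  rewrite ge0_integralD//; last 2 first.
  - by move=> w _; rewrite lee_fin mulr_ge0.
  - by apply/measurable_EFinP; apply: measurable_funM.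
  under [X in (_ + X)%E]eq_integral do rewrite EFinM.
  rewrite ge0_integralZl//; last exact/measurable_EFinP.
  rewrite integral_indic// setIT integral_cst//= probability_setT mule1.
  apply: (@le_trans _ _ ((rate k * 2 * theta ^+ 2)%:E + (rate k * K)%:E * (theta ^+ 2)%:E)%E).
    by apply: leeD2l; apply: lee_wpmul2l => //; rewrite lee_fin.
  rewrite -EFinM -EFinD lee_fin.
  have t2 : theta ^+ 2 <= theta by rewrite expr2 ler_piMl// ltW.
  have : (rate k * (2 + K)) * theta ^+ 2 <= (rate k * (2 + K)) * theta.
    by rewrite ler_wpM2l// mulr_ge0// addr_ge0.
  lra.
have off w : ~ B w -> `|tau w - u (G w)| <= theta ^+ 2.
  by move=> /negP; rewrite -leNgt.
have inB w : B w -> \1_B w = 1 :> R by move=> Bw; rewrite indicE mem_set.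
have ninB w : ~ B w -> \1_B w = 0 :> R by move=> Bw; rewrite indicE memNset.
have rep (f g : Omega -> R) : measurable_fun setT f -> measurable_fun setT g ->
    (forall w, 0 <= f w) -> (forall w, 0 <= g w) ->
    (\int[P]_(w in F) (f w + g w)%:E = \int[P]_(w in F) (f w)%:E + \int[P]_(w in F) (g w)%:E)%E.
  move=> mf mg f0 g0; under eq_integral do rewrite EFinD.
  rewrite ge0_integralD//.
  - by move=> w _; rewrite lee_fin.
  - exact/measurable_funTS/measurable_EFinP.
  - by move=> w _; rewrite lee_fin.
  - exact/measurable_funTS/measurable_EFinP.
have mono (f g : Omega -> R) : measurable_fun setT f -> measurable_fun setT g ->
    (forall w, 0 <= f w) -> (forall w, f w <= g w) ->
    (\int[P]_(w in F) (f w)%:E <= \int[P]_(w in F) (g w)%:E)%E.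
  move=> mf mg f0 fg; apply: ge0_le_integral => //.
  - by move=> w _; rewrite lee_fin.
  - exact/measurable_funTS/measurable_EFinP.
  - exact/measurable_funTS/measurable_EFinP.
  - by move=> w _; rewrite lee_fin.
have CE : (theta * C = theta * ((rate k * K) ^+ 2 + rate k * K + 1) + theta * (rate k * (2 + K))).
  by rewrite /C; ring.
have sq0 := sqr_ge0 theta.
have mtk : measurable_fun setT (fun w => rate k * tau w) by exact: measurable_funM.
have rearr (a b c : \bar R) : (a + (b + c) = a + c + b)%E by rewrite addeA addeAC.
rewrite CE EFinD; split.
- pose u1 j := u j + theta ^+ 2.
  have u10 j : 0 <= u1 j by have /andP[? _] := uK j; rewrite addr_ge0.
  apply: (@le_trans _ _ (\int[P]_(w in F) ((incr k t (u1 (G w)) w)%:R + e1 w)%:E)%E).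
    apply: mono => //; first exact: mi.
    - by apply: measurable_funD => //; apply: mi; exact: mu.
    - move=> w; have [Bw|Bw] := pselect (B w).
        apply: (@le_trans _ _ (nK w)); last by rewrite -[leLHS]add0r lerD// big.
        by rewrite ler_nat incr_monotone//; have /andP[] := tauK w.
      rewrite -[leLHS]addr0 lerD// ler_nat incr_monotone// /u1.
      by have := off _ Bw; rewrite ler_norml => /andP[_]; lra.
  rewrite rep//; last by apply: mi; exact: mu.
  rewrite incr_adapted// [leRHS]rearr; apply: leeD => //.
  apply: (@le_trans _ _ (\int[P]_(w in F) (rate k * tau w + e2 w)%:E)%E).
    apply: (mono (fun w => rate k * u1 (G w)) (fun w => rate k * tau w + e2 w)) => //.
    - by apply: measurable_funM => //; exact: mu.
    - exact: measurable_funD.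
    - by move=> w; rewrite mulr_ge0.
    - move=> w; rewrite /e2 /u1; have [Bw|Bw] := pselect (B w).
        rewrite inB// mulr1; have /andP[? ?] := uK (G w); have /andP[? _] := tauK w.
        have : rate k * u (G w) <= rate k * K by rewrite ler_wpM2l.
        have : 0 <= rate k * tau w by rewrite mulr_ge0.
        have : 0 <= rate k * theta ^+ 2 by rewrite mulr_ge0.
        lra.
      have := off _ Bw; rewrite ler_norml => /andP[h _]; rewrite ninB// mulr0 addr0.
      have : 0 <= rate k * (tau w - u (G w) + theta ^+ 2) by rewrite mulr_ge0//; lra.
      lra.
  rewrite rep//; last by move=> w; rewrite mulr_ge0//; have /andP[] := tauK w.
  exact: leeD2l.
- pose u1 j := Num.max (u j - theta ^+ 2) 0.
  have u10 j : 0 <= u1 j by rewrite le_max lexx orbT.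
  apply: (@le_trans _ _ (\int[P]_(w in F) (rate k * u1 (G w) + e2 w)%:E)%E).
    apply: (mono (fun w => rate k * tau w) (fun w => rate k * u1 (G w) + e2 w)) => //.
    - by apply: measurable_funD => //; apply: measurable_funM => //; exact: mu.
    - by move=> w; rewrite mulr_ge0//; have /andP[] := tauK w.
    - move=> w; rewrite /e2; have [Bw|Bw] := pselect (B w).
        rewrite inB// mulr1; have /andP[_ h] := tauK w.
        have : rate k * tau w <= rate k * K by rewrite ler_wpM2l.
        have : 0 <= rate k * u1 (G w) by rewrite mulr_ge0.
        have : 0 <= rate k * theta ^+ 2 by rewrite mulr_ge0.
        lra.
      have := off _ Bw; rewrite ler_norml => /andP[_ h]; rewrite ninB// mulr0 addr0.
      have h2 : u (G w) - theta ^+ 2 <= u1 (G w) by rewrite le_max lexx.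
      have : 0 <= rate k * (u1 (G w) + 2 * theta ^+ 2 - tau w) by rewrite mulr_ge0//; lra.
      lra.
  rewrite rep//; last 2 first.
  - by apply: measurable_funM => //; exact: mu.
  - by move=> w; rewrite mulr_ge0.
  rewrite -(incr_adapted pF ak t0 pG u10) [leRHS]addeA; apply: leeD => //.
  apply: (@le_trans _ _ (\int[P]_(w in F) ((incr k t (tau w) w)%:R + e1 w)%:E)%E).
    apply: mono => //; first by apply: mi; exact: mu.
    - by apply: measurable_funD => //; exact: mi.
    - move=> w; have [Bw|Bw] := pselect (B w).
        apply: (@le_trans _ _ (nK w)); last by rewrite -[leLHS]add0r lerD// big.
        rewrite ler_nat incr_monotone// /u1 ge_max K0 andbT.
        by have /andP[_ ?] := uK (G w); lra.
      rewrite -[leLHS]addr0 lerD// ler_nat incr_monotone// /u1 ge_max.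
      have := off _ Bw; rewrite ler_norml => /andP[h _].
      by have /andP[-> _] := tauK w; rewrite andbT; lra.
  rewrite rep//; last exact: mi.
  exact: leeD2l.
Qed.

End Sys.

(** * Calculus of time integrals *)

Lemma tint_add (R : realType) d (T : measurableType d) (f : R * T -> R) w (a b c K : R) :
  measurable_fun setT f -> (forall s, a <= s <= c -> `|f (s, w)| <= K) ->
  a <= b <= c -> tint f a c w = tint f a b w + tint f b c w.
Proof.
move=> mf fK /andP[ab bc]; rewrite /tint.
have iac := path_integrable mf fK.
have ibc : lebesgue_measure.-integrable `]b, c] (fun s => (f (s, w))%:E).
  apply: integrableS iac => //; apply: subset_itv; rewrite bnd_simp//.
have := @Rintegral_itvB _ (fun s => f (s, w)) (BLeft a) (BRight c) b iac.
rewrite !bnd_simp => /(_ ab bc).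
rewrite (Rintegral_itv_obnd_cbnd (b := BRight c) ibc) => <-.
by rewrite addrC subrK.
Qed.

Lemma tint_ge0 (R : realType) d (T : measurableType d) (f : R * T -> R) w (a c : R) :
  (forall s, a <= s <= c -> 0 <= f (s, w)) -> 0 <= tint f a c w.
Proof. by move=> f0; apply: Rintegral_ge0 => s /=; rewrite in_itv; exact: f0. Qed.

Lemma tint_le (R : realType) d (T : measurableType d) (f g : R * T -> R) w (a c K : R) :
  measurable_fun setT f -> measurable_fun setT g ->
  (forall s, a <= s <= c -> `|f (s, w)| <= K) -> (forall s, a <= s <= c -> `|g (s, w)| <= K) ->
  (forall s, a <= s <= c -> f (s, w) <= g (s, w)) -> tint f a c w <= tint g a c w.
Proof.
move=> mf mg fK gK fg; apply: le_Rintegral => //.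
- exact: path_integrable mf fK.
- exact: path_integrable mg gK.
Qed.

Lemma tint_cst (R : realType) d (T : measurableType d) w (a c K : R) : a <= c ->
  tint (fun _ : R * T => K) a c w = K * (c - a).
Proof. by move=> ac; rewrite /tint Rintegral_cst//= lebesgue_itvcc. Qed.

(** * Two elementary estimates *)

Lemma nat_tail (R : realType) d (T : measurableType d) (P : probability T R)
    (Y : T -> nat) (eta : R) : measurable_fun setT Y -> 0 < eta ->
  exists M, (P [set w | (M < Y w)%N] <= eta%:E)%E.
Proof.
move=> mY eta0; pose F M := [set w | (M < Y w)%N].
have mF M : measurable (F M).
  by apply: (salg_preimage (@sigma_algebra_measurable _ T) _ [set k | (M < k)%N]);
    exact: (measurable_fun_natP _).2.
have capF : \bigcap_M F M = set0.
  by apply/seteqP; split => // w /(_ (Y w) Logic.I); rewrite /F /= ltnn.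
have := @nonincreasing_cvg_mu _ _ _ P F.
rewrite capF measure0 => /(_ _ mF measurable0) h.
have {h} : P \o F @ \oo --> 0%E.
  apply: h; first by rewrite ltey_eq fin_num_measure.
  move=> m k mk; rewrite subsetEset => w; rewrite /F /=; exact: leq_ltn_trans.
move=> /fine_cvgP[_ /cvgr_lt/(_ _ eta0)[M _ MP]].
exists M; have := MP M (leqnn M); rewrite /= -lte_fin fineK ?fin_num_measure//.
exact: ltW.
Qed.

Lemma clamp_dist (R : realType) (x y K : R) : 0 <= x -> 0 <= K ->
  `|K - Num.max 0 (Num.min x K) - Num.max 0 (K - y)| <= `|x - y|.
Proof.
move=> x0 K0.
have n1 := ler_norm (x - y); have n2 := ler_norm (y - x); rewrite distrC in n2.
have [xK|Kx] := leP x K; have [y0|y0] := leP 0 (K - y);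
  rewrite ?(max_r x0) ?(max_r K0) ler_norml; apply/andP; split; lra.
Qed.

(** * The compensation identity *)

Section Martingale.
Context (R : realType) (I J : nat) (net : network R I J) (n : nat).
Context (d : measure_display) (Omega : measurableType d) (P : probability Omega R).
Context (N : source I J -> R -> Omega -> nat).
Context (X : R -> Omega -> 'I_I -> nat).
Context (Z : R -> Omega -> 'I_I -> 'I_J -> nat).
Context (x0 : 'I_I -> nat).
Hypothesis netP : network_assumptions net.
Hypothesis n0 : (0 < n)%N.
Hypothesis hs : is_system net n P N X Z x0.
Hypothesis ha : admissible net n P N X Z.
Local Notation rate := (rate net n).
Local Notation past := (past net n P N X Z).
Local Notation occ := (occ net n X Z).
Local Notation busy := (busy net n X Z).
Local Notation cnt := (cnt net n N X Z).
Local Notation incr := (incr net n N X Z).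
Local Notation regular := (regular net n N X Z x0).

Let pastP t : sigma_algebra setT (past t).
Proof. exact: smallest_sigma_algebra. Qed.

Lemma incr_stopped F k t (tau : Omega -> R) K : past t F -> active net k -> 0 <= t ->
  measurable_fun setT tau -> (forall w, 0 <= tau w <= K) ->
  past_approx net n P N X Z t tau K ->
  (\int[P]_(w in F) (incr k t (tau w) w)%:R%:E = \int[P]_(w in F) (rate k * tau w)%:E)%E.
Proof.
move=> pF ak t0 mtau tauK app.
pose C := (rate k * K) ^+ 2 + rate k * K + 1 + rate k * (2 + K).
have K0 : 0 <= K by have /andP[h1 h2] := tauK point; exact: le_trans h2.
have C0 : 0 < C.
  have := rate_ge0 netP n0 ak => rk; have : 0 <= rate k * K by rewrite mulr_ge0.
  have : 0 <= rate k * (2 + K) by rewrite mulr_ge0 ?addr_ge0.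
  by have := sqr_ge0 (rate k * K); rewrite /C; lra.
have step e : 0 < e -> exists2 theta, 0 < theta <= 1 & theta * C <= e.
  move=> e0; exists (Num.min 1 (e / C)).
    by rewrite lt_min ge_min lexx ltr01 divr_gt0.
  by rewrite -ler_pdivlMr// ge_min lexx orbT.
apply/eqP; rewrite eq_le; apply/andP; split; apply/lee_addgt0Pr => e e0;
  have [theta th thC] := step e e0;
  have [|G [u [pG uK PB]]] := app (theta ^+ 2); try by rewrite exprn_gt0; case/andP: th.
- have [h _] := incr_stopped_approx netP n0 hs ha pF ak t0 mtau tauK th pG uK PB.
  by apply: (le_trans h); apply: leeD2l; rewrite lee_fin.
- have [_ h] := incr_stopped_approx netP n0 hs ha pF ak t0 mtau tauK th pG uK PB.
  by apply: (le_trans h); apply: leeD2l; rewrite lee_fin.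
Qed.

(** A nondecreasing bound for every component of the state; truncating it
    localizes the dynamics to finitely many states. *)
Definition arrivals (t : R) (w : Omega) : nat := (\sum_(i < I) (x0 i + cnt (inl (inl i)) t w))%N.

Lemma X_le_arrivals t w i : regular w -> 0 <= t -> (X t w i <= arrivals t w)%N.
Proof.
move=> [bal _] t0; rewrite /arrivals (bigD1 i)//= (leq_trans _ (leq_addr _ _))//.
by rewrite -bal// leq_addr.
Qed.

Lemma arrivals_mono s t w : regular w -> 0 <= s -> s <= t -> (arrivals s w <= arrivals t w)%N.
Proof.
move=> rw s0 st; apply: leq_sum => i _; rewrite leq_add2l /cnt.
rewrite !(busy_arrival netP n0 i rw) ?(le_trans s0 st)//.
apply: (poisson_mono (sys_poisson hs (k := inl (inl i)) _)) => //.
by rewrite ler_wpM2l// (rate_ge0 netP n0 (k := inl (inl i))).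
Qed.

Definition max_servers : nat := (\sum_(j < J) servers_n net n j)%N.

Lemma occ_le k s (M : nat) w : (forall i, X s w i <= M)%N ->
  occ k (s, w) <= (M + max_servers).+1%:R.
Proof.
move=> XM; rewrite /occ /on_path /=; case: ifP => // _; rewrite ler_nat /occN.
case: ifP => // f; case: k => [[i|[i j]]|i] //=.
- have /and3P[_ _ /forallP/(_ j) h] := f.
  apply: leqW; apply: (leq_trans _ (leq_addl _ _)).
  apply: (@leq_trans (servers_n net n j)).
    by apply: leq_trans h; rewrite (bigD1 i)//= leq_addr.
  by rewrite /max_servers (bigD1 j)//= leq_addr.
- by apply: leqW; apply: (leq_trans (leq_subr _ _)); rewrite (leq_trans (XM i))// leq_addr.
Qed.

Lemma occ_bounded k t w : regular w -> forall s, 0 <= s <= t ->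
  `|occ k (s, w)| <= (arrivals t w + max_servers).+1%:R.
Proof.
move=> rw s /andP[s0 st]; rewrite ger0_norm ?occ_ge0// occ_le// => i.
by rewrite (leq_trans (X_le_arrivals _ rw s0))// arrivals_mono.
Qed.

Lemma busyB k s t w : regular w -> 0 <= s <= t -> busy k t w - busy k s w = tint (occ k) s t w.
Proof.
move=> rw /andP[s0 st]; have mo : measurable_fun setT (occ k) := measurable_occ hs k.
rewrite /busy (tint_add (b := s) mo (occ_bounded k (t := t) rw)) ?s0//.
by rewrite addrAC subrr add0r.
Qed.

Lemma busy_mono k s t w : regular w -> 0 <= s <= t -> busy k s w <= busy k t w.
Proof.
move=> rw st; rewrite -subr_ge0 busyB// tint_ge0// => r _; exact: occ_ge0.
Qed.

Lemma cnt_mono k s t w : active net k -> regular w -> 0 <= s <= t ->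
  (cnt k s w <= cnt k t w)%N.
Proof.
move=> ak rw st; apply: (poisson_mono (sys_poisson hs ak)).
by rewrite ler_wpM2l ?(rate_ge0 netP n0 ak)// busy_mono.
Qed.

(** The clamp makes it bounded on all paths, the irregular ones included. *)
Definition used k s t K w : R := Num.max 0 (Num.min (busy k t w - busy k s w) K).

Lemma used_itv k s t K w : 0 <= K -> 0 <= used k s t K w <= K.
Proof.
by move=> K0; rewrite /used le_max lexx /= ge_max K0 /= ge_min lexx orbT.
Qed.

Lemma measurable_used k s t K : measurable_fun setT (used k s t K).
Proof.
apply: measurable_maxr => //; apply: measurable_minr => //.
by apply: measurable_funB; exact: (measurable_busy hs).
Qed.

Lemma past_sum t (us : seq R) (phi : ('I_I -> nat) * ('I_I -> 'I_J -> nat) -> nat) j :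
  (forall u, u \in us -> 0 <= u <= t) ->
  past t [set w | (\sum_(u <- us) phi (X u w, Z u w))%N = j].
Proof.
elim: us j => [|u us IH] j ut.
  under eq_set => w do rewrite big_nil.
  have [<-|j0] := eqVneq 0%N j.
    by rewrite (_ : [set _ : Omega | 0%N = 0%N] = setT); [exact: (salg_setT (pastP t))|exact/seteqP].
  rewrite (_ : [set _ : Omega | 0%N = j] = set0); first by case: (pastP t).
  by apply/seteqP; split => // w /= /eqP; rewrite (negbTE j0).
under eq_set => w do rewrite big_cons.
apply: (salg_pair (pastP t) _ _ [set p | (p.1 + p.2)%N = j]) => l.
  by apply: (past_state hs ha (fun s => phi s = l)); apply: ut; rewrite mem_head.
by apply: IH => v vus; apply: ut; rewrite in_cons vus orbT.
Qed.

Lemma measurable_arrivals t : measurable_fun setT (arrivals t).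
Proof.
apply/measurable_fun_natP => m.
pose B : set {ffun 'I_I -> nat} := [set c | (\sum_(i < I) (x0 i + c i))%N = m].
rewrite (_ : [set w | _] = [set w | B [ffun i => cnt (inl (inl i)) t w]]); last first.
  apply: eq_set => w; rewrite /arrivals /B /=.
  by under [in RHS]eq_bigr do rewrite ffunE.
apply: (salg_ffun (F := fun w i => cnt (inl (inl i)) t w)
  (@sigma_algebra_measurable _ Omega)) => i l.
by apply: (measurable_fun_natP _).2; exact: (measurable_cnt hs).
Qed.

(** The busy time is [t - s] times a time average of the occupation, which the
    mean of the occupations at sampled times approximates.  The occupation is
    capped at [b] to have bounded samples; the cap is exceeded only when many
    customers have arrived. *)
Lemma idle_approx k s t K : active net k -> 0 <= s -> s < t -> 0 <= K ->
  past_approx net n P N X Z t (fun w => K - used k s t K w) K.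
Proof.
move=> ak s0 st K0 eta eta0.
pose h := t - s; have h0 : 0 < h by rewrite subr_gt0.
have t0 : 0 <= t by lra.
have [M MP] := @nat_tail _ _ _ P _ (eta / 2) (measurable_arrivals t) (divr_gt0 eta0 (ltr0n _ 2)).
pose b := (M + max_servers).+1.
pose phi st0 := minn (occN net n k st0) b.
pose f : R * Omega -> R := on_path X Z (fun st0 => (phi st0)%:R).
have mf : measurable_fun setT f by exact: (measurable_on_path hs).
have f0 p : 0 <= f p by rewrite /f /on_path; case: ifP.
have fb p : f p <= b%:R by rewrite /f /on_path; case: ifP => // _; rewrite ler_nat geq_minr.
pose c2 := (eta / h) ^+ 2.
have c20 : 0 < c2 by rewrite exprn_gt0// divr_gt0.
pose m := (Num.truncn ((b%:R ^+ 2 + 1) * (eta / 2 * c2)^-1)).+1.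
have mP : (b%:R ^+ 2 + 1) <= eta / 2 * (m%:R * c2) :> R.
  rewrite mulrCA mulrC -ler_pdivrMl; last by rewrite mulr_gt0// divr_gt0.
  by rewrite mulrC ltW// truncnS_gt.
have m0 : 0 < m%:R :> R by rewrite ltr0n.
have [us [szus usI usP]] := @sampling_times _ _ _ P f b%:R s t mf f0 fb st m.
pose G w := (\sum_(u <- us) phi (X u w, Z u w))%N.
pose u j : R := Num.max 0 (K - h * (j%:R / m%:R)).
have uK j : 0 <= u j <= K.
  by rewrite /u le_max lexx /= ge_max K0 /= gerBl mulr_ge0 ?divr_ge0// ltW.
have pG j : past t [set w | G w = j].
  by apply: past_sum => v /usI /andP[sv vt]; rewrite (le_trans s0 sv).
exists G, u; split => //.
pose S w := \sum_(u <- us) f (u, w) - m%:R * (tint f s t w / (t - s)).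
have SE w : S w = (G w)%:R - m%:R * (tint f s t w / h).
  rewrite /S /G natr_sum; congr (_ - _); apply: eq_big_seq => v /usI /andP[sv _].
  by rewrite /f /on_path /= (le_trans s0 sv).
have mG : measurable_fun setT G.
  by apply/measurable_fun_natP => j; exact: (past_measurable hs (pG j)).
have mS : measurable_fun setT S.
  apply: (eq_measurable_fun (fun w => (G w)%:R - m%:R * (tint f s t w / h))).
    by move=> w _; rewrite SE.
  apply: measurable_funB; first exact: (measurable_of_nat (fun m => m%:R : R) mG).
  by apply: measurable_funM => //; apply: measurable_funM => //; exact: measurable_tint.
have [Nl [mNl Nl0 sub]] := regular_ae netP hs ha.
pose B1 := [set w | (M < arrivals t w)%N].
pose B2 := [set w | ((m%:R ^+ 2 * c2)%:E <= `|(S w ^+ 2)%:E|)%E].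
have mB1 : measurable B1.
  by apply: (salg_preimage (@sigma_algebra_measurable _ Omega) _ [set k | (M < k)%N]);
    apply: (measurable_fun_natP _).2; exact: measurable_arrivals.
have mS2 : measurable_fun setT (fun w => (S w ^+ 2)%:E).
  exact/measurable_EFinP/measurable_funX.
have mB2 : measurable B2.
  rewrite -[B2]setTI; apply: emeasurable_fun_c_infty => //.
  exact: measurableT_comp.
have PB2 : (P B2 <= (eta / 2)%:E)%E.
  have mc : 0 < m%:R ^+ 2 * c2 by rewrite mulr_gt0// exprn_gt0.
  have := @le_integral_abse _ _ _ P setT measurableT _ _ mS2 mc.
  rewrite setTI -/B2 => le1.
  have : ((m%:R ^+ 2 * c2)%:E * P B2 <= (m%:R * (b%:R ^+ 2 + 1))%:E)%E.
    apply: (le_trans le1); apply: le_trans usP; apply: ge0_le_integral => //.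
    - exact: measurableT_comp.
    - by move=> w _; rewrite gee0_abs// lee_fin sqr_ge0.
  rewrite -[P B2]fineK ?fin_num_measure// -EFinM !lee_fin => le2.
  rewrite -(ler_pM2l mc); apply: (le_trans le2).
  by have := ler_wpM2l (ltW m0) mP; lra.
apply: (@le_trans _ _ (P (Nl `|` (B1 `|` B2)))).
  apply: le_measure; rewrite ?inE.
  - have md : measurable_fun setT (fun w => `|K - used k s t K w - u (G w)|).
      apply: measurableT_comp => //; apply: measurable_funB; last exact: measurable_of_nat.
      by apply: measurable_funB => //; exact: measurable_used.
    have := md measurableT `]eta, +oo[%classic (measurable_itv _).
    by congr measurable; apply/seteqP; split => w /=; rewrite in_itv /= andbT; [case|].
  - by apply: measurableU => //; exact: measurableU.
  move=> w /= big; apply: contrapT => /not_orP[Nw /not_orP[/negP B1w /negP B2w]].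
  have rw : regular w by apply: contrapT => h'; exact/Nw/sub.
  move: B1w B2w; rewrite -leqNgt -ltNge => Aw.
  rewrite gee0_abs ?lee_fin ?sqr_ge0// lte_fin => S2.
  have Xb v i : s <= v <= t -> (X v w i <= M)%N.
    move=> /andP[sv vt]; have v0 := le_trans s0 sv.
    apply: (leq_trans (X_le_arrivals _ rw v0)); apply: leq_trans Aw; exact: arrivals_mono.
  have fE : tint f s t w = busy k t w - busy k s w.
    rewrite busyB// ?s0 ?ltW//; apply: eq_Rintegral => v; rewrite inE /= in_itv /= => /andP[sv vt].
    have := @occ_le k v M w (fun i => Xb v i _); rewrite sv vt => /(_ isT).
    rewrite /f /occ /on_path /= (le_trans s0 sv) ler_nat => ob.
    by rewrite /phi (minn_idPl ob).
  have O0 : 0 <= busy k t w - busy k s w by rewrite subr_ge0 busy_mono// s0 ltW.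
  set O := busy k t w - busy k s w in fE O0.
  have SO : `|O - h * ((G w)%:R / m%:R)| < eta.
    have -> : O - h * ((G w)%:R / m%:R) = - (h / m%:R * S w).
      by rewrite SE fE; field; rewrite !gt_eqF.
    rewrite normrN normrM ger0_norm; last by rewrite divr_ge0// ltW.
    have S1 : `|S w| < m%:R * (eta / h).
      have mh0 : 0 <= m%:R * (eta / h) by rewrite mulr_ge0// divr_ge0 ?(ltW eta0) ?(ltW h0).
      by rewrite -(@ltr_pXn2r _ 2)// ?nnegrE// real_normK ?num_real// exprMn.
    have -> : eta = h / m%:R * (m%:R * (eta / h)) by field; rewrite !gt_eqF.
    by rewrite ltr_pM2l// divr_gt0.
  by move: big; apply/negP; rewrite -leNgt (le_trans (clamp_dist _ O0 K0))// ltW.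
apply: (le_trans (measureU2 _ _ _)) => //; first exact: measurableU.
apply: (@le_trans _ _ (0 + (P B1 + P B2))%E).
  by apply: leeD; [rewrite le_eqVlt; apply/orP; left; apply/eqP; exact: Nl0|exact: measureU2].
by rewrite add0e [eta]splitr EFinD leeD.
Qed.

(** The increment over the fixed amount [K] of service from time [s] is the sum
    of the increment over the service used in [[s, t]] and of an increment from
    time [t] over the rest.  Independence of past and future at [s] gives the
    mean of the whole, independence at [t] that of the second summand. *)
Lemma martingale F k s t K : past s F -> active net k -> 0 <= s -> s < t -> 0 <= K ->
  (\int[P]_(w in F) (incr k s (used k s t K w) w)%:R%:E =
   \int[P]_(w in F) (rate k * used k s t K w)%:E)%E.
Proof.
move=> pF ak s0 st K0; have t0 : 0 <= t by lra.
have mF := past_measurable hs pF.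
have uK w := used_itv k s t w K0.
have mu := measurable_used k s t K.
have rk := rate_ge0 netP n0 ak.
have mtau : measurable_fun setT (fun w => K - used k s t K w) by exact: measurable_funB.
have tauK w : 0 <= K - used k s t K w <= K by have /andP[? ?] := uK w; apply/andP; split; lra.
have E1 := incr_mean netP n0 hs ha pF ak s0 K0.
have E2 := incr_stopped (past_mono (ltW st) pF) ak t0 mtau tauK (idle_approx ak s0 st K0).
have split1 : (\int[P]_(w in F) (incr k s K w)%:R%:E =
    \int[P]_(w in F) (incr k s (used k s t K w) w)%:R%:E
    + \int[P]_(w in F) (incr k t (K - used k s t K w) w)%:R%:E)%E.
  have m1 := measurable_of_nat (fun m => m%:R : R) (measurable_incr hs s ak mu).
  have m2 := measurable_of_nat (fun m => m%:R : R) (measurable_incr hs t ak mtau).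
  have m3 := measurable_of_nat (fun m => m%:R : R) (measurable_incr hs s ak (measurable_cst K)).
  rewrite -ge0_integralD//.
  - apply: ge0_ae_eq_integral => //.
    + exact/measurable_funTS/measurable_EFinP.
    + by apply: emeasurable_funD; exact/measurable_funTS/measurable_EFinP.
    + by move=> w _; rewrite -EFinD lee_fin addr_ge0.
    + apply: filterS (regular_ae netP hs ha) => w rw _.
      rewrite -EFinD -natrD; congr (_%:R%:E).
      have st' : 0 <= s <= t by rewrite s0 ltW.
      have O0 : 0 <= busy k t w - busy k s w by rewrite subr_ge0 busy_mono.
      rewrite /incr /used; set b := busy k s w in O0 *; set b' := busy k t w in O0 *.
      have mono := poisson_mono (sys_poisson hs ak).
      have [h|h] := leP (b' - b) K.
        rewrite (max_r O0).
        have -> : rate k * b' + rate k * (K - (b' - b)) = rate k * b + rate k * K by ring.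
        have -> : rate k * b + rate k * (b' - b) = rate k * b' by ring.
        rewrite addnC addnBA ?subnK//; apply: mono; rewrite -?mulrDr ler_wpM2l//; lra.
      rewrite (max_r K0) subrr mulr0 addr0 subnn addn0//.
  - exact/measurable_funTS/measurable_EFinP.
  - exact/measurable_funTS/measurable_EFinP.
have split2 : (\int[P]_(w in F) (rate k * K)%:E =
    \int[P]_(w in F) (rate k * used k s t K w)%:E
    + \int[P]_(w in F) (rate k * (K - used k s t K w))%:E)%E.
  rewrite -ge0_integralD//.
  - by apply: eq_integral => w _; rewrite -EFinD; congr EFin; ring.
  - by move=> w _; rewrite lee_fin mulr_ge0//; have /andP[] := uK w.
  - by apply: measurable_funTS; apply/measurable_EFinP; exact: measurable_funM.
  - by move=> w _; rewrite lee_fin mulr_ge0//; have /andP[] := tauK w.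
  - by apply: measurable_funTS; apply/measurable_EFinP; exact: measurable_funM.
have fin : (\int[P]_(w in F) (rate k * (K - used k s t K w))%:E \is a fin_num)%E.
  rewrite ge0_fin_numE; last first.
    by apply: integral_ge0 => w _; rewrite lee_fin mulr_ge0//; have /andP[] := tauK w.
  apply: (@le_lt_trans _ _ (\int[P]_(w in F) (rate k * K)%:E)%E).
    apply: ge0_le_integral => //.
    - by move=> w _; rewrite lee_fin mulr_ge0//; have /andP[] := tauK w.
    - by apply: measurable_funTS; apply/measurable_EFinP; exact: measurable_funM.
    - by move=> w _; rewrite lee_fin ler_wpM2l//; have /andP[] := tauK w.
  by rewrite integral_cst// ltey_eq fin_numM// fin_num_measure.
have E3 : (\int[P]_(w in F) (incr k s K w)%:R%:E = \int[P]_(w in F) (rate k * K)%:E)%E.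
  by rewrite E1 integral_cst// muleC.
rewrite split1 split2 E2 in E3.
by rewrite -[LHS](addeK _ fin) E3 addeK.
Qed.

End Martingale.

(** * The generator as a sum over the sources *)

Section Generator.
Context (R : realType) (I J : nat) (net : network R I J) (n : nat).
Context (beta : 'rV[R]_I) (kappa C2 : R).
Local Notation rate := (rate net n).
Local Notation Xh := (X_hat net n).

Lemma sum_sources (f : source I J -> R) :
  \sum_(k | active net k) f k =
  \sum_(i < I) (f (inl (inl i)) + \sum_(j < J | edge net i j) f (inl (inr (i, j))) + f (inr i)).
Proof.
rewrite big_sumType big_sumType /= 2!big_split/=; congr (_ + _ + _).
by rewrite (pair_big_dep xpredT (edge net) (fun i j => f (inl (inr (i, j)))))/=; apply: eq_big => -[i j].
Qed.

Definition jump (k : source I J) (i : 'I_I) : R :=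
  match k with
  | inl (inl i') => (i == i')%:R
  | inl (inr (i', j)) => - (i == i')%:R
  | inr i' => - (i == i')%:R
  end.

Definition lyap (x : 'I_I -> nat) : R := (1 + sqbnorm beta (Xh x)) `^ (kappa / 2).

(** First-order variation of [lyap] at a jump of source [k], together with its
    share of the second-order error. *)
Definition jump_bound (k : source I J) (x : 'I_I -> nat) : R :=
  (1 + sqbnorm beta (Xh x)) `^ (kappa / 2 - 1) *
  (kappa * (\sum_(i < I) beta 0 i * Xh x 0 i * (jump k i / Num.sqrt n%:R)) + C2 / n%:R).

Lemma sum_jump_bound (D : source I J -> R) x :
  \sum_(k | active net k) jump_bound k x * D k =
  (1 + sqbnorm beta (Xh x)) `^ (kappa / 2 - 1) *
  (kappa * (\sum_(i < I) beta 0 i * Xh x 0 i * ((D (inl (inl i))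
      - \sum_(j < J | edge net i j) D (inl (inr (i, j))) - D (inr i)) / Num.sqrt n%:R))
   + C2 * ((\sum_(k | active net k) D k) / n%:R)).
Proof.
pose y i := beta 0 i * Xh x 0 i / Num.sqrt n%:R.
have E k : jump_bound k x * D k = (1 + sqbnorm beta (Xh x)) `^ (kappa / 2 - 1) *
   (kappa * (\sum_(i < I) y i * (jump k i * D k)) + C2 / n%:R * D k).
  rewrite /jump_bound -mulrA mulrDl -mulrA mulr_suml; congr (_ * (_ * _ + _)).
  by apply: eq_bigr => i _; rewrite /y; ring.
under eq_bigr do rewrite E.
rewrite -mulr_sumr big_split/= -!mulr_sumr; congr (_ * (_ * _ + _)); last by ring.
rewrite exchange_big/=; apply: eq_bigr => i _.
rewrite -mulr_sumr sum_sources.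
have -> : \sum_(i0 < I) (jump (inl (inl i0)) i * D (inl (inl i0)) +
     \sum_(j < J | edge net i0 j) jump (inl (inr (i0, j))) i * D (inl (inr (i0, j))) +
     jump (inr i0) i * D (inr i0)) =
   D (inl (inl i)) - \sum_(j < J | edge net i j) D (inl (inr (i, j))) - D (inr i).
  rewrite (bigD1 i)//= [X in _ + X]big1 ?addr0; last first.
    move=> i' ne; rewrite eq_sym (negbTE ne) oppr0 !mul0r big1 ?addr0// => j _.
    by rewrite mul0r.
  rewrite eqxx mul1r mulN1r; congr (_ + _ - _).
  by rewrite -sumrN; apply: eq_bigr => j _; rewrite mulN1r.
by rewrite /y; ring.
Qed.

Hypothesis n0 : (0 < n)%N.

(** Several sources may jump during the same step; their joint second-order
    effect depends on the number of jumps only, and is distributed over the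
    sources. *)
Lemma lyap_jump (x x' : 'I_I -> nat) (D : source I J -> nat) :
  (forall (n : nat) (x x' : 'I_I -> nat) (S : nat), (0 < n)%N -> (S <= #|{: source I J}|)%N ->
    (forall i, `|(x' i)%:R - (x i)%:R| <= S%:R :> R) ->
    (1 + sqbnorm beta (X_hat net n x')) `^ (kappa / 2) <=
    (1 + sqbnorm beta (X_hat net n x)) `^ (kappa / 2) +
    (1 + sqbnorm beta (X_hat net n x)) `^ (kappa / 2 - 1) *
    (kappa * (\sum_(i < I) beta 0 i * X_hat net n x 0 i * (((x' i)%:R - (x i)%:R) / Num.sqrt n%:R))
      + C2 * (S%:R / n%:R))) ->
  (forall k, active net k -> (D k <= 1)%N) ->
  (forall i, (x' i)%:R - (x i)%:R = (D (inl (inl i)))%:R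
     - \sum_(j < J | edge net i j) (D (inl (inr (i, j))))%:R - (D (inr i))%:R :> R) ->
  lyap x' <= lyap x + \sum_(k | active net k) jump_bound k x * (D k)%:R.
Proof.
move=> taylor D1 dx; rewrite (sum_jump_bound (fun k => (D k)%:R)).
pose S := (\sum_(k | active net k) D k)%N.
have := taylor n x x' S n0; rewrite -natr_sum -/S; under eq_bigr do rewrite dx.
apply.
  rewrite -sum1_card /S big_mkcond; apply: leq_sum => k _.
  by case: ifP => // /D1.
move=> i; rewrite dx /S natr_sum sum_sources (bigD1 i)//=.
set a := (D (inl (inl i)))%:R; set b := \sum_(j < J | _) _; set c := (D (inr i))%:R.
have b0 : 0 <= b by apply: sumr_ge0.
have : 0 <= \sum_(i0 < I | i0 != i) ((D (inl (inl i0)))%:R +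
   \sum_(j < J | edge net i0 j) (D (inl (inr (i0, j))))%:R + (D (inr i0))%:R) :> R.
  by apply: sumr_ge0 => i0 _; rewrite !addr_ge0// sumr_ge0.
have : 0 <= a by rewrite /a. have : 0 <= c by rewrite /c.
move=> c0 a0 h; rewrite ler_norml; apply/andP; split; lra.
Qed.

Lemma generator_sources (netP : network_assumptions net) (c C : R) x z : feasible net n x z ->
  (1 + sqbnorm beta (X_hat net n x)) `^ (kappa / 2 - 1) *
      (kappa * \sum_(i < I) beta 0 i * X_hat net n x 0 i * sys_drift net n x z i
      + C2 * (total_rate net n x z / n%:R))
    <= - c * (1 + sqbnorm beta (X_hat net n x)) `^ (kappa / 2) + C * (1 + qsum R n x z) `^ kappa ->
  \sum_(k | active net k) jump_bound k x * (rate k * (occN net n k (x, z))%:R) <=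
  - c * lyap x + C * (1 + qsum R n x z) `^ kappa.
Proof.
move=> f; apply: le_trans; rewrite (sum_jump_bound (fun k => rate k * (occN net n k (x, z))%:R)).
have mu0 i j : ~~ edge net i j -> mu_n net n i j = 0 by exact: (mu_n_eq0 netP).
have full i : \sum_(j < J | edge net i j) mu_n net n i j * (z i j)%:R =
   \sum_(j < J) mu_n net n i j * (z i j)%:R.
  rewrite [RHS](bigID (edge net i))/= [X in _ + X]big1 ?addr0// => j e.
  by rewrite mu0// mul0r.
have q i : (queue x z i)%:~R = (x i - \sum_(j < J) z i j)%N%:R :> R.
  by rewrite (queue_feasible i f).
rewrite sum_sources /occN /= f le_eqVlt; apply/orP; left; apply/eqP.
congr (_ * (_ * _ + _ * (_ / _))).
  by apply: eq_bigr => i _; rewrite /sys_drift full q mulr1.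
by apply: eq_bigr => i _; rewrite full q mulr1.
Qed.

End Generator.

(** * One step along a path *)

Lemma bounded_states (R : realType) (I J : nat) (M : nat)
    (phi : ('I_I -> nat) * ('I_I -> 'I_J -> nat) -> R) :
  exists B : R, 0 <= B /\ forall x z, (forall i, x i <= M)%N -> (forall i j, z i j <= M)%N ->
    `|phi (x, z)| <= B.
Proof.
pose dec (a : {ffun 'I_I -> 'I_M.+1}) (b : {ffun 'I_I * 'I_J -> 'I_M.+1}) :=
  (fun i => a i : nat, fun i j => b (i, j) : nat).
exists (\sum_a \sum_b `|phi (dec a b)|); split.
  by apply: sumr_ge0 => a _; apply: sumr_ge0.
move=> x z xM zM.
pose a : {ffun 'I_I -> 'I_M.+1} := [ffun i => inord (x i)].
pose b : {ffun 'I_I * 'I_J -> 'I_M.+1} := [ffun p => inord (z p.1 p.2)].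
have -> : (x, z) = dec a b.
  congr (_, _); first by apply/funext => i; rewrite ffunE inordK// ltnS.
  by apply/funext => i; apply/funext => j; rewrite ffunE inordK// ltnS.
rewrite (bigD1 a)//= (bigD1 b)//= -addrA lerDl addr_ge0//; first exact: sumr_ge0.
by apply: sumr_ge0 => ? _; apply: sumr_ge0.
Qed.

Lemma tintZ (R : realType) d (T : measurableType d) (f : R * T -> R) w (a c K r : R) :
  measurable_fun setT f -> (forall s, a <= s <= c -> `|f (s, w)| <= K) ->
  tint (fun p => r * f p) a c w = r * tint f a c w.
Proof. by move=> mf fK; rewrite /tint RintegralZl//; exact: path_integrable mf fK. Qed.

Lemma tintD (R : realType) d (T : measurableType d) (f g : R * T -> R) w (a c K L : R) :
  measurable_fun setT f -> (forall s, a <= s <= c -> `|f (s, w)| <= K) ->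
  measurable_fun setT g -> (forall s, a <= s <= c -> `|g (s, w)| <= L) ->
  tint (fun p => f p + g p) a c w = tint f a c w + tint g a c w.
Proof.
move=> mf fK mg gL; rewrite /tint RintegralD//.
- exact: path_integrable mf fK.
- exact: path_integrable mg gL.
Qed.

Lemma tint_sum (R : realType) d (T : measurableType d) (S : Type) (r : seq S)
    (f : S -> R * T -> R) w (a c : R) (K : S -> R) : a <= c ->
  (forall k, measurable_fun setT (f k)) ->
  (forall k s, a <= s <= c -> `|f k (s, w)| <= K k) ->
  tint (fun p => \sum_(k <- r) f k p) a c w = \sum_(k <- r) tint (f k) a c w.
Proof.
move=> ac mf fK; elim: r => [|k r IH].
  under [X in tint X]eq_fun do rewrite big_nil.
  by rewrite tint_cst// mul0r big_nil.
rewrite big_cons -IH -(@tintD _ _ _ _ _ _ _ _ (K k) (\sum_(k <- r) K k)).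
- by congr tint; apply/funext => p; rewrite big_cons.
- exact: mf.
- by move=> s; exact: fK.
- exact: measurable_sum.
- move=> s asc; apply: (le_trans (ler_norm_sum _ _ _)).
  by apply: ler_sum => k' _; exact: fK.
Qed.

Section Step.
Context (R : realType) (I J : nat) (net : network R I J) (n : nat).
Context (d : measure_display) (Omega : measurableType d) (P : probability Omega R).
Context (N : source I J -> R -> Omega -> nat).
Context (X : R -> Omega -> 'I_I -> nat).
Context (Z : R -> Omega -> 'I_I -> 'I_J -> nat).
Context (x0 : 'I_I -> nat).
Hypothesis netP : network_assumptions net.
Hypothesis n0 : (0 < n)%N.
Hypothesis hs : is_system net n P N X Z x0.
Hypothesis ha : admissible net n P N X Z.
Local Notation rate := (rate net n).
Local Notation occ := (occ net n X Z).
Local Notation busy := (busy net n X Z).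
Local Notation cnt := (cnt net n N X Z).
Local Notation incr := (incr net n N X Z).
Local Notation regular := (regular net n N X Z x0).
Local Notation used := (used net n X Z).
Local Notation arrivals := (arrivals net n N X Z x0).

(** The clamp at [K] is inactive. *)
Lemma used_full k s t K w : active net k -> regular w -> 0 <= s <= t ->
  busy k t w - busy k s w <= K ->
  used k s t K w = busy k t w - busy k s w /\
  cnt k t w = (cnt k s w + incr k s (used k s t K w) w)%N.
Proof.
move=> ak rw st bK.
have O0 : 0 <= busy k t w - busy k s w by rewrite subr_ge0 (busy_mono netP n0 hs k rw).
have uE : used k s t K w = busy k t w - busy k s w.
  by rewrite /used (min_idPl bK) (max_idPr O0).
split => //; rewrite uE /incr.
rewrite -mulrDr addrC subrK subnKC//.
exact: (cnt_mono netP n0 hs ak rw st).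
Qed.

Variable M : nat.
(** Starting from at most [M] arrivals, simple jumps bring at most one more per
    class; up to then no source is occupied more than [occ_cap]. *)
Definition occ_cap : R := (M + I + max_servers net n).+1%:R.

Let occ_cap_ge1 : 1 <= occ_cap. Proof. by rewrite ler1n. Qed.

Lemma used_arrival i s t w : regular w -> 0 <= s <= t ->
  cnt (inl (inl i)) t w =
  (cnt (inl (inl i)) s w + incr (inl (inl i)) s (used (inl (inl i)) s t (occ_cap * (t - s))%R w) w)%N.
Proof.
move=> rw /andP[s0 st]; apply: (used_full (k := inl (inl i)) _ rw _ _).2 => //; first by rewrite s0.
by rewrite !(busy_arrival netP n0 i rw) ?(le_trans s0)// ler_peMl// subr_ge0.
Qed.

Lemma few_arrivals s t w : regular w -> 0 <= s <= t -> (arrivals s w <= M)%N ->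
  (forall k, active net k -> (incr k s (used k s t (occ_cap * (t - s))%R w) w <= 1)%N) ->
  (arrivals t w <= M + I)%N.
Proof.
move=> rw st AM D1.
apply: (@leq_trans (\sum_(i < I) ((x0 i + cnt (inl (inl i)) s w) + 1))%N).
  apply: leq_sum => i _; rewrite (used_arrival _ rw st) addnA leq_add2l.
  exact: (D1 (inl (inl i))).
by rewrite big_split/= sum1_card card_ord leq_add2r.
Qed.

Lemma busy_le k s t w m : regular w -> 0 <= s <= t -> (arrivals t w <= m)%N ->
  busy k t w - busy k s w <= (m + max_servers net n).+1%:R * (t - s).
Proof.
move=> rw /andP[s0 st] Am; rewrite (busyB netP n0 hs k rw) ?s0//.
rewrite -(tint_cst w _ st).
have ob r : s <= r <= t -> occ k (r, w) <= (m + max_servers net n).+1%:R.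
  move=> /andP[sr rt]; have r0 := le_trans s0 sr; apply: occ_le => i.
  apply: leq_trans Am; apply: leq_trans (X_le_arrivals _ rw r0) _.
  exact: (arrivals_mono netP n0 hs).
apply: (@tint_le _ _ _ _ _ _ _ _ ((m + max_servers net n).+1%:R)) => //.
- exact: (measurable_occ hs).
- by move=> r rst; rewrite ger0_norm ?occ_ge0// ob.
- by move=> r _; rewrite ger0_norm.
Qed.

Lemma state_jump s t w (D : source I J -> nat) : regular w -> 0 <= s -> 0 <= t ->
  (forall k, active net k -> cnt k t w = cnt k s w + D k)%N ->
  forall i, (X t w i)%:R - (X s w i)%:R = (D (inl (inl i)))%:R
     - \sum_(j < J | edge net i j) (D (inl (inr (i, j))))%:R - (D (inr i))%:R :> R.
Proof.
move=> [bal _] s0 t0 cD i.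
have := congr1 (fun m => m%:R : R) (bal t i t0).
have := congr1 (fun m => m%:R : R) (bal s i s0).
rewrite !natrD !natr_sum.
have -> : \sum_(j < J | edge net i j) (cnt (inl (inr (i, j))) t w)%:R =
   \sum_(j < J | edge net i j) (cnt (inl (inr (i, j))) s w)%:R
   + \sum_(j < J | edge net i j) (D (inl (inr (i, j))))%:R :> R.
  by rewrite -big_split/=; apply: eq_bigr => j e; rewrite (cD (inl (inr (i, j))) e) natrD.
rewrite (cD (inr i) isT) (cD (inl (inl i)) isT) !natrD; lra.
Qed.

Lemma no_jump s t w : regular w -> 0 <= s <= t ->
  (forall k, active net k -> cnt k t w = cnt k s w) ->
  X t w = X s w /\ arrivals t w = arrivals s w.
Proof.
move=> rw /andP[s0 st] c; split; last by apply: eq_bigr => i _; rewrite (c (inl (inl i)) isT).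
apply/funext => i.
have c' k : active net k -> (cnt k t w = cnt k s w + 0)%N by move=> ak; rewrite addn0 c.
have h := state_jump rw s0 (le_trans s0 st) c' i.
by apply/eqP; rewrite -(eqr_nat R) -subr_eq0 h big1// !subr0.
Qed.

Context (beta : 'rV[R]_I) (kappa C2 c C : R).
Hypotheses (c0 : 0 < c) (C0 : 0 <= C).
Local Notation V := (lyap net n beta kappa).
Local Notation G := (jump_bound net n beta kappa C2).
Hypothesis taylor : forall x x' (D : source I J -> nat),
  (forall k, active net k -> (D k <= 1)%N) ->
  (forall i, (x' i)%:R - (x i)%:R = (D (inl (inl i)))%:R
     - \sum_(j < J | edge net i j) (D (inl (inr (i, j))))%:R - (D (inr i))%:R :> R) ->
  V x' <= V x + \sum_(k | active net k) G k x * (D k)%:R.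
Hypothesis gen : forall x z, feasible net n x z ->
  \sum_(k | active net k) G k x * (rate k * (occN net n k (x, z))%:R) <=
  - c * V x + C * (1 + qsum R n x z) `^ kappa.

Definition on_feasible (phi : ('I_I -> nat) * ('I_I -> 'I_J -> nat) -> R) :=
  on_path X Z (fun s => if feasible net n s.1 s.2 then phi s else 0).

Definition V_path := on_feasible (fun s => V s.1).
Definition Q_path := on_feasible (fun s => (1 + qsum R n s.1 s.2) `^ kappa).

Lemma measurable_on_feasible phi : measurable_fun setT (on_feasible phi).
Proof. exact: (measurable_on_path hs). Qed.

Lemma V_ge0 x : 0 <= V x. Proof. exact: powR_ge0. Qed.

Lemma V_path_ge0 p : 0 <= V_path p.
Proof. by rewrite /V_path /on_feasible /on_path; do 2 case: ifP => // _; exact: V_ge0. Qed.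

Lemma Q_path_ge0 p : 0 <= Q_path p.
Proof. by rewrite /Q_path /on_feasible /on_path; do 2 case: ifP => // _; exact: powR_ge0. Qed.

Lemma on_feasible_bounded phi m : exists B : R, 0 <= B /\ forall w t, regular w -> 0 <= t ->
  (arrivals t w <= m)%N -> forall s, 0 <= s <= t -> `|on_feasible phi (s, w)| <= B.
Proof.
have [B [B0 BP]] := @bounded_states R I J m phi.
exists B; split => // w t rw t0 Am s /andP[s0 st].
rewrite /on_feasible /on_path /= s0; case: ifP => f; last by rewrite normr0.
have Xm i : (X s w i <= m)%N.
  apply: leq_trans (X_le_arrivals _ rw s0) _; apply: leq_trans Am.
  exact: (arrivals_mono netP n0 hs).
apply: BP => // i j; apply: leq_trans (Xm i).
by have /and3P[_ /forallP/(_ i) h _] := f; apply: leq_trans h; rewrite (bigD1 j)//= leq_addr.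
Qed.

Definition jumps k s t w : nat := incr k s (used k s t (occ_cap * (t - s)) w) w.
Definition compensator k s t w : R := rate k * used k s t (occ_cap * (t - s)) w.

(** Without a jump the state is constant, so that the bound on the generator can
    be integrated over the step although the control varies. *)
Lemma step_still s t w : regular w -> 0 <= s <= t -> (arrivals s w <= M)%N ->
  (forall k, active net k -> incr k s (used k s t (occ_cap * (t - s)) w) w = 0%N) ->
  [/\ X t w = X s w, arrivals t w = arrivals s w &
  c * tint V_path s t w + \sum_(k | active net k) G k (X s w) * (rate k * used k s t (occ_cap * (t - s)) w)
   <= C * tint Q_path s t w].
Proof.
move=> rw st As D0; have /andP[s0 le_st] := st.
have At : (arrivals t w <= M)%N.
  apply: (leq_trans _ As); apply: leq_sum => i _; rewrite (used_arrival _ rw st).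
  by rewrite (D0 (inl (inl i)) isT) addn0.
have bK k : busy k t w - busy k s w <= occ_cap * (t - s).
  apply: (le_trans (busy_le k rw st At)); rewrite ler_wpM2r ?subr_ge0// ler_nat.
  by rewrite ltnS leq_add2r leq_addr.
have cst_cnt k : active net k -> cnt k t w = cnt k s w.
  by move=> ak; have [_ ->] := used_full ak rw st (bK k); rewrite D0// addn0.
have still r : s <= r <= t -> X r w = X s w.
  move=> /andP[sr rt]; apply: (no_jump rw _ _).1; first by rewrite s0.
  move=> k ak; apply/eqP; rewrite eqn_leq -{1}(cst_cnt k ak).
  by rewrite !(cnt_mono netP n0 hs ak rw)// ?s0// (le_trans s0 sr).
have [Xt At'] := no_jump rw st cst_cnt; split => //.
have ob k r : s <= r <= t -> `|occ k (r, w)| <= (arrivals t w + max_servers net n).+1%:R.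
  by move=> /andP[sr rt]; apply: (occ_bounded netP n0 hs _ rw); rewrite (le_trans s0 sr).
have [B1 [B10 B1P]] := on_feasible_bounded (fun s => V s.1) M.
have [B2 [B20 B2P]] := on_feasible_bounded (fun s => (1 + qsum R n s.1 s.2) `^ kappa) M.
have V1 r : s <= r <= t -> `|V_path (r, w)| <= B1.
  by move=> /andP[sr rt]; apply: (B1P w t) => //; rewrite ?(le_trans s0)// sr.
have Q1 r : s <= r <= t -> `|Q_path (r, w)| <= B2.
  by move=> /andP[sr rt]; apply: (B2P w t) => //; rewrite ?(le_trans s0)// sr.
pose g k := G k (X s w) * rate k.
have mo k : measurable_fun setT (occ k) := measurable_occ hs k.
have mV := measurable_on_feasible (fun s => V s.1).
have mQ := measurable_on_feasible (fun s => (1 + qsum R n s.1 s.2) `^ kappa).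
pose L : R := (arrivals t w + max_servers net n).+1%:R.
have -> : \sum_(k | active net k) G k (X s w) * (rate k * used k s t (occ_cap * (t - s)) w) =
   tint (fun p => \sum_(k | active net k) g k * occ k p) s t w.
  under [in RHS]eq_fun do rewrite -big_filter.
  rewrite (tint_sum _ (K := fun k => `|g k| * L)) => //.
  - rewrite big_filter; apply: eq_bigr => k ak.
    rewrite (tintZ _ (mo k) (ob k)) -(busyB netP n0 hs k rw st).
    by rewrite (used_full ak rw st (bK k)).1 mulrA.
  - by move=> k; exact: measurable_funM.
  - by move=> k r rst; rewrite normrM ler_wpM2l// ob.
rewrite -(tintZ c mV V1) -(tintZ C mQ Q1).
have mS : measurable_fun setT (fun p => \sum_(k | active net k) g k * occ k p).
  under eq_fun do rewrite -big_filter.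
  by apply: measurable_sum => k; exact: measurable_funM.
have Sb r : s <= r <= t -> `|\sum_(k | active net k) g k * occ k (r, w)| <=
    \sum_(k | active net k) `|g k| * L.
  move=> rst; apply: (le_trans (ler_norm_sum _ _ _)); apply: ler_sum => k _.
  by rewrite normrM ler_wpM2l// ob.
have cVb r : s <= r <= t -> `|c * V_path (r, w)| <= c * B1.
  by move=> rst; rewrite normrM (gtr0_norm c0) ler_pM2l// V1.
rewrite -(tintD _ cVb mS Sb); last exact: measurable_funM.
apply: (@tint_le _ _ _ _ _ _ _ _ (c * B1 + \sum_(k | active net k) `|g k| * L + C * B2)).
- by apply: measurable_funD => //; exact: measurable_funM.
- exact: measurable_funM.
- move=> r rst; apply: (le_trans (ler_normD _ _)).
  by have := cVb r rst; have := Sb r rst; have := mulr_ge0 C0 B20; lra.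
- move=> r rst; rewrite normrM (ger0_norm C0).
  have h1 := ler_wpM2l C0 (Q1 r rst).
  have h2 : 0 <= \sum_(k | active net k) `|g k| * L by apply: sumr_ge0 => k _; rewrite mulr_ge0.
  by have := mulr_ge0 (ltW c0) B10; lra.
move=> r rst; have /andP[sr rt] := rst; have r0 := le_trans s0 sr.
rewrite /V_path /Q_path /on_feasible /occ /on_path /= r0 (still r rst).
case: ifP => f; last first.
  rewrite big1 ?mulr0 ?addr0// => k _.
  by rewrite /occN /= f mulr0.
have := gen f.
have -> : \sum_(k | active net k) G k (X s w) * (rate k * (occN net n k (X s w, Z r w))%:R) =
    \sum_(k | active net k) g k * (occN net n k (X s w, Z r w))%:R.
  by apply: eq_bigr => k _; rewrite /g mulrA.
lra.
Qed.

Lemma compensator_itv k s t w : active net k -> s <= t -> 0 <= compensator k s t w <= rate k * occ_cap * (t - s).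
Proof.
move=> ak st; have K0s : 0 <= occ_cap * (t - s) by rewrite mulr_ge0 ?subr_ge0// (le_trans ler01).
have /andP[u0 u1] := used_itv net n X Z k s t w K0s.
by rewrite /compensator mulr_ge0 ?(rate_ge0 netP n0 ak)//= -mulrA ler_wpM2l// (rate_ge0 netP n0 ak).
Qed.

(** Three cases: without a jump the generator bound applies; if every source
    jumps at most once, the Taylor bound applies and the remaining terms are of
    order [t - s] on an event where some source has jumped; if a source jumps
    twice, its second factorial power is at least 2 and absorbs everything. *)
Lemma step_core T : 0 <= T -> exists CM : R, 0 <= CM /\ forall w s t, regular w ->
  0 <= s -> s < t -> t <= T -> (arrivals s w <= M)%N ->
  (arrivals t w <= M)%N%:R * (V (X t w) + c * tint V_path s t w) <=
  V (X s w) + C * tint Q_path s t w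
  + \sum_(k | active net k) G k (X s w) * ((jumps k s t w)%:R - compensator k s t w)
  + CM * \sum_(k | active net k) ((jumps k s t w * (jumps k s t w).-1)%:R
       + (t - s) * (jumps k s t w)%:R).
Proof.
have ar1 (v e q a g : R) : a + g <= q -> 0 <= e -> v + a <= v + q + (0 - g) + e by lra.
have ar2 (B a b e : R) : 0 <= B -> 0 <= a -> 0 <= b -> 0 <= e -> a + b <= B + a + b + e by lra.
have ar3 (q e e' a b g v u : R) : 0 <= q -> e' <= e -> a + b <= e' -> g <= b ->
  v + u + a <= v + q + (u - g) + e by lra.
have ar4 (q e a b g v u f B : R) : 0 <= q -> B + (a + b) + f <= e -> g <= b -> - f <= u -> 0 <= v ->
  B + a <= v + q + (u - g) + e by lra.
have ar5 (a a' b b' e e' f : R) : a <= a' -> b <= b' -> 0 <= e -> 0 <= e' ->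
  a + b + f <= a' + b' + e + e' + f by lra.
move=> T0.
have [B [B0 BP]] := @bounded_states R I J (M + I)
  (fun p => V p.1 + \sum_(k | active net k) `|G k p.1|).
have VG0 x : 0 <= \sum_(k | active net k) `|G k x| by apply: sumr_ge0.
have bnd x : (forall i, x i <= M + I)%N -> V x <= B /\ forall k, active net k -> `|G k x| <= B.
  move=> xM; have := BP x (fun _ _ => 0%N) xM (fun _ _ => leq0n _).
  rewrite /= ger0_norm ?addr_ge0 ?V_ge0// => h; split; first by have := VG0 x; lra.
  move=> k ak; apply: le_trans h; rewrite (bigD1 k)//=.
  have : 0 <= \sum_(i | active net i && (i != k)) `|G i x| by apply: sumr_ge0.
  by have := V_ge0 x; lra.
have [BV [BV0 BVP]] := on_feasible_bounded (fun s => V s.1) (M + I).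
pose r := \sum_(k | active net k) rate k.
have r0 : 0 <= r by apply: sumr_ge0 => k ak; exact: (rate_ge0 netP n0 ak).
pose S : R := \sum_(k | active net k) 1.
have S0 : 0 <= S by apply: sumr_ge0.
pose A := B + c * BV + B * r * occ_cap + B * (1 + S).
have K00 : 0 <= occ_cap by rewrite (le_trans ler01).
have a1 : 0 <= c * BV by rewrite mulr_ge0// ltW.
have a2 : 0 <= B * r * occ_cap by rewrite !mulr_ge0.
have a3 : 0 <= B * (1 + S) by rewrite mulr_ge0// addr_ge0.
have A0 : 0 <= A by rewrite /A !addr_ge0.
exists ((1 + T) * A); split; first by rewrite mulr_ge0// addr_ge0.
move=> w s t rw s0 lt_st tT As.
have h0 : 0 < t - s by rewrite subr_gt0.
have hT : t - s <= T by lra.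
set h := t - s in h0 hT *.
have st : 0 <= s <= t by rewrite s0 ltW.
have t0 : 0 <= t by lra.
set x := X s w.
have [Vx Gx] := bnd x (fun i => leq_trans (X_le_arrivals i rw s0) (leq_trans As (leq_addr _ _))).
have Q0 : 0 <= C * tint Q_path s t w.
  by rewrite mulr_ge0// tint_ge0// => *; exact: Q_path_ge0.
pose D k := jumps k s t w; pose ta k := compensator k s t w.
set SG := \sum_(k | active net k) G k x * _.
set SE := \sum_(k | active net k) (_ + _).
have [GD GDE] := ex_intro (fun r => r = \sum_(k | active net k) G k x * (D k)%:R) _ erefl.
have [GT GTE] := ex_intro (fun r => r = \sum_(k | active net k) G k x * ta k) _ erefl.
have SGE : SG = GD - GT.
  by rewrite GDE GTE -sumrB; apply: eq_bigr => k _; rewrite mulrBr.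
have SE_ge k : active net k -> (D k * (D k).-1)%:R + h * (D k)%:R <= SE.
  move=> ak; rewrite /SE (bigD1 k)//= lerDl; apply: sumr_ge0 => k' _.
  by rewrite addr_ge0// mulr_ge0// ltW.
have SE0 : 0 <= SE by apply: sumr_ge0 => k _; rewrite addr_ge0// mulr_ge0// ltW.
have Sta : GT <= B * r * occ_cap * h.
  rewrite GTE -!mulrA mulr_suml mulr_sumr; apply: ler_sum => k ak.
  have /andP[ta0 ta1] := @compensator_itv k s t w ak (ltW lt_st).
  apply: le_trans (ler_norm _) _; rewrite normrM (ger0_norm ta0).
  apply: (le_trans (ler_wpM2r ta0 (Gx k ak))).
  by rewrite ler_wpM2l// mulrA.
have tV0 : 0 <= tint V_path s t w by rewrite tint_ge0// => *; exact: V_path_ge0.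
have tV : (arrivals t w <= M + I)%N -> tint V_path s t w <= BV * h.
  move=> At; rewrite /h -(tint_cst w BV (ltW lt_st)).
  apply: (@tint_le _ _ _ _ _ _ _ _ BV) => //.
  - exact: measurable_on_feasible.
  - by move=> q /andP[sq qt]; apply: (BVP w t) => //; rewrite (le_trans s0 sq).
  - by move=> q _; rewrite ger0_norm.
  - move=> q /andP[sq qt]; apply: (le_trans (ler_norm _)).
    by apply: (BVP w t) => //; rewrite (le_trans s0 sq).
have tV' : (arrivals t w <= M + I)%N -> c * tint V_path s t w <= c * BV * h.
  by move=> /tV h1; rewrite -mulrA ler_pM2l.
(* [D <= D * (D - 1) + 1] for every natural number [D] *)
have SES : \sum_(k | active net k) (D k)%:R <= SE + S.
  rewrite /S /SE -big_split/=; apply: ler_sum => k ak.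
  apply: (@le_trans _ _ ((D k * (D k).-1)%:R + 1)).
    by rewrite natr1 ler_nat; case: (D k) => // m; rewrite /= ltnS mulSn leq_addr.
  by rewrite lerD2r lerDl mulr_ge0// ltW.
rewrite SGE; clearbody SE; have [Vx' Vx'E] := ex_intro (fun v => v = V x) _ erefl.
have [tVs tVsE] := ex_intro (fun v => v = tint V_path s t w) _ erefl.
have [tQs tQsE] := ex_intro (fun v => v = tint Q_path s t w) _ erefl.
rewrite -Vx'E -tVsE -tQsE; rewrite -Vx'E in Vx; rewrite -tVsE in tV0 tV tV'; rewrite -tQsE in Q0.
have Vx0 : 0 <= Vx' by rewrite Vx'E V_ge0.
have [/forallP all0|/forallPn[k1]] := boolP [forall k, active net k ==> (D k == 0%N)].
  have D0 k : active net k -> D k = 0%N by move=> ak; exact/eqP/(implyP (all0 k)).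
  have [-> -> gb] := step_still rw st As D0.
  have {}gb : c * tVs + GT <= C * tQs by rewrite tVsE tQsE GTE.
  have GD0 : GD = 0 by rewrite GDE big1// => k ak; rewrite D0// mulr0.
  rewrite As mul1r -/x -Vx'E GD0.
  have := mulr_ge0 (mulr_ge0 (addr_ge0 ler01 T0) A0) SE0.
  exact: ar1.
rewrite negb_imply => /andP[ak1 Dk1].
have [/forallP all1|/forallPn[k2]] := boolP [forall k, active net k ==> (D k <= 1)%N].
  have D1 k : active net k -> (D k <= 1)%N by move=> ak; exact: (implyP (all1 k)).
  have At := few_arrivals rw st As D1.
  have bK k : busy k t w - busy k s w <= occ_cap * (t - s) := busy_le k rw st At.
  have VX : V (X t w) <= Vx' + GD.
    rewrite Vx'E GDE; apply: taylor => //; apply: state_jump => // k ak.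
    exact: (used_full ak rw st (bK k)).2.
  have lhs : (arrivals t w <= M)%N%:R * (V (X t w) + c * tVs) <=
      V (X t w) + c * BV * h.
    have V0 := V_ge0 (X t w); have := tV' At; have : 0 <= c * tVs by rewrite mulr_ge0// ltW.
    move=> ? ?; case: (arrivals t w <= M)%N; rewrite ?mul1r ?mul0r; first exact: lerD.
    exact/addr_ge0/(le_trans _ (tV' At)).
  have SEh : h <= SE.
    apply: le_trans (SE_ge k1 ak1); have -> : D k1 = 1%N.
      by apply/eqP; rewrite eqn_leq D1// lt0n.
    by rewrite muln0 add0r mulr1.
  have hh : (c * BV + B * r * occ_cap) * h <= A * SE.
    by apply: (ler_pM (addr_ge0 a1 a2) (ltW h0) _ SEh); exact: ar2.
  have hA : A * SE <= (1 + T) * A * SE.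
    by rewrite -mulrA ler_peMl ?mulr_ge0// lerDl.
  apply: (le_trans lhs); apply: (le_trans (lerD VX (lexx (c * BV * h)))).
  by rewrite mulrDl in hh; exact: (ar3 _ _ _ _ _ _ _ _ Q0 hA hh Sta).
rewrite negb_imply -ltnNge => /andP[ak2 Dk2].
have lhs : (arrivals t w <= M)%N%:R * (V (X t w) + c * tVs) <= B + c * BV * h.
  have [At|_] := boolP (arrivals t w <= M)%N; last by rewrite mul0r addr_ge0// mulr_ge0// ltW.
  have AtI : (arrivals t w <= M + I)%N by rewrite (leq_trans At) ?leq_addr.
  have [VB _] := bnd (X t w) (fun i => leq_trans (X_le_arrivals i rw t0) AtI).
  by rewrite mul1r; apply: lerD => //; exact: tV'.
have SE1 : 1 <= SE.
  apply: le_trans (SE_ge k2 ak2); apply: (@le_trans _ _ (D k2 * (D k2).-1)%:R); last first.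
    by rewrite lerDl mulr_ge0// ltW.
  by rewrite ler1n; move: Dk2; case: (D k2) => [|[|m]].
have SD : - (B * (1 + S) * SE) <= GD.
  have h1 : \sum_(k | active net k) (D k)%:R <= (1 + S) * SE.
    by apply: (le_trans SES); rewrite mulrDl mul1r lerD2l ler_peMr.
  rewrite GDE lerNl -sumrN; apply: (@le_trans _ _ (\sum_(k | active net k) B * (D k)%:R)).
    apply: ler_sum => k ak; rewrite -mulNr ler_wpM2r//.
    by apply: le_trans (Gx k ak); rewrite -normrN ler_norm.
  by rewrite -mulr_sumr -mulrA ler_wpM2l.
have hh : B + (c * BV + B * r * occ_cap) * h + B * (1 + S) * SE <= (1 + T) * A * SE.
  have e1 : B <= B * SE by rewrite ler_peMr.
  have e2 : (c * BV + B * r * occ_cap) * h <= (c * BV + B * r * occ_cap) * T * SE.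
    rewrite -[leRHS]mulrA; apply: ler_wpM2l; first exact: addr_ge0.
    by apply: (le_trans hT); rewrite ler_peMr.
  have e3 : 0 <= T * (B + B * (1 + S)) * SE by rewrite !mulr_ge0// addr_ge0.
  have e4 : 0 <= (c * BV + B * r * occ_cap) * SE by rewrite !mulr_ge0// addr_ge0.
  rewrite (_ : (1 + T) * A * SE = B * SE + (c * BV + B * r * occ_cap) * T * SE
      + T * (B + B * (1 + S)) * SE + (c * BV + B * r * occ_cap) * SE + B * (1 + S) * SE);
    first exact: ar5.
  by rewrite /A; ring.
apply: (le_trans lhs); move: hh; rewrite mulrDl.
move=> hh; exact: (ar4 _ _ _ _ _ _ _ _ _ Q0 hh Sta SD Vx0).
Qed.

End Step.

(** * Expectations of nonnegative variables *)

Section Mean.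
Context (R : realType) (d : measure_display) (Omega : measurableType d).
Context (P : probability Omega R).

Definition nnrv (f : Omega -> R) : Prop := measurable_fun setT f /\ forall w, 0 <= f w.

Definition mean (f : Omega -> R) : \bar R := (\int[P]_w (f w)%:E)%E.

Lemma nnrv_add f g : nnrv f -> nnrv g -> nnrv (fun w => f w + g w).
Proof.
by move=> [mf f0] [mg g0]; split=> [|w]; [exact: measurable_funD|rewrite addr_ge0].
Qed.

Lemma nnrv_mul f g : nnrv f -> nnrv g -> nnrv (fun w => f w * g w).
Proof.
by move=> [mf f0] [mg g0]; split=> [|w]; [exact: measurable_funM|rewrite mulr_ge0].
Qed.

Lemma nnrv_cst r : 0 <= r -> nnrv (fun=> r).
Proof. by move=> r0; split. Qed.

Lemma nnrv_sum (S : Type) (r : seq S) (A : pred S) (f : S -> Omega -> R) :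
  (forall k, A k -> nnrv (f k)) -> nnrv (fun w => \sum_(k <- r | A k) f k w).
Proof.
move=> h; elim: r => [|k r IH].
  by under eq_fun do rewrite big_nil; exact: nnrv_cst.
under eq_fun do rewrite big_cons.
by have [Ak|//] := boolP (A k); exact: nnrv_add (h k Ak) IH.
Qed.

Lemma mean_ge0 f : nnrv f -> (0 <= mean f)%E.
Proof. by move=> [_ f0]; apply: integral_ge0 => w _; rewrite lee_fin. Qed.

Lemma meanD f g : nnrv f -> nnrv g -> mean (fun w => f w + g w) = (mean f + mean g)%E.
Proof.
move=> [mf f0] [mg g0]; rewrite /mean -ge0_integralD//.
- by move=> w _; rewrite lee_fin.
- exact/measurable_EFinP.
- by move=> w _; rewrite lee_fin.
- exact/measurable_EFinP.
Qed.

Lemma meanZ r f : 0 <= r -> nnrv f -> mean (fun w => r * f w) = (r%:E * mean f)%E.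
Proof.
move=> r0 [mf f0]; rewrite /mean -ge0_integralZl//.
- exact/measurable_EFinP.
- by move=> w _; rewrite lee_fin.
Qed.

Lemma mean_sum (S : Type) (r : seq S) (A : pred S) (f : S -> Omega -> R) :
  (forall k, A k -> nnrv (f k)) ->
  mean (fun w => \sum_(k <- r | A k) f k w) = (\sum_(k <- r | A k) mean (f k))%E.
Proof.
move=> h; elim: r => [|k r IH].
  by rewrite /mean; under eq_integral do rewrite big_nil; rewrite big_nil integral0.
rewrite big_cons -IH; have [Ak|nAk] := boolP (A k).
  rewrite -meanD; [|exact: h|exact: nnrv_sum].
  by congr mean; apply/funext => w; rewrite big_cons Ak.
by congr mean; apply/funext => w; rewrite big_cons (negbTE nAk).
Qed.

Lemma mean_le f g : nnrv f -> nnrv g -> {ae P, forall w, f w <= g w} -> (mean f <= mean g)%E.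
Proof.
move=> [mf f0] [mg g0] fg; apply: ae_ge0_le_integral => //.
- by move=> w _; rewrite lee_fin.
- exact/measurable_EFinP.
- by move=> w _; rewrite lee_fin.
- exact/measurable_EFinP.
- by apply: filterS fg => w fgw _; rewrite lee_fin.
Qed.

Lemma mean_eq f g : nnrv f -> nnrv g -> {ae P, forall w, f w = g w} -> mean f = mean g.
Proof.
move=> nf ng fg; apply/eqP; rewrite eq_le !mean_le//.
- by apply: filterS fg => w ->.
- by apply: filterS fg => w ->.
Qed.

Lemma mean_cst r : mean (fun=> r) = r%:E.
Proof. by rewrite /mean integral_cst//= probability_setT mule1. Qed.

Lemma mean_indic A f : measurable A -> nnrv f ->
  nnrv (fun w => \1_A w * f w) /\ mean (fun w => \1_A w * f w) = (\int[P]_(w in A) (f w)%:E)%E.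
Proof.
move=> mA [mf f0]; split.
  by apply: nnrv_mul; split => //; exact: measurable_indic.
rewrite /mean [RHS]integral_mkcond; apply: eq_integral => w _.
by rewrite /patch indicE; case: ifP; rewrite ?mul1r ?mul0r.
Qed.

End Mean.

(** * The Lyapunov inequality in expectation *)

Section Expectation.
Context (R : realType) (I J : nat) (net : network R I J) (n : nat).
Context (d : measure_display) (Omega : measurableType d) (P : probability Omega R).
Context (N : source I J -> R -> Omega -> nat).
Context (X : R -> Omega -> 'I_I -> nat).
Context (Z : R -> Omega -> 'I_I -> 'I_J -> nat).
Context (x0 : 'I_I -> nat).
Hypothesis netP : network_assumptions net.
Hypothesis n0 : (0 < n)%N.
Hypothesis hs : is_system net n P N X Z x0.
Hypothesis ha : admissible net n P N X Z.
Local Notation leb := (@lebesgue_measure R).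
Local Notation rate := (rate net n).
Local Notation past := (past net n P N X Z).
Local Notation occ := (occ net n X Z).
Local Notation busy := (busy net n X Z).
Local Notation cnt := (cnt net n N X Z).
Local Notation incr := (incr net n N X Z).
Local Notation regular := (regular net n N X Z x0).
Local Notation used := (used net n X Z).
Local Notation arrivals := (arrivals net n N X Z x0).

Context (beta : 'rV[R]_I) (kappa C2 c C : R).
Hypotheses (c0 : 0 < c) (C0 : 0 <= C).
Local Notation V := (lyap net n beta kappa).
Local Notation G := (jump_bound net n beta kappa C2).
Local Notation nnrv := (@nnrv R d Omega).
Local Notation mean := (@mean R d Omega P).
Local Notation V_path := (V_path net n X Z beta kappa).
Local Notation Q_path := (Q_path net n X Z kappa).
Local Notation jumps := (jumps net n N X Z).
Local Notation compensator := (compensator net n X Z).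
Local Notation occ_cap := (occ_cap net n).
Hypothesis taylor : forall x x' (D : source I J -> nat),
  (forall k, active net k -> (D k <= 1)%N) ->
  (forall i, (x' i)%:R - (x i)%:R = (D (inl (inl i)))%:R
     - \sum_(j < J | edge net i j) (D (inl (inr (i, j))))%:R - (D (inr i))%:R :> R) ->
  V x' <= V x + \sum_(k | active net k) G k x * (D k)%:R.
Hypothesis gen : forall x z, feasible net n x z ->
  \sum_(k | active net k) G k x * (rate k * (occN net n k (x, z))%:R) <=
  - c * V x + C * (1 + qsum R n x z) `^ kappa.

Lemma measurable_at t (phi : ('I_I -> nat) * ('I_I -> 'I_J -> nat) -> R) : 0 <= t ->
  measurable_fun setT (fun w => phi (X t w, Z t w)).
Proof.
move=> t0 _ Y mY; rewrite setTI.
exact: (measurable_state_at hs (fun s => Y (phi s)) t0).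
Qed.

Lemma measurable_few M t : measurable_fun setT (fun w => (arrivals t w <= M)%N%:R : R).
Proof. exact: (measurable_of_nat (fun m => (m <= M)%N%:R : R) (measurable_arrivals hs t)). Qed.

Section Truncation.
Variable M : nat.

(** While at most [M] customers have arrived, the state takes finitely many
    values: a weight that depends on the state is a finite combination of the
    indicators of these events of the past. *)
Definition cell s (a : {ffun 'I_I -> 'I_M.+1}) : set Omega :=
  [set w | (arrivals s w <= M)%N /\ X s w = (fun i => a i : nat)].

Lemma past_cell s a : 0 <= s -> past s (cell s a).
Proof.
move=> s0; have pastP : sigma_algebra setT (past s) by exact: smallest_sigma_algebra.
have ss : 0 <= s <= s by rewrite s0 lexx.
apply: (salg_setI pastP).
  pose E : set {ffun source I J -> nat} :=
    [set f | (\sum_(i < I) (x0 i + f (inl (inl i))) <= M)%N].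
  have pE : past s [set w | E [ffun k => if active net k then
      time_changed net n N X Z k s w else 0%N]] by exact: past_counts.
  apply: (past_ae pE).
    have := measurable_arrivals hs s => mA.
    by apply: (salg_preimage (@sigma_algebra_measurable _ Omega) _ [set k | (k <= M)%N]);
      apply: (measurable_fun_natP _).2.
  apply: filterS (regular_ae netP hs ha) => w [_ cb].
  rewrite /E /=; under eq_bigr do rewrite ffunE /=.
  rewrite /arrivals.
  suff -> : (\sum_(i < I) (x0 i + time_changed net n N X Z (inl (inl i)) s w))%N =
     (\sum_(i < I) (x0 i + cnt (inl (inl i)) s w))%N by [].
  by apply: eq_bigr => i _; rewrite /time_changed (cb (inl (inl i)) s isT s0).
exact: (past_state hs ha (fun st => st.1 = (fun i => a i : nat)) ss).
Qed.

Lemma measurable_cell s a : 0 <= s -> measurable (cell s a).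
Proof. by move=> s0; exact: (past_measurable hs (past_cell a s0)). Qed.

Lemma mean_cells s (phi : ('I_I -> nat) -> R) f : 0 <= s -> (forall x, 0 <= phi x) -> nnrv f ->
  nnrv (fun w => (arrivals s w <= M)%N%:R * phi (X s w) * f w) /\
  mean (fun w => (arrivals s w <= M)%N%:R * phi (X s w) * f w) =
  (\sum_(a : {ffun 'I_I -> 'I_M.+1}) (phi (fun i => a i : nat))%:E * \int[P]_(w in cell s a) (f w)%:E)%E.
Proof.
move=> s0 phi0 nf.
have nl : nnrv (fun w => (arrivals s w <= M)%N%:R * phi (X s w) * f w).
  apply: nnrv_mul => //; apply: nnrv_mul; first by split => //; exact: measurable_few.
  by split => //; exact: (measurable_at (fun st => phi st.1) s0).
split => //.
have nc a : nnrv (fun w => \1_(cell s a) w * f w) := (mean_indic P (measurable_cell a s0) nf).1.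
have np (a : {ffun 'I_I -> 'I_M.+1}) : nnrv (fun w => phi (fun i => a i : nat) * (\1_(cell s a) w * f w)).
  by apply: nnrv_mul => //; exact: nnrv_cst.
transitivity (mean (fun w => \sum_(a : {ffun 'I_I -> 'I_M.+1}) phi (fun i => a i : nat) * (\1_(cell s a) w * f w))).
  apply: mean_eq => //; first exact: nnrv_sum.
  apply: filterS (regular_ae netP hs ha) => w rw.
  have [As|nAs] := boolP (arrivals s w <= M)%N; last first.
    rewrite !mul0r big1// => a _; rewrite indicE memNset ?mul0r ?mulr0//.
    by move=> [h _]; rewrite h in nAs.
  pose a : {ffun 'I_I -> 'I_M.+1} := [ffun i => inord (X s w i)].
  have aE : X s w = (fun i => a i : nat).
    apply/funext => i; rewrite ffunE inordK// ltnS.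
    exact: leq_trans (X_le_arrivals i rw s0) As.
  rewrite (bigD1 a)//= indicE mem_set; last by split.
  rewrite big1 ?addr0 -?aE ?mul1r// => b ba.
  rewrite indicE memNset ?mul0r ?mulr0// => -[_ bE].
  move/eqP: ba; apply; apply/ffunP => i; apply: val_inj => /=.
  by rewrite -[RHS](congr1 (fun g => g i) aE) (congr1 (fun g => g i) bE).
rewrite mean_sum//; apply: eq_bigr => a _.
by rewrite meanZ// (mean_indic P (measurable_cell a s0) nf).2.
Qed.

Lemma occ_cap_ge0 : 0 <= occ_cap M. Proof. by []. Qed.

Lemma horizon_ge0 s t : s < t -> 0 <= occ_cap M * (t - s).
Proof. by move=> st; rewrite mulr_ge0 ?occ_cap_ge0// subr_ge0 ltW. Qed.

Lemma nnrv_jumps k s t (g : nat -> R) : active net k -> (forall m, 0 <= g m) ->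
  nnrv (fun w => g (jumps M k s t w)).
Proof.
move=> ak g0; split=> [|w]; last exact: g0.
apply: measurable_of_nat; apply: (measurable_incr hs) => //.
exact: (measurable_used hs).
Qed.

Lemma nnrv_compensator k s t : active net k -> s < t -> nnrv (compensator M k s t).
Proof.
move=> ak st; split=> [|w].
  by apply: measurable_funM => //; exact: (measurable_used hs).
by rewrite mulr_ge0 ?(rate_ge0 netP n0 ak)//; have /andP[] := used_itv net n X Z k s t w (horizon_ge0 st).
Qed.

Lemma mean_weighted k s t (phi : ('I_I -> nat) -> R) : active net k -> 0 <= s -> s < t ->
  (forall x, 0 <= phi x) ->
  let m := mean (fun w => (arrivals s w <= M)%N%:R * phi (X s w) * compensator M k s t w) in
  mean (fun w => (arrivals s w <= M)%N%:R * phi (X s w) * (jumps M k s t w)%:R) = m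
  /\ m \is a fin_num.
Proof.
move=> ak s0 st phi0 /=; have K0s := horizon_ge0 st.
have ntau := nnrv_compensator ak st.
have mart a := martingale netP n0 hs ha (past_cell a s0) ak s0 st K0s.
rewrite (mean_cells s0 phi0 ntau).2.
rewrite (mean_cells s0 phi0 (nnrv_jumps s t ak (fun m => ler0n R m))).2; split.
  by apply: eq_bigr => a _; rewrite mart.
apply/sum_fin_numP => a _ _; rewrite fin_numM// ge0_fin_numE; last first.
  by apply: integral_ge0 => w _; rewrite lee_fin ntau.2.
have mc := measurable_cell a s0.
apply: (@le_lt_trans _ _ (\int[P]_(w in cell s a) (rate k * (occ_cap M * (t - s)))%:E)%E).
  apply: ge0_le_integral => //.
  - by move=> w _; rewrite lee_fin ntau.2.
  - by apply: measurable_funTS; apply/measurable_EFinP; exact: ntau.1.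
  - move=> w _; rewrite lee_fin /compensator ler_wpM2l ?(rate_ge0 netP n0 ak)//.
    by have /andP[] := used_itv net n X Z k s t w K0s.
by rewrite integral_cst// ltey_eq fin_numM// fin_num_measure.
Qed.

(** The second factorial moment is quadratic in the length of the step, which is
    why multiple jumps are negligible. *)
Lemma mean_errors k s t : active net k -> 0 <= s -> s < t ->
  (mean (fun w => (jumps M k s t w)%:R) <= (rate k * (occ_cap M * (t - s)))%:E)%E /\
  (mean (fun w => (jumps M k s t w * (jumps M k s t w).-1)%:R) <=
     ((rate k * (occ_cap M * (t - s))) ^+ 2)%:E)%E.
Proof.
move=> ak s0 st; have K0s := horizon_ge0 st.
have dle w : (jumps M k s t w <= incr k s (occ_cap M * (t - s))%R w)%N.
  apply: (incr_monotone netP n0 hs) => //.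
  by have /andP[] := used_itv net n X Z k s t w K0s.
have ni (g : nat -> R) : (forall m, 0 <= g m) ->
    nnrv (fun w => g (incr k s (occ_cap M * (t - s))%R w)).
  move=> g0; split=> [|w]; last exact: g0.
  apply: measurable_of_nat; exact: (measurable_incr hs s ak (measurable_cst (occ_cap M * (t - s)))).
split.
  have := incr_mean netP n0 hs ha (salg_setT _ : past s setT) ak s0 K0s.
  rewrite probability_setT mul1e => <-; last exact: smallest_sigma_algebra.
  apply: mean_le; [exact: (nnrv_jumps _ _ _ (fun m => ler0n R m))|exact: (ni (fun m => m%:R))|].
  by apply: aeW => w; rewrite ler_nat dle.
rewrite -(incr_moment2 netP n0 hs ha ak s0 K0s).
apply: mean_le.
- exact: (@nnrv_jumps k s t (fun m => (m * m.-1)%:R)).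
- exact: (ni (fun m => (m * m.-1)%:R)).
- apply: aeW => w; rewrite ler_nat; apply: leq_mul => //.
  by rewrite -!subn1 leq_sub2r.
Qed.

(** The truncation makes the Lyapunov function bounded. *)
Definition potential t w : R := (arrivals t w <= M)%N%:R * (V (X t w) + c * tint V_path 0 t w).

Lemma tint_path_nnrv phi s t : (forall x, 0 <= phi x) ->
  nnrv (tint (on_feasible net n X Z phi) s t).
Proof.
move=> phi0; split.
  by apply: measurable_tint; exact: (measurable_on_feasible hs).
move=> w; apply: tint_ge0 => r _; rewrite /on_feasible /on_path.
by do 2 case: ifP => // _.
Qed.

Lemma nnrv_V_path s t : nnrv (tint V_path s t).
Proof. by apply: tint_path_nnrv => x; exact: powR_ge0. Qed.

Lemma nnrv_Q_path s t : nnrv (tint Q_path s t).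
Proof. by apply: tint_path_nnrv => x; exact: powR_ge0. Qed.

Lemma nnrv_VX t : 0 <= t -> nnrv (fun w => V (X t w)).
Proof.
move=> t0; split; last by move=> w; exact: powR_ge0.
exact: (measurable_at (fun st => V st.1) t0).
Qed.

Lemma nnrv_VV t : 0 <= t -> nnrv (fun w => V (X t w) + c * tint V_path 0 t w).
Proof.
move=> t0; apply: nnrv_add; first exact: nnrv_VX.
by apply: nnrv_mul; [exact/nnrv_cst/ltW|exact: nnrv_V_path].
Qed.

Lemma nnrv_potential t : 0 <= t -> nnrv (potential t).
Proof.
move=> t0; apply: nnrv_mul; last exact: nnrv_VV.
by split => //; exact: measurable_few.
Qed.

Lemma V_path_add r s t w : regular w -> 0 <= r -> r <= s <= t ->
  tint V_path r t w = tint V_path r s w + tint V_path s t w.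
Proof.
move=> rw r0 rst.
have [B [_ BP]] := on_feasible_bounded netP n0 hs (fun st => V st.1) (arrivals t w).
have /andP[rs st] := rst; have t0 : 0 <= t by rewrite (le_trans r0)// (le_trans rs).
apply: (@tint_add _ _ _ _ _ _ _ _ B) => //; first exact: (measurable_on_feasible hs).
by move=> q /andP[rq qt]; apply: (BP w t) => //; rewrite (le_trans r0 rq).
Qed.

Lemma Q_path_add r s t w : regular w -> 0 <= r -> r <= s <= t ->
  tint Q_path r t w = tint Q_path r s w + tint Q_path s t w.
Proof.
move=> rw r0 rst.
have [B [_ BP]] := on_feasible_bounded netP n0 hs (fun st => (1 + qsum R n st.1 st.2) `^ kappa)
  (arrivals t w).
have /andP[rs st] := rst; have t0 : 0 <= t by rewrite (le_trans r0)// (le_trans rs).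
apply: (@tint_add _ _ _ _ _ _ _ _ B) => //; first exact: (measurable_on_feasible hs).
by move=> q /andP[rq qt]; apply: (BP w t) => //; rewrite (le_trans r0 rq).
Qed.

(** The compensated jumps have mean zero.  The positive and the negative parts of
    their weights are kept on opposite sides, so that only nonnegative variables
    are integrated; the common finite value of both sides cancels. *)
Lemma step_mean T : 0 <= T -> exists C' : R, 0 <= C' /\ forall s t,
  0 <= s -> s < t -> t <= T ->
  (mean (potential t) <= mean (potential s) + C%:E * mean (tint Q_path s t) + (C' * (t - s) ^+ 2)%:E)%E.
Proof.
move=> T0; have [CM [CM0 core]] := step_core netP n0 hs M c0 C0 taylor gen T0.
exists (CM * \sum_(k | active net k) ((rate k * occ_cap M) ^+ 2 + rate k * occ_cap M)); split.
  apply: mulr_ge0 => //; apply: sumr_ge0 => k ak.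
  by rewrite addr_ge0 ?sqr_ge0// mulr_ge0// (rate_ge0 netP n0 ak).
move=> s t s0 st tT; have t0 : 0 <= t by rewrite (le_trans s0)// ltW.
pose Gp k x := Num.max (G k x) 0; pose Gm k x := Num.max (- G k x) 0.
have GpmE k x : Gp k x - Gm k x = G k x.
  by rewrite /Gp /Gm; have [h|h] := leP (G k x) 0; [rewrite max_l ?oppr_ge0// sub0r opprK
    |rewrite max_r ?oppr_le0 ?ltW// subr0].
have Gp0 k x : 0 <= Gp k x by rewrite le_max lexx orbT.
have Gm0 k x : 0 <= Gm k x by rewrite le_max lexx orbT.
pose D k w : R := (jumps M k s t w)%:R.
pose one w : R := (arrivals s w <= M)%N%:R.
pose lo w := \sum_(k | active net k) (one w * Gp k (X s w) * compensator M k s t w + one w * Gm k (X s w) * D k w).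
pose up w := \sum_(k | active net k) (one w * Gp k (X s w) * D k w + one w * Gm k (X s w) * compensator M k s t w).
pose err w := \sum_(k | active net k) ((jumps M k s t w * (jumps M k s t w).-1)%:R + (t - s) * D k w).
have h0 : 0 <= t - s by rewrite subr_ge0 ltW.
have nD k : active net k -> nnrv (D k) by move=> ak; exact: (nnrv_jumps s t ak (fun m => ler0n R m)).
have nDD k : active net k -> nnrv (fun w => (jumps M k s t w * (jumps M k s t w).-1)%:R).
  by move=> ak; exact: (@nnrv_jumps k s t (fun m => (m * m.-1)%:R)).
have nerr : nnrv err.
  apply: nnrv_sum => k ak; apply: nnrv_add; first exact: nDD.
  by apply: nnrv_mul; [exact: nnrv_cst|exact: nD].
have np k := fun ak : active net k => (mean_cells s0 (Gp0 k) (nnrv_compensator ak st)).1.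
have nm k := fun ak : active net k => (mean_cells s0 (Gm0 k) (nD k ak)).1.
have np' k := fun ak : active net k => (mean_cells s0 (Gp0 k) (nD k ak)).1.
have nm' k := fun ak : active net k => (mean_cells s0 (Gm0 k) (nnrv_compensator ak st)).1.
have nlo : nnrv lo by apply: nnrv_sum => k ak; apply: nnrv_add; [exact: np|exact: nm].
have nup : nnrv up by apply: nnrv_sum => k ak; apply: nnrv_add; [exact: np'|exact: nm'].
have loE : mean lo = (\sum_(k | active net k)
    (mean (fun w => one w * Gp k (X s w) * compensator M k s t w)%R
     + mean (fun w => one w * Gm k (X s w) * compensator M k s t w)%R))%E.
  rewrite mean_sum => [|k ak]; last by apply: nnrv_add; [exact: np|exact: nm].
  apply: eq_bigr => k ak; rewrite meanD; [|exact: np|exact: nm].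
  by congr (_ + _)%E; exact: (mean_weighted ak s0 st (Gm0 k)).1.
have lofin : mean lo \is a fin_num.
  rewrite loE; apply/sum_fin_numP => k _ ak.
  by rewrite fin_numD (mean_weighted ak s0 st (Gp0 k)).2 (mean_weighted ak s0 st (Gm0 k)).2.
have upE : mean up = mean lo.
  rewrite loE mean_sum => [|k ak]; last by apply: nnrv_add; [exact: np'|exact: nm'].
  apply: eq_bigr => k ak; rewrite meanD; [|exact: np'|exact: nm'].
  by congr (_ + _)%E; exact: (mean_weighted ak s0 st (Gp0 k)).1.
have errE : (mean err <= ((\sum_(k | active net k) ((rate k * occ_cap M) ^+ 2 + rate k * occ_cap M))
     * (t - s) ^+ 2)%:E)%E.
  rewrite mean_sum => [|k ak]; last first.
    by apply: nnrv_add; [exact: nDD|apply: nnrv_mul; [exact: nnrv_cst|exact: nD]].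
  rewrite mulr_suml -sumEFin; apply: lee_sum => k ak.
  rewrite meanD; [|exact: nDD|by apply: nnrv_mul; [exact: nnrv_cst|exact: nD]].
  rewrite meanZ//; last exact: nD.
  have [e1 e2] := mean_errors ak s0 st.
  apply: (@le_trans _ _ (((rate k * (occ_cap M * (t - s))) ^+ 2)%:E
      + (t - s)%:E * (rate k * (occ_cap M * (t - s)))%:E)%E).
    by apply: leeD => //; apply: lee_wpmul2l; rewrite ?lee_fin.
  by rewrite -EFinM -EFinD lee_fin le_eqVlt; apply/orP; left; apply/eqP; ring.
have nQ := nnrv_Q_path s t.
have nCQ : nnrv (fun w => C * tint Q_path s t w) by apply: nnrv_mul; [exact: nnrv_cst|].
have nE : nnrv (fun w => CM * err w) by apply: nnrv_mul; [exact: nnrv_cst|].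
have ps := nnrv_potential s0; have pt := nnrv_potential t0.
have ar (v v' q a a' u l e b : R) : 0 <= b <= 1 -> b * (v' + a') <= v + q + (u - l) + e -> 0 <= a ->
  b * (v' + (a + a')) + l <= (v + a + q + u + e).
  move=> /andP[b0 b1] h a0; have : b * a <= a by rewrite ler_piMl.
  by rewrite addrCA mulrDr; lra.
have path : (mean (fun w => potential t w + lo w)%R <=
    mean (fun w => potential s w + C * tint Q_path s t w + up w + CM * err w)%R)%E.
  apply: mean_le; first exact: nnrv_add.
    by apply: nnrv_add => //; apply: nnrv_add => //; exact: nnrv_add.
  apply: filterS (regular_ae netP hs ha) => w rw.
  have [As|nAs] := boolP (arrivals s w <= M)%N; last first.
    have At : (arrivals t w <= M)%N = false.
      by apply: contraNF nAs; apply: leq_trans; apply: (arrivals_mono netP n0 hs rw s0); exact: ltW.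
    rewrite /potential At (negbTE nAs) !mul0r add0r.
    rewrite /lo big1 => [|k _]; last by rewrite /one (negbTE nAs) !mul0r addr0.
    by rewrite add0r !addr_ge0 ?nCQ.2 ?nup.2 ?nE.2.
  have := core w s t rw s0 st tT As.
  have -> : \sum_(k | active net k) G k (X s w) * ((jumps M k s t w)%:R - compensator M k s t w) = up w - lo w.
    rewrite /up /lo -sumrB; apply: eq_bigr => k _; rewrite /one As !mul1r -(GpmE k (X s w)) /D; ring.
  rewrite /potential As mul1r => h.
  rewrite (@V_path_add 0 s t w rw (lexx 0)) ?s0 ?(ltW st)// [c * (_ + _)]mulrDr.
  apply: (ar _ _ _ _ _ _ _ _ _ _ h); first by case: (_ <= M)%N; rewrite ?lexx ler01.
  by apply: mulr_ge0; [exact: ltW|exact: (nnrv_V_path 0 s).2].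
have n1 : nnrv (fun w => potential s w + C * tint Q_path s t w) by exact: nnrv_add.
have n2 : nnrv (fun w => potential s w + C * tint Q_path s t w + up w) by exact: nnrv_add.
move: path; rewrite (meanD P pt nlo) (meanD P n2 nE) (meanD P n1 nup) (meanD P ps nCQ).
rewrite upE (meanZ P C0 nQ) (meanZ P CM0 nerr) [leRHS]addeAC.
rewrite (leeD2rE _ _ lofin) => /le_trans; apply; apply: leeD2l.
apply: (le_trans (lee_wpmul2l _ errE)); rewrite ?lee_fin//.
by rewrite -mulrA.
Qed.

Lemma busy0 k w : busy k 0 w = 0.
Proof. by rewrite /busy /tint set_itv1 Rintegral_set1. Qed.

Lemma cnt0 k w : active net k -> cnt k 0 w = 0%N.
Proof.
by move=> ak; rewrite /cnt busy0 mulr0 (poisson_zero (sys_poisson hs ak)).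
Qed.

Lemma regular_start w : regular w -> X 0 w = x0.
Proof.
move=> [bal _]; apply/funext => i; have := bal 0 i (lexx 0).
rewrite !cnt0// big1 ?addn0// => j e; exact: cnt0.
Qed.

Lemma potential_start : (mean (potential 0) <= (V x0)%:E)%E.
Proof.
rewrite -[leRHS](mean_cst P); apply: mean_le.
- exact: nnrv_potential.
- by apply: nnrv_cst; exact: powR_ge0.
apply: filterS (regular_ae netP hs ha) => w rw.
rewrite /potential (regular_start rw) /tint set_itv1 Rintegral_set1 mulr0 addr0.
by case: (_ <= M)%N; rewrite ?mul1r ?mul0r ?powR_ge0.
Qed.

Lemma mean_Q_path_add s t : 0 <= s <= t ->
  (mean (tint Q_path 0 s) + mean (tint Q_path s t) = mean (tint Q_path 0 t))%E.
Proof.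
move=> st; have n1 := nnrv_Q_path 0 s; have n2 := nnrv_Q_path s t.
rewrite -(meanD P n1 n2); apply: mean_eq; [exact: nnrv_add|exact: nnrv_Q_path|].
apply: filterS (regular_ae netP hs ha) => w rw.
by rewrite (Q_path_add rw (lexx 0) st).
Qed.

(** The error per step is quadratic in the mesh, hence disappears in the limit. *)
Lemma potential_bound t : 0 <= t ->
  (mean (potential t) <= (V x0)%:E + C%:E * mean (tint Q_path 0 t))%E.
Proof.
move=> t0; have [C' [C'0 step]] := step_mean t0.
have mQ s s' : (0 <= mean (tint Q_path s s'))%E by apply: mean_ge0; exact: nnrv_Q_path.
have [t1|tp] := leP t 0.
  have {t1 step t0} -> : t = 0 by apply/eqP; rewrite eq_le t1.
  by apply: (le_trans potential_start); rewrite leeDl// mule_ge0.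
apply/lee_addgt0Pr => e e0.
pose m := (Num.truncn (C' * t ^+ 2 / e)).+1.
have m0 : 0 < m%:R :> R by rewrite ltr0n.
have mP : C' * t ^+ 2 / m%:R <= e.
  rewrite ler_pdivrMr// -ler_pdivrMl// [_^-1 * _]mulrC; exact/ltW/truncnS_gt.
pose h := t / m%:R; have h0 : 0 < h by rewrite divr_gt0.
have regroup (A a b : \bar R) (u v z : R) : z = u + v -> (0 <= a)%E -> (0 <= b)%E ->
    (A + C%:E * a + u%:E + C%:E * b + v%:E <= A + C%:E * (a + b) + z%:E)%E.
  move=> -> a0 b0; rewrite ge0_muleDr// EFinD.
  move: (C%:E * a)%E (C%:E * b)%E => a' b'.
  by rewrite -!addeA (addeCA u%:E).
have grid l : (l <= m)%N -> (mean (potential (l%:R * h)) <=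
    (V x0)%:E + C%:E * mean (tint Q_path 0 (l%:R * h)) + (l%:R * (C' * h ^+ 2))%:E)%E.
  elim: l => [_|l IH lm].
    rewrite !mul0r adde0; apply: (le_trans potential_start).
    by rewrite leeDl// mule_ge0.
  have lh0 : 0 <= l%:R * h by rewrite mulr_ge0// ltW.
  have lt1 : l%:R * h < l.+1%:R * h by rewrite ltr_pM2r// ltr_nat.
  have le2 : l.+1%:R * h <= t.
    by rewrite /h mulrCA ler_piMr// ?(ltW tp)// ler_pdivrMr// mul1r ler_nat.
  apply: (le_trans (step _ _ lh0 lt1 le2)).
  have -> : l.+1%:R * h - l%:R * h = h by rewrite -natr1; ring.
  apply: (@le_trans _ _ (((V x0)%:E + C%:E * mean (tint Q_path 0 (l%:R * h))
      + (l%:R * (C' * h ^+ 2))%:E) + C%:E * mean (tint Q_path (l%:R * h) (l.+1%:R * h))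
      + (C' * h ^+ 2)%:E)%E).
    by apply: leeD => //; apply: leeD => //; exact: IH (ltnW lm).
  rewrite -(@mean_Q_path_add (l%:R * h) (l.+1%:R * h)) ?lh0 ?(ltW lt1)//.
  apply: regroup; rewrite ?mQ//.
  by rewrite -natr1 mulrDl mul1r.
have := grid m (leqnn m).
have -> : m%:R * h = t by rewrite /h mulrC divfK// gt_eqF.
move=> /le_trans; apply; apply: leeD2l; rewrite lee_fin; apply: le_trans mP.
rewrite le_eqVlt; apply/orP; left; apply/eqP.
by rewrite /h; field; rewrite gt_eqF.
Qed.

End Truncation.

(** The truncation is removed by monotone convergence. *)
Lemma lyapunov_mean t : 0 <= t ->
  (mean (fun w => V (X t w) + c * tint V_path 0 t w)%R <=
   (V x0)%:E + C%:E * mean (tint Q_path 0 t))%E.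
Proof.
move=> t0; have [mV V0] := nnrv_VV t0.
pose F M := [set w | (arrivals t w <= M)%N].
have mF M : measurable (F M).
  by apply: (salg_preimage (@sigma_algebra_measurable _ Omega) _ [set k | (k <= M)%N]);
    apply: (measurable_fun_natP _).2; exact: (measurable_arrivals hs).
have FT : \bigcup_M F M = setT.
  by apply/seteqP; split => // w _; exists (arrivals t w) => //; rewrite /F /= leqnn.
have := @ge0_nondecreasing_set_cvg_integral _ _ _ F
  (fun w => (V (X t w) + c * tint V_path 0 t w)%:E) P.
rewrite FT => h.
have Fcvg : (\int[P]_(w in F M) (V (X t w) + c * tint V_path 0 t w)%:E)%E @[M --> \oo] -->
    mean (fun w => V (X t w) + c * tint V_path 0 t w).
  apply: h => //.
  - by move=> m k mk; rewrite subsetEset => w; rewrite /F /=; move: mk => /[swap] /leq_trans; apply.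
  - by move=> M; apply: measurable_funTS; exact/measurable_EFinP.
  - by move=> M w _; rewrite lee_fin V0.
apply: (cvge_to_le Fcvg); apply: nearW => M.
apply: le_trans (potential_bound M t0).
rewrite -(mean_indic P (mF M) (nnrv_VV t0)).2 le_eqVlt; apply/orP; left; apply/eqP.
congr mean; apply/funext => w; rewrite /potential indicE; congr (_%:R * _).
by congr nat_of_bool; apply/idP/idP; rewrite inE.
Qed.

End Expectation.

(** * From the Lyapunov function to the state *)

Section Comparison.
Context (R : realType) (I J : nat) (net : network R I J) (n : nat).
Context (d : measure_display) (Omega : measurableType d) (P : probability Omega R).
Context (N : source I J -> R -> Omega -> nat).
Context (X : R -> Omega -> 'I_I -> nat).
Context (Z : R -> Omega -> 'I_I -> 'I_J -> nat).
Context (x0 : 'I_I -> nat).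
Hypothesis netP : network_assumptions net.
Hypothesis n0 : (0 < n)%N.
Hypothesis hs : is_system net n P N X Z x0.
Hypothesis ha : admissible net n P N X Z.
Local Notation leb := (@lebesgue_measure R).
Local Notation arrivals := (arrivals net n N X Z x0).
Local Notation mean := (@mean R d Omega P).
Local Notation state := (('I_I -> nat) * ('I_I -> 'I_J -> nat))%type.
Local Notation masked := (on_feasible net n X Z).

(** The integrals over the time interval are insensitive to the exceptional times
    at which the control is not admissible. *)
Lemma mean_path (phi : state -> R) T : (forall s, 0 <= phi s) -> 0 <= T ->
  (\int[P]_w \int[leb]_(s in `[0%R, T]) (phi (X s w, Z s w))%:E =
   mean (tint (masked phi) 0 T))%E.
Proof.
move=> phi0 T0; have p0 p : (0 <= (on_path X Z phi p)%:E)%E.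
  by rewrite lee_fin /on_path; case: ifP.
have mp : measurable_fun setT (fun p => (on_path X Z phi p)%:E).
  by apply/measurable_EFinP; exact: (measurable_on_path hs).
have E w : (\int[leb]_(s in `[0%R, T]) (phi (X s w, Z s w))%:E =
    \int[leb]_(s in `[0%R, T]) (on_path X Z phi (s, w))%:E)%E.
  apply: eq_integral => s; rewrite inE /= in_itv/= => /andP[s0 _].
  by rewrite /on_path /= s0.
have [mt t0] := tint_path_nnrv hs 0 T phi0.
under eq_integral do rewrite E.
apply: ge0_ae_eq_integral => //.
- exact: (measurable_time_integral 0 T mp p0).
- exact/measurable_EFinP.
- by move=> w _; exact: integral_ge0.
- by move=> w _; rewrite lee_fin.
apply: filterS2 (regular_ae netP hs ha) (feasible_ae netP hs ha) => w rw fw _.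
have mm := measurable_on_feasible hs phi.
have [B [_ BP]] := on_feasible_bounded netP n0 hs phi (arrivals T w).
have int := path_integrable mm (fun s => BP w T rw T0 (leqnn _) s).
rewrite /tint /Rintegral fineK; last exact: integrable_fin_num.
apply: ge0_ae_eq_integral => //.
- by apply: measurable_funTS; apply/measurable_EFinP; apply: measurable_path; exact: (measurable_on_path hs).
- by apply: measurable_funTS; apply/measurable_EFinP; exact: measurable_path.
- by move=> s _; rewrite lee_fin /on_feasible /on_path; case: ifP => //= _; case: ifP.
have [A [mA A0 sub]] := fw; exists A; split => // s /= nE; apply: sub => /= fs.
apply: nE; rewrite in_itv /= => /andP[s0 _].
by rewrite /on_feasible /on_path /= s0 fs.
Qed.

Lemma mean_path_le (phi psi : state -> R) (a : R) T : 0 <= a ->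
  (forall s, 0 <= phi s) -> (forall s, 0 <= psi s) -> 0 <= T ->
  (forall x z, feasible net n x z -> phi (x, z) <= a * psi (x, z)) ->
  (mean (tint (masked phi) 0 T) <= a%:E * mean (tint (masked psi) 0 T))%E.
Proof.
move=> a0 phi0 psi0 T0 le.
have nphi := tint_path_nnrv hs 0 T phi0; have npsi := tint_path_nnrv hs 0 T psi0.
rewrite -(meanZ P a0 npsi); apply: mean_le => //.
  by apply: nnrv_mul => //; exact: nnrv_cst.
apply: filterS (regular_ae netP hs ha) => w rw.
have mphi := measurable_on_feasible hs phi; have mpsi := measurable_on_feasible hs psi.
have [B [B0 BP]] := on_feasible_bounded netP n0 hs phi (arrivals T w).
have [B' [B'0 B'P]] := on_feasible_bounded netP n0 hs psi (arrivals T w).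
have bphi := BP w T rw T0 (leqnn _); have bpsi := B'P w T rw T0 (leqnn _).
rewrite -(tintZ a mpsi bpsi).
apply: (@tint_le _ _ _ _ _ _ _ _ (B + a * B')) => //.
- exact: measurable_funM.
- by move=> s sT; apply: (le_trans (bphi s sT)); rewrite lerDl mulr_ge0.
- move=> s sT; rewrite normrM (ger0_norm a0).
  by apply: (le_trans (ler_wpM2l a0 (bpsi s sT))); rewrite lerDr.
move=> s /andP[s0 _]; rewrite /on_feasible /on_path /= s0.
by case: ifP => [f|]; [exact: le|rewrite mulr0].
Qed.

Context (beta : 'rV[R]_I) (kappa c C : R).
Hypotheses (c0 : 0 < c) (C0 : 0 <= C).
Local Notation V := (lyap net n beta kappa).
Local Notation V_path := (V_path net n X Z beta kappa).
Local Notation Q_path := (Q_path net n X Z kappa).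
Hypothesis bound : forall t, 0 <= t ->
  (mean (fun w => V (X t w) + c * tint V_path 0 t w)%R <=
   (V x0)%:E + C%:E * mean (tint Q_path 0 t))%E.

(** For [T < 1] the term [V x0] does not carry the factor [T] that the final
    bound requires; integrating the bound at each time [t <= T] supplies it. *)
Lemma mean_V_path T : 0 < T ->
  (mean (tint V_path 0 T) <=
   ((1 + c^-1) * (Num.min 1 T * V x0))%:E + ((1 + c^-1) * C)%:E * mean (tint Q_path 0 T))%E.
Proof.
move=> T0; have nQ := nnrv_Q_path hs kappa 0 T; have mQ := mean_ge0 P nQ.
have nV := nnrv_V_path hs beta kappa 0 T.
have Vx0 : 0 <= V x0 by exact: powR_ge0.
have ci : 0 <= c^-1 by rewrite invr_ge0 ltW.
have intc (B : \bar R) : (\int[leb]_(s in `[0%R, T]) B = T%:E * B)%E.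
  by rewrite integral_cst//= lebesgue_measure_itv/= lte_fin T0 oppr0 adde0 muleC.
have divc (x y : \bar R) : (c%:E * x <= y)%E -> (x <= c^-1%:E * y)%E.
  move=> xy; have -> : x = (c^-1%:E * (c%:E * x))%E.
    by rewrite muleA -EFinM mulVf ?mul1e// gt_eqF.
  by apply: lee_wpmul2l => //; rewrite lee_fin.
have [T1|T1] := leP 1 T.
  have h1 : (c%:E * mean (tint V_path 0 T) <= (V x0)%:E + C%:E * mean (tint Q_path 0 T))%E.
    apply: le_trans (bound (ltW T0)); rewrite -(meanZ P (ltW c0) nV).
    apply: mean_le.
    - by apply: nnrv_mul => //; exact/nnrv_cst/ltW.
    - exact: (nnrv_VV hs beta kappa c0 (ltW T0)).
    - by apply: aeW => w; rewrite lerDr; exact: powR_ge0.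
  apply: (le_trans (divc _ _ h1)).
  rewrite ge0_muleDr ?lee_fin ?mule_ge0// muleA -!EFinM; apply: leeD.
    by rewrite mul1r lee_fin ler_wpM2r// lerDr.
  by apply: lee_wpmul2r => //; rewrite lee_fin ler_wpM2r// lerDr.
have V0' (s : state) : 0 <= V s.1 by exact: powR_ge0.
have mE := mean_path V0' (ltW T0).
apply: (@le_trans _ _ (\int[P]_w \int[leb]_(s in `[0%R, T]) (V (X s w, Z s w).1)%:E)%E).
  by rewrite le_eqVlt; apply/orP; left; apply/eqP; exact: (esym mE).
have mp : measurable_fun setT (fun p => (on_path X Z (fun s => V s.1) p)%:E).
  by apply/measurable_EFinP; exact: (measurable_on_path hs).
have p0 p : (0 <= (on_path X Z (fun s => V s.1) p)%:E)%E.
  by rewrite lee_fin /on_path; case: ifP.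
have -> : (\int[P]_w \int[leb]_(s in `[0%R, T]) (V (X s w, Z s w).1)%:E =
   \int[P]_w \int[leb]_(s in `[0%R, T]) (on_path X Z (fun s => V s.1) (s, w))%:E)%E.
  apply: eq_integral => w _; apply: eq_integral => s; rewrite inE /= in_itv/= => /andP[s0 _].
  by rewrite /on_path /= s0.
rewrite (time_tonelli P 0 T mp p0).
have at_s s : `[0%R, T]%classic s -> (\int[P]_w (on_path X Z (fun s => V s.1) (s, w))%:E <=
    (V x0)%:E + C%:E * mean (tint Q_path 0 T))%E.
  rewrite /= in_itv/= => /andP[s0 sT].
  apply: (@le_trans _ _ (mean (fun w => V (X s w) + c * tint V_path 0 s w)%R)).
    have := nnrv_VX hs beta kappa s0 => nVs.
    apply: (@le_trans _ _ (mean (fun w => V (X s w)))).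
      by rewrite le_eqVlt; apply/orP; left; apply/eqP/eq_integral => w _; rewrite /on_path /= s0.
    apply: mean_le => //; first exact: (nnrv_VV hs beta kappa c0 s0).
    apply: aeW => w; rewrite lerDl mulr_ge0 ?(ltW c0)//.
    exact: (nnrv_V_path hs beta kappa 0 s).2.
  apply: (le_trans (bound s0)); apply: leeD2l.
  apply: lee_wpmul2l; first by rewrite lee_fin.
  apply: (mean_le (nnrv_Q_path hs kappa 0 s) nQ).
  apply: filterS (regular_ae netP hs ha) => w rw.
  have s0T : 0 <= s <= T by rewrite s0.
  rewrite -subr_ge0 (Q_path_add netP n0 hs kappa rw (lexx 0) s0T) addrAC subrr add0r.
  exact: (nnrv_Q_path hs kappa s T).2.
apply: (@le_trans _ _ (\int[leb]_(s in `[0%R, T]) ((V x0)%:E + C%:E * mean (tint Q_path 0 T)))%E).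
  apply: ge0_le_integral => //.
  - by move=> s _; exact: integral_ge0.
  - apply: measurable_funTS.
    exact: (@measurable_fun_fubini_tonelli_F _ _ _ _ _ P _ mp p0).
rewrite intc ge0_muleDr ?lee_fin ?mule_ge0// muleA -!EFinM; apply: leeD.
  by rewrite lee_fin ler_peMl ?mulr_ge0 ?(ltW T0)// lerDl.
apply: lee_wpmul2r => //; rewrite lee_fin ler_wpM2r//.
by apply: (le_trans (ltW T1)); rewrite lerDl.
Qed.

End Comparison.

Theorem proposition6p2 (R : realType) (I J : nat) (net : network R I J)
    (Psi : 'rV[R]_I -> 'rV[R]_J -> 'M[R]_(I, J)) :
  network_assumptions net -> is_Psi net Psi -> FL_plus net Psi ->
  forall kappa : R, 1 <= kappa ->
  exists C0 C1 : R,
  forall (n : nat) (d : measure_display) (Omega : measurableType d)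
    (P : probability Omega R) (N : source I J -> R -> Omega -> nat)
    (X : R -> Omega -> 'I_I -> nat) (Z : R -> Omega -> 'I_I -> 'I_J -> nat)
    (x0 : 'I_I -> nat),
  (0 < n)%N -> is_system net n P N X Z x0 -> admissible net n P N X Z ->
  forall T : R, 0 < T ->
  (\int[P]_w \int[lebesgue_measure]_(s in `[0%R, T])
      (enorm (X_hat net n (X s w)) `^ kappa)%:E
   <= C0%:E * (T + enorm (X_hat net n x0) `^ kappa)%:E
      + C1%:E * \int[P]_w \int[lebesgue_measure]_(s in `[0%R, T])
          ((1 + enorm (Q_hat R n (X s w) (Z s w))) `^ kappa)%:E)%E.

Proof.
move=> netP PsiP FL kappa k1; have k0 : 0 <= kappa by lra.
have [beta [b0 gen]] := sys_generator_le netP PsiP FL k1.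
have [C2 [C20 jumps]] := lyapunov_jump net b0 k1 #|{: source I J}|.
have [c [C [c0 C0 {}gen]]] := gen C2 C20.
have [a1 [a10 a1P]] := enorm_powR_le b0 k0.
have [a2 [a20 a2P]] := powR_sqbnorm_le b0 k0.
have [a3 [a30 a3P]] := @qsum_powR_le R I J kappa k0.
pose b := 1 + c^-1; have b00 : 0 <= b by rewrite addr_ge0// invr_ge0 ltW.
exists (a1 * (b * a2)), (a1 * (b * C) * a3) => n d Omega P N X Z x0 n0 hs ha T T0.
have bound := lyapunov_mean netP n0 hs ha c0 C0
  (fun x x' D => lyap_jump n0 jumps) (fun x z f => generator_sources n0 netP f (gen n x z n0 f)).
pose phi (s : ('I_I -> nat) * ('I_I -> 'I_J -> nat)) := enorm (X_hat net n s.1) `^ kappa.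
pose psi (s : ('I_I -> nat) * ('I_I -> 'I_J -> nat)) := (1 + enorm (Q_hat R n s.1 s.2)) `^ kappa.
have phi0 s : 0 <= phi s by exact: powR_ge0.
have psi0 s : 0 <= psi s by exact: powR_ge0.
have T0' := ltW T0.
rewrite (mean_path netP n0 hs ha phi0 T0') (mean_path netP n0 hs ha psi0 T0').
have V0 (s : ('I_I -> nat) * ('I_I -> 'I_J -> nat)) : 0 <= lyap net n beta kappa s.1 by exact: powR_ge0.
have Q0 (s : ('I_I -> nat) * ('I_I -> 'I_J -> nat)) : 0 <= (1 + qsum R n s.1 s.2) `^ kappa by exact: powR_ge0.
apply: (le_trans (mean_path_le netP n0 hs ha a10 phi0 V0 T0' (fun x z _ => a1P _))).
have hV := mean_V_path netP n0 hs ha c0 C0 bound T0.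
have hQ := mean_path_le netP n0 hs ha a30 Q0 psi0 T0' (fun x z f => a3P n x z (qsum_ge0 n0 f)).
have bC : 0 <= b * C by rewrite mulr_ge0.
have nQ := mean_ge0 P (tint_path_nnrv hs 0 T psi0).
apply: (@le_trans _ _ (a1%:E * ((b * (Num.min 1 T * lyap net n beta kappa x0))%:E +
   (b * C)%:E * (a3%:E * mean P (tint (on_feasible net n X Z psi) 0 T))))%E).
  apply: lee_wpmul2l; first by rewrite lee_fin.
  by apply: (le_trans hV); apply: leeD2l; apply: lee_wpmul2l; rewrite ?lee_fin.
have mT : 0 <= Num.min 1 T by rewrite le_min ler01 ltW.
have Vx : lyap net n beta kappa x0 <= a2 * (1 + enorm (X_hat net n x0) `^ kappa) := a2P _.
have Vx0 : 0 <= lyap net n beta kappa x0 by exact: powR_ge0.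
have e0 : 0 <= enorm (X_hat net n x0) `^ kappa by exact: powR_ge0.
move: (lyap net n beta kappa x0) (enorm _ `^ kappa) (mean P _) Vx Vx0 e0 nQ => v e m Vx Vx0 e0 m0.
rewrite ge0_muleDr ?lee_fin ?mule_ge0 ?lee_fin ?mulr_ge0// !muleA -!EFinM; apply: leeD => //.
rewrite lee_fin -!mulrA ler_wpM2l// ler_wpM2l//.
apply: (le_trans (ler_wpM2l mT Vx)).
rewrite mulrCA ler_wpM2l// mulrDr mulr1; apply: lerD; first by rewrite ge_min lexx orbT.
by rewrite ler_piMl// ge_min lexx.
Qed.
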